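(* Assume that there exists a distance $d_{\mathcal I}$ on $\mathcal I$ such that for every apartment $A$ of $\mathcal I$, $d_{\mathcal I}|_{A^2}$ is induced by some norm. Then $\mathcal I$ is a building and $d_{\mathcal I}|_{\mathbb A^2}$ is $W^a$-invariant.
   Context: **Vectorial data.** $I$ is a finite set and $C=(c_{i,j})_{i,j\in I}$ is a Kac--Moody matrix: $c_{i,j}\in\mathbb Z$, $c_{i,i}=2$, $c_{i,j}\le 0$ for $i\neq j$, and $c_{i,j}=0\iff c_{j,i}=0$. $X,Y$ are dual free $\mathbb Z$-modules of finite rank with $\mathbb Z$-linearly independent families $(\alpha_i)_{i\in I}$ in $X$ and $(\alpha_i^\vee)_{i\in I}$ in $Y$ such that $\alpha_j(\alpha_i^\vee)=c_{i,j}$. $\mathbb A=Y\otimes\mathbb R$, with its usual topology; elements of $X$ are linear forms on $\mathbb A$. $r_i(v)=v-\alpha_i(v)\alpha_i^\vee$, and $W^v=\langle r_i\mid i\in I\rangle\subset \mathrm{GL}(\mathbb A)$ (Weyl group), acting on $\mathbb A^*$ by $(w.\alpha)(x)=\alpha(w^{-1}x)$. $\Phi=\{w.\alpha_i\}$ is the set of real roots; for $\alpha=w.\alpha_i\in\Phi$, $\alpha^\vee=w.\alpha_i^\vee$. $Q^\vee=\bigoplus_i\mathbb Z\alpha_i^\vee$ and $W^a=Q^\vee\rtimes W^v$ (affine Weyl group, acting on $\mathbb A$ by affine maps). $\Delta\subset\bigoplus_i\mathbb Z\alpha_i\subset\mathbb A^*$ is the set of all (real and imaginary) roots of the Kac--Moody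 algebra of $C$. For $\alpha\in\mathbb A^*$, $k\in\mathbb R$: $D(\alpha,k)=\{\alpha(x)+k\ge0\}$, $D^\circ(\alpha,k)=\{\alpha(x)+k>0\}$, $M(\alpha,k)=\{\alpha(x)+k=0\}$, and $D(\alpha,+\infty)=D^\circ(\alpha,+\infty)=\mathbb A$. Walls (resp. half-apartments) are the $M(\alpha,k)$ (resp. $D(\alpha,k)$), $\alpha\in\Phi$, $k\in\mathbb Z$. $C^v_f=\{v\mid\alpha_i(v)>0\ \forall i\}$; for $J\subset I$, $F^v(J)=\{v\mid \alpha_i(v)=0\ (i\in J),\ \alpha_i(v)>0\ (i\notin J)\}$. Positive (resp. negative) vectorial faces are the $w.F^v(J)$ (resp. $-w.F^v(J)$), $w\in W^v$; vectorial chambers are the $\pm w.C^v_f$. Tits cone: $\mathcal T=\bigcup_{w}w.\overline{C^v_f}$. A vectorial face is spherical if it meets $\pm\mathring{\mathcal T}$. $x\le y$ means $y-x\in\mathcal T$. A ray or segment through $x\ne y$ from $x$ is preordered if $x\le y$ or $y\le x$, generic if $y-x\in\pm\mathring{\mathcal T}$. **Filters.** A filter lies in a set $Z$ if $Z$ is an element of it; a set (e.g. an apartment) contains a filter if it contains an element of it; a map fixes a filter if it fixes pointwise some element of it. The support of a filter is the smallest affine subspace containing it. $\mathcal F\Cup\mathcal F'=\{E\cup E'\mid E\in\mathcal F,E'\in\mathcal F'\}$. The enclosure $\mathrm{cl}(\mathcal F)$ of a filter on $\mathbb A$ is the filter of sets $E$ containing some $\bigcap_{\alpha\in\Delta}D(\alpha,k_\alpha)\in\mathcal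 F$ with $k_\alpha\in\mathbb Z\cup\{+\infty\}$ (a set is treated as its principal filter). The face $F(x,F^v)$ ($x\in\mathbb A$, $F^v$ a vectorial face) is the filter of sets $E$ for which there are $k_\alpha,k'_\alpha\in\mathbb Z\cup\{+\infty\}$ $(\alpha\in\Delta)$ and a neighbourhood $\Omega$ of $x$ with $E\supset\bigcap_{\alpha}(D(\alpha,k_\alpha)\cap D^\circ(\alpha,k'_\alpha))\supset\Omega\cap(x+F^v)$. A chamber (resp. panel) is a face with support $\mathbb A$ (resp. a wall). A chimney is $\mathfrak r(F,F^v)=\mathrm{cl}(F+F^v)$, $F$ a face, $F^v$ a vectorial face; it is splayed if $F^v$ is spherical, solid if the pointwise stabilizer in $W^v$ of the direction of its support is finite. Its germ is the filter of sets belonging to some $\mathfrak r(F+u,F^v)$, $u\in\overline{F^v}$. **Apartments.** $\mathrm{Aut}(\mathbb A)$ is the group of affine bijections of $\mathbb A$ stabilizing $\{(M(\alpha,k),\alpha^\vee)\mid\alpha\in\Phi,k\in\mathbb Z\}$. An apartment of type $\mathbb A$ is a set $A$ with a nonempty set $\mathrm{Isom}^w(\mathbb A,A)$ of bijections $\mathbb A\to A$ forming one orbit $f_0\circ W^a$. A bijection $\phi:A\to A'$ is a Weyl isomorphism (resp. an isomorphism, which here always means vectorially Weyl isomorphism) if $f'^{-1}\circ\phi\circ f\in W^a$ (resp. $\in(W^v\ltimes\mathbb A)\cap\mathrm{Aut}(\mathbb A)$) for $f\in\mathrm{Isom}^w(\mathbb A,A)$, $f'\in\mathrm{Isom}^w(\mathbb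 A,A')$. All above notions, the affine structure and the affine topology are transported to every apartment. A distance on an apartment is induced by a norm if it is $(x,y)\mapsto\|x-y\|$ for a norm on its underlying vector space. **Masure.** A masure of type $\mathbb A$ is a set $\mathcal I$ covered by a family of subsets called apartments such that: (MA1) each apartment has a structure of apartment of type $\mathbb A$. (MA2) If $F$ is a point, a germ of a preordered interval, a generic ray or a solid chimney in an apartment $A$, and $A'$ is another apartment containing $F$, then $A\cap A'$ contains $\mathrm{cl}_A(F)$ and there is a Weyl isomorphism $A\to A'$ fixing $\mathrm{cl}_A(F)$. (MA3) If $\mathfrak R$ is the germ of a splayed chimney and $F$ is a face or a germ of a solid chimney, some apartment contains $\mathfrak R$ and $F$. (MA4) If apartments $A,A'$ contain $\mathfrak R$ and $F$ as in (MA3), there is a Weyl isomorphism $A\to A'$ fixing $\mathrm{cl}_A(\mathfrak R\Cup F)$. (MAO) If $x,y\in A\cap A'$ and $x\le_A y$ then $[x,y]_A=[x,y]_{A'}$. Standing assumptions: $\mathcal I$ is such a masure; each panel lies in the closure of finitely many, and more than $2$, chambers; a group $G$ acts strongly transitively on $\mathcal I$ (it permutes apartments, each $g:A\to g.A$ is an isomorphism of apartments, and all isomorphisms in the axioms are induced by elements of $G$); $\mathbb A$ is identified with a fixed apartment of $\mathcal I$, and the stabilizer of $\mathbb A$ in $G$ induces on $\mathbb A$ the group $W^v\ltimes Y$. $\mathcal I$ is a building if and only if $W^v$ is finite. *)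

(* Defs.v *)
From HB Require Import structures.
From mathcomp Require Export all_boot all_order all_fingroup all_algebra.
From mathcomp Require Export complex.
From mathcomp Require Export all_classical all_reals all_analysis.

Set Implicit Arguments.
Unset Strict Implicit.
Unset Printing Implicit Defensive.

Export Order.TTheory GRing.Theory Num.Theory.
Export numFieldNormedType.Exports.

#[global] Open Scope classical_set_scope.
#[global] Open Scope ring_scope.

Definition lin_indep (I : finType) (K : nzRingType) (V : lmodType K)
    (v : I -> V) : Prop :=
  forall c : I -> K, \sum_i c i *: v i = 0 -> forall i, c i = 0.

Definition kac_moody_matrix (I : finType) (C : I -> I -> int) : Prop :=
  [/\ forall i, C i i = 2,
      forall i j, i != j -> C i j <= 0
    & forall i j, C i j = 0 <-> C j i = 0].

Definition lin_subspace (K : nzRingType) (V : lmodType K) (S : set V) : Prop :=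
  S 0 /\ forall (a : K) x y, S x -> S y -> S (a *: x + y).

(* The Kac-Moody algebra of [C] over [K], with Cartan subalgebra the image of
   ['cV[K]_km_dim], following Kac, "Infinite dimensional Lie algebras", ch. 1:
   a minimal realization [(km_root, km_coroot)] of [C], Chevalley generators,
   and no nonzero ideal meeting the Cartan subalgebra trivially. *)
Record kac_moody_algebra (K : fieldType) (I : finType) (C : I -> I -> int) := {
  km_alg :> lmodType K;
  km_br : km_alg -> km_alg -> km_alg;
  km_br_linear_r : forall x, linear (km_br x);
  km_br_linear_l : forall y, linear (km_br^~ y);
  km_br_alt : forall x, km_br x x = 0;
  km_jacobi : forall x y z,
    km_br x (km_br y z) + km_br y (km_br z x) + km_br z (km_br x y) = 0;
  km_dim : nat;
  km_root : I -> 'rV[K]_km_dim;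
  km_coroot : I -> 'cV[K]_km_dim;
  km_root_free : lin_indep km_root;
  km_coroot_free : lin_indep km_coroot;
  km_pairing : forall i j,
    (km_root j *m km_coroot i) 0 0 = (C i j)%:~R;
  km_minimal : (km_dim +
    \rank (\matrix_(i < #|I|, j < #|I|)
             ((C (enum_val i) (enum_val j))%:~R : K)) = 2 * #|I|)%N;
  km_cartan : {linear 'cV[K]_km_dim -> km_alg};
  km_cartan_inj : injective km_cartan;
  km_e : I -> km_alg;
  km_f : I -> km_alg;
  km_cartan_comm : forall u v, km_br (km_cartan u) (km_cartan v) = 0;
  km_ef : forall i j,
    km_br (km_e i) (km_f j) = if i == j then km_cartan (km_coroot i) else 0;
  km_he : forall u i,
    km_br (km_cartan u) (km_e i) = (km_root i *m u) 0 0 *: km_e i;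
  km_hf : forall u i,
    km_br (km_cartan u) (km_f i) = - ((km_root i *m u) 0 0 *: km_f i);
  km_generated : forall S : set km_alg,
    lin_subspace S -> (forall x y, S x -> S y -> S (km_br x y)) ->
    (forall u, S (km_cartan u)) -> (forall i, S (km_e i)) ->
    (forall i, S (km_f i)) -> S = setT;
  km_no_ideal : forall J : set km_alg,
    lin_subspace J -> (forall x y, J y -> J (km_br x y)) ->
    J `&` range km_cartan = [set 0] -> J = [set 0]
}.

(* [b] stands for the weight [\sum_i b i alpha_i]; every weight of the adjoint
   representation is of this form. *)
Definition km_is_root (K : fieldType) (I : finType) (C : I -> I -> int)
    (g : kac_moody_algebra K C) (b : I -> int) : Prop :=
  (exists i, b i != 0) /\
  exists2 x : g, x != 0 &
    forall u, km_br (km_cartan g u) x =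
      (\sum_i (b i)%:~R * (km_root g i *m u) 0 0) *: x.

(* X and Y are row and column vectors over int, put in duality by the
   matrix product. *)
Record root_datum (I : finType) (C : I -> I -> int) (n : nat) := {
  simple_root : I -> 'rV[int]_n;
  simple_coroot : I -> 'cV[int]_n;
  simple_root_free : lin_indep simple_root;
  simple_coroot_free : lin_indep simple_coroot;
  root_coroot : forall i j, (simple_root j *m simple_coroot i) 0 0 = C i j
}.

Section StandardApartment.
Context (R : realType) (I : finType) (C : I -> I -> int) (n : nat).
Context (S : root_datum C n) (g : kac_moody_algebra R[i] C).

Local Notation V := 'cV[R]_n.

Definition ev (a : 'rV[R]_n) (x : V) : R := (a *m x) 0 0.

Definition alpha (i : I) : 'rV[R]_n := map_mx intr (simple_root S i).
Definition alphav (i : I) : V := map_mx intr (simple_coroot S i).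

Definition simple_reflection (i : I) : 'M[R]_n := 1%:M - alphav i *m alpha i.

(* The generators are involutions, so closure under left multiplication by
   them already gives a subgroup of GL. *)
Inductive weyl : 'M[R]_n -> Prop :=
| weyl1 : weyl 1%:M
| weylM i w : weyl w -> weyl (simple_reflection i *m w).

Definition coroot_of (a : 'rV[R]_n) (av : V) : Prop :=
  exists w i, [/\ weyl w, a = alpha i *m invmx w & av = w *m alphav i].

Definition real_roots : set 'rV[R]_n := [set a | exists av, coroot_of a av].

Definition coroot_lattice : set V :=
  [set q | exists c : I -> int, q = \sum_i (c i)%:~R *: alphav i].

Definition all_roots : set 'rV[R]_n :=
  [set a | exists2 b, km_is_root g b & a = \sum_i (b i)%:~R *: alpha i].

Definition affine_weyl : set (V -> V) :=
  [set u | exists w q,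
     [/\ weyl w, coroot_lattice q & u = fun x => w *m x + q]].

Definition weyl_lattice : set (V -> V) :=
  [set u | exists w (y : 'cV[int]_n),
     weyl w /\ u = fun x => w *m x + map_mx intr y].

(* [None] is the value +oo. *)
Definition half (a : 'rV[R]_n) (k : option int) : set V :=
  if k is Some z then [set x | 0 <= ev a x + z%:~R] else setT.

Definition open_half (a : 'rV[R]_n) (k : option int) : set V :=
  if k is Some z then [set x | 0 < ev a x + z%:~R] else setT.

Definition hyperplane (a : 'rV[R]_n) (k : int) : set V :=
  [set x | ev a x + k%:~R = 0].

Definition is_wall (M : set V) : Prop :=
  exists a k, real_roots a /\ M = hyperplane a k.

Definition coroot_walls : set (set V * V) :=
  [set p | exists a av k, coroot_of a av /\ p = (hyperplane a k, av)].

Definition apartment_aut : set (V -> V) :=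
  [set u | exists L t, [/\ L \in unitmx, u = (fun x => L *m x + t) &
     (fun p : set V * V => (u @` p.1, L *m p.2)) @` coroot_walls
       = coroot_walls]].

Definition vweyl_aut : set (V -> V) :=
  [set u | exists w t, weyl w /\ u = fun x => w *m x + t] `&` apartment_aut.

Definition positive_vface (w : 'M[R]_n) (J : {set I}) : set V :=
  (fun v => w *m v) @`
    [set v | forall i, if i \in J then ev (alpha i) v = 0
                       else 0 < ev (alpha i) v].

Definition is_vface (Fv : set V) : Prop :=
  exists w J, weyl w /\
    (Fv = positive_vface w J \/ Fv = -%R @` positive_vface w J).

Definition fund_chamber : set V := [set v | forall i, 0 < ev (alpha i) v].

Definition tits_cone : set V :=
  [set x | exists w v, [/\ weyl w, closure fund_chamber v & x = w *m v]].

Definition pm_tits_interior : set V :=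
  tits_cone° `|` -%R @` tits_cone°.

Definition spherical (Fv : set V) : Prop := Fv `&` pm_tits_interior !=set0.

Definition tits_le (x y : V) : Prop := tits_cone (y - x).

Definition segment (x y : V) : set V :=
  [set z | exists t : R, 0 <= t <= 1 /\ z = x + t *: (y - x)].

Definition ray (x y : V) : set V :=
  [set z | exists t : R, 0 <= t /\ z = x + t *: (y - x)].

Definition affine_subspace (E : set V) : Prop :=
  E !=set0 /\
  forall x y (t : R), E x -> E y -> E ((1 - t) *: x + t *: y).

Definition has_support (F : set_system V) (E : set V) : Prop :=
  [/\ affine_subspace E, F E &
      forall E', affine_subspace E' -> F E' -> E `<=` E'].

Definition direction (E : set V) : set V :=
  [set v | exists x y, [/\ E x, E y & v = x - y]].

Definition enclosure (F : set_system V) : set_system V :=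
  [set E | exists k : 'rV[R]_n -> option int,
     let P := \bigcap_(a in all_roots) half a (k a) in F P /\ P `<=` E].

Definition face (x : V) (Fv : set V) : set_system V :=
  [set E | exists (k k' : 'rV[R]_n -> option int) (Om : set V),
     let P := \bigcap_(a in all_roots) (half a (k a) `&` open_half a (k' a)) in
     [/\ nbhs x Om, P `<=` E & Om `&` [set x + v | v in Fv] `<=` P]].

Definition is_face (F : set_system V) : Prop :=
  exists x Fv, is_vface Fv /\ F = face x Fv.

Definition is_chamber (F : set_system V) : Prop :=
  is_face F /\ has_support F setT.

Definition is_panel (F : set_system V) : Prop :=
  is_face F /\ exists2 M, is_wall M & has_support F M.

Definition filter_sum (F : set_system V) (Z : set V) : set_system V :=
  [set E | exists2 E0, F E0 & [set x + v | x in E0 & v in Z] `<=` E].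

Definition chimney (F : set_system V) (Fv : set V) : set_system V :=
  enclosure (filter_sum F Fv).

Definition chimney_germ (F : set_system V) (Fv : set V) : set_system V :=
  [set E | exists2 u, closure Fv u & chimney (filter_sum F [set u]) Fv E].

Definition solid (F : set_system V) (Fv : set V) : Prop :=
  exists2 E, has_support (chimney F Fv) E &
    finite_set [set w | weyl w /\ forall v, direction E v -> w *m v = v].

Definition is_solid_chimney (F : set_system V) : Prop :=
  exists F0 Fv, [/\ is_face F0, is_vface Fv, solid F0 Fv & F = chimney F0 Fv].

Definition is_solid_germ (F : set_system V) : Prop :=
  exists F0 Fv,
    [/\ is_face F0, is_vface Fv, solid F0 Fv & F = chimney_germ F0 Fv].

Definition is_splayed_germ (F : set_system V) : Prop :=
  exists F0 Fv,
    [/\ is_face F0, is_vface Fv, spherical Fv & F = chimney_germ F0 Fv].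

Definition is_preordered_germ (F : set_system V) : Prop :=
  exists x y, [/\ x != y, tits_le x y \/ tits_le y x &
                  F = within (segment x y) (nbhs x)].

Definition is_generic_ray (F : set_system V) : Prop :=
  exists x y, [/\ x != y, pm_tits_interior (y - x) & F = globally (ray x y)].

Definition is_point (F : set_system V) : Prop :=
  exists x, F = globally [set x].

End StandardApartment.

Record apartment_system (R : realType) (n : nat) := {
  points :> Type;
  apartments : set (set points);
  isomW : set points -> set ('cV[R]_n -> points)
}.

Section Masure.
Context (R : realType) (I : finType) (C : I -> I -> int) (n : nat).
Context (S : root_datum C n) (g : kac_moody_algebra R[i] C).
Context (M : apartment_system R n).

Local Notation V := 'cV[R]_n.

(* A filter [F] on the standard apartment is transported to a filter [f @ F]
   on [M] by a chart [f]. As filters are stable by supersets, a set [A]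
   contains [F] iff [F A]. *)

Definition apartment_structure (A : set M) : Prop :=
  exists f0 : V -> M, [/\ injective f0, range f0 = A &
    isomW A = [set f0 \o u | u in affine_weyl S]].

Definition weyl_isom (A A' : set M) (phi : M -> M) : Prop :=
  forall f f', isomW A f -> isomW A' f' ->
    exists2 u, affine_weyl S u & forall x, phi (f x) = f' (u x).

Definition vweyl_isom (A A' : set M) (phi : M -> M) : Prop :=
  forall f f', isomW A f -> isomW A' f' ->
    exists2 u, vweyl_aut S u & forall x, phi (f x) = f' (u x).

Definition fixes (phi : M -> M) (F : set_system M) : Prop :=
  exists2 E, F E & forall x, E x -> phi x = x.

Definition filter_cup (F F' : set_system M) : set_system M :=
  [set E | exists E1 E2, [/\ F E1, F' E2 & E = E1 `|` E2]].

(* cl_A, computed in the chart [f] of [A], for a filter [F] such that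
   [F A] *)
Definition enclosure_in (f : V -> M) (F : set_system M) : set_system M :=
  f @ enclosure S g [set E | F (f @` E)].

Definition transported (P : set_system V -> Prop) (A : set M)
    (F : set_system M) : Prop :=
  exists f F0, [/\ isomW A f, P F0 & F = f @ F0].

Definition transported_any (P : set_system V -> Prop) (F : set_system M) :
    Prop := exists2 A, apartments A & transported P A F.

Definition MA2_filter (F : set_system V) : Prop :=
  [\/ is_point F, is_preordered_germ S F, is_generic_ray S F
    | is_solid_chimney S g F].

Definition MA2_config (A A' : set M) (f : V -> M) (F : set_system M) : Prop :=
  [/\ apartments A, apartments A', isomW A f,
      transported MA2_filter A F & F A'].

Definition MA3_pair (Rg F : set_system M) : Prop :=
  transported_any (is_splayed_germ S g) Rg /\
  (transported_any (is_face S g) F \/ transported_any (is_solid_germ S g) F).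

Definition MA4_config (A A' : set M) (f : V -> M) (Rg F : set_system M) :
    Prop :=
  [/\ apartments A, apartments A', isomW A f, MA3_pair Rg F &
      [/\ Rg A, F A, Rg A' & F A']].

Record is_masure : Prop := {
  masure_cover : forall x : M, exists2 A, apartments A & A x;
  MA1 : forall A : set M, apartments A -> apartment_structure A;
  MA2 : forall A A' f F, MA2_config A A' f F ->
    enclosure_in f F (A `&` A') /\
    exists2 phi, weyl_isom A A' phi & fixes phi (enclosure_in f F);
  MA3 : forall Rg F, MA3_pair Rg F ->
    exists2 A, apartments A & Rg A /\ F A;
  MA4 : forall A A' f Rg F, MA4_config A A' f Rg F ->
    exists2 phi, weyl_isom A A' phi &
      fixes phi (enclosure_in f (filter_cup Rg F));
  MAO : forall (A A' : set M) (f f' : V -> M) (x y x' y' : V),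
    apartments A -> apartments A' -> isomW A f -> isomW A' f' ->
    f x = f' x' -> f y = f' y' -> tits_le S x y ->
    f @` segment x y = f' @` segment x' y'
}.

Definition in_closure_of_chamber (P Ch : set_system M) : Prop :=
  exists A f F, [/\ apartments A, isomW A f, is_chamber S g F,
    Ch = f @ F & forall E, F E -> P (f @` closure E)].

Definition thick_finite_panels : Prop :=
  forall P, transported_any (is_panel S g) P ->
    let Chs := [set Ch | in_closure_of_chamber P Ch] in
    finite_set Chs /\ (`I_3 #<= Chs)%card.

Definition induced_on (A : set M) (phi psi : M -> M) : Prop :=
  forall x, A x -> psi x = phi x.

Record strongly_transitive (G : groupType) (act : G -> M -> M) : Prop := {
  act1 : forall x, act 1%g x = x;
  actM : forall a b x, act (a * b)%g x = act a (act b x);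
  act_apartment : forall a A, apartments A -> apartments (act a @` A);
  act_isom : forall a A, apartments A -> vweyl_isom A (act a @` A) (act a);
  act_MA2 : forall A A' f F phi, MA2_config A A' f F ->
    weyl_isom A A' phi -> fixes phi (enclosure_in f F) ->
    exists a, induced_on A phi (act a);
  act_MA4 : forall A A' f Rg F phi, MA4_config A A' f Rg F ->
    weyl_isom A A' phi -> fixes phi (enclosure_in f (filter_cup Rg F)) ->
    exists a, induced_on A phi (act a)
}.

(* [iota] is the identification of the standard apartment with [A0]. *)
Definition stabilizer_induces (G : groupType) (act : G -> M -> M)
    (A0 : set M) (iota : V -> M) : Prop :=
  forall u : V -> V,
    weyl_lattice S u <->
    exists a, act a @` A0 = A0 /\ forall x, act a (iota x) = iota (u x).

(* A Euclidean building of type [(V, W^a)]: the apartments are Euclidean, i.e.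
   the Weyl group is finite; any two facets lie in a common apartment; two
   apartments containing two given facets are related by an isomorphism fixing
   both; the intersection of two apartments is a union of facets. *)
Definition is_building : Prop :=
  [/\ finite_set [set w | weyl (R := R) S w],
      forall F F', transported_any (is_face S g) F ->
        transported_any (is_face S g) F' ->
        exists2 A, apartments A & F A /\ F' A,
      forall A A' F F', apartments A -> apartments A' ->
        transported_any (is_face S g) F -> transported_any (is_face S g) F' ->
        F A -> F' A -> F A' -> F' A' ->
        exists2 phi, weyl_isom A A' phi & fixes phi (filter_cup F F')
    & forall A A' x, apartments A -> apartments A' -> A x -> A' x ->
        exists F, [/\ transported (is_face S g) A F,
          forall E, F E -> E x & F (A `&` A')]].

Definition is_distance (d : M -> M -> R) : Prop :=
  [/\ forall x y, d x y = 0 <-> x = y,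
      forall x y, d x y = d y x
    & forall x y z, d x z <= d x y + d y z].

Definition is_norm (N : V -> R) : Prop :=
  [/\ forall x, N x = 0 -> x = 0,
      forall (a : R) x, N (a *: x) = `|a| * N x
    & forall x y, N (x + y) <= N x + N y].

Definition induced_by_norm (d : M -> M -> R) (A : set M) : Prop :=
  forall f, isomW A f ->
    exists2 N, is_norm N & forall x y, d (f x) (f y) = N (x - y).

End Masure.

(* Main.v *)
From HB Require Import structures.
Require Import Defs.
From mathcomp Require Import ring lra zify.

(* Charts of two apartments that agree on a nonempty open set give the same norm,
   because both compute the distance [d] there. Let [P] be a panel of a simple
   wall of the standard apartment and [Ch] a third chamber on [P]. Retracting
   [Ch] to the standard apartment from sector germs on the two sides of the wall
   gives two isometric pictures of [Ch], on opposite sides of the wall, related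
   through [Ch] by an element of the affine Weyl group that preserves the norm and
   fixes the wall; up to a transvection this is the simple reflection. The
   isometries in the Weyl group preserve a norm and a lattice, hence form a finite
   group; averaging a scalar product over it shows that the Cartan matrix is
   invertible, which kills the transvection. So the Weyl group preserves the norm
   and is finite.

   When the Weyl group is finite, every pair of points is preordered, so the
   intersection of two apartments is convex, and finitely many charts agree with a
   given one at one of its points; a convex set covered by finitely many flats
   lies in one of them, so a single isomorphism fixes the whole intersection. *)

(** Enclosures, faces and chimneys are cut out by all roots, imaginary ones included, of an algebra
    known only through its characterising properties. Hence the algebraic preliminaries: every root
    has coefficients of one sign, and the set of roots is stable under the Weyl group and under
    negation. The sign replaces local finiteness: infinitely many roots may matter near a point, but
    a comparison on the simple roots controls all positive roots at once.

    The distance makes (MAO) rigid. The axiom only identifies two segments as sets; comparing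
    lengths from an end identifies their points one by one, and also lets agreement of two charts on
    a beginning of a segment pass to its other end.

    The comparison of the two retractions is determined on the wall, but outside it only up to a
    vector [c]. *)

Set Implicit Arguments.
Unset Strict Implicit.
Unset Printing Implicit Defensive.

(** * Kac--Moody algebras: triangular decomposition and sign of roots *)

Section KacMoody.
Context (K : fieldType) (I : finType) (C : I -> I -> int).

(* The relations of the Kac-Moody algebra without generation, simplicity and
   freeness; they also hold in the product of two copies, where the graph of the
   Chevalley involution lives. *)
Record chevalley_relations := {
  cr_alg :> lmodType K;
  cr_br : cr_alg -> cr_alg -> cr_alg;
  cr_br_linear_r : forall x, linear (cr_br x);
  cr_br_linear_l : forall y, linear (cr_br^~ y);
  cr_br_alt : forall x, cr_br x x = 0;
  cr_jacobi : forall x y z,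
    cr_br x (cr_br y z) + cr_br y (cr_br z x) + cr_br z (cr_br x y) = 0;
  cr_dim : nat;
  cr_root : I -> 'rV[K]_cr_dim;
  cr_coroot : I -> 'cV[K]_cr_dim;
  cr_cartan : {linear 'cV[K]_cr_dim -> cr_alg};
  cr_e : I -> cr_alg;
  cr_f : I -> cr_alg;
  cr_cartan_comm : forall u v, cr_br (cr_cartan u) (cr_cartan v) = 0;
  cr_ef : forall i j,
    cr_br (cr_e i) (cr_f j) = if i == j then cr_cartan (cr_coroot i) else 0;
  cr_he : forall u i,
    cr_br (cr_cartan u) (cr_e i) = (cr_root i *m u) 0 0 *: cr_e i;
  cr_hf : forall u i,
    cr_br (cr_cartan u) (cr_f i) = - ((cr_root i *m u) 0 0 *: cr_f i)
}.

Section Bracket.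
Context (g : chevalley_relations).
Local Notation br := (@cr_br g).
Local Notation h := (@cr_cartan g).
Local Notation e := (@cr_e g).
Local Notation f := (@cr_f g).

Lemma brPr a (x y z : g) : br x (a *: y + z) = a *: br x y + br x z.
Proof. exact: cr_br_linear_r. Qed.

Lemma brPl a (x y z : g) : br (a *: y + z) x = a *: br y x + br z x.
Proof. exact: (cr_br_linear_l x a y z). Qed.

Lemma brDr (x y z : g) : br x (y + z) = br x y + br x z.
Proof. by have := brPr 1 x y z; rewrite !scale1r. Qed.

Lemma brDl (x y z : g) : br (y + z) x = br y x + br z x.
Proof. by have := brPl 1 x y z; rewrite !scale1r. Qed.

Lemma br0r (x : g) : br x 0 = 0.
Proof. by apply: (addIr (br x 0)); rewrite -brDr !add0r. Qed.

Lemma br0l (x : g) : br 0 x = 0.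
Proof. by apply: (addIr (br 0 x)); rewrite -brDl !add0r. Qed.

Lemma brZr a (x y : g) : br x (a *: y) = a *: br x y.
Proof. by have := brPr a x y 0; rewrite br0r !addr0. Qed.

Lemma brZl a (x y : g) : br (a *: y) x = a *: br y x.
Proof. by have := brPl a x y 0; rewrite br0l !addr0. Qed.

Lemma brC (x y : g) : br x y = - br y x.
Proof.
have := cr_br_alt (x + y); rewrite brDl !brDr !cr_br_alt add0r addr0.
by move/eqP; rewrite addr_eq0 => /eqP.
Qed.

Lemma br_deriv (x y z : g) : br x (br y z) = br (br x y) z + br y (br x z).
Proof.
have /eqP := cr_jacobi x y z; rewrite -addrA addr_eq0 => /eqP ->.
by rewrite (brC z x) (brC z) opprD -!scaleN1r brZr !scaleN1r !opprK addrC.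
Qed.

Definition weight_form (b : I -> int) (u : 'cV[K]_(cr_dim g)) : K :=
  \sum_i (b i)%:~R * (cr_root g i *m u) 0 0.

Definition has_weight (b : I -> int) (x : g) : Prop :=
  forall u, br (h u) x = weight_form b u *: x.

Definition delta (i j : I) : int := (i == j)%:Z.

Lemma weight_formD (b b' : I -> int) u :
  weight_form (fun i => b i + b' i) u = weight_form b u + weight_form b' u.
Proof.
by rewrite -big_split; apply: eq_bigr => i _; rewrite rmorphD mulrDl.
Qed.

Lemma weight_formN (b : I -> int) u : weight_form (fun i => - b i) u = - weight_form b u.
Proof.
by rewrite /weight_form -sumrN; apply: eq_bigr => i _; rewrite rmorphN mulNr.
Qed.

Lemma weight_form_delta i u : weight_form (delta i) u = (cr_root g i *m u) 0 0.
Proof.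
rewrite /weight_form (bigD1 i) //= /delta eqxx mul1r big1 ?addr0 // => j.
by rewrite eq_sym => /negPf ->; rewrite mul0r.
Qed.

Lemma weight_form0 u : weight_form (fun=> 0) u = 0.
Proof. by apply: big1 => i _; rewrite mul0r. Qed.

Lemma has_weightZ b a x : has_weight b x -> has_weight b (a *: x).
Proof. by move=> bx u; rewrite brZr bx scalerA mulrC -scalerA. Qed.

Lemma has_weight_br b b' x y : has_weight b x -> has_weight b' y ->
  has_weight (fun i => b i + b' i) (br x y).
Proof.
move=> bx b'y u; rewrite br_deriv bx b'y brZl brZr -scalerDl.
by rewrite weight_formD.
Qed.

Lemma has_weight_cartan u : has_weight (fun=> 0) (h u).
Proof. by move=> v; rewrite weight_form0 scale0r cr_cartan_comm. Qed.

Lemma has_weight_e i : has_weight (delta i) (e i).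
Proof. by move=> u; rewrite weight_form_delta cr_he. Qed.

Lemma has_weight_f i : has_weight (fun j => - delta i j) (f i).
Proof.
by move=> u; rewrite weight_formN weight_form_delta cr_hf scaleNr.
Qed.

Lemma has_weight_eq b b' x : b =1 b' -> has_weight b x -> has_weight b' x.
Proof. by move=> /funext ->. Qed.

Inductive span (P : g -> Prop) : g -> Prop :=
| span0 : span P 0
| span_cons a x y : P x -> span P y -> span P (a *: x + y).

Lemma span_gen (P : g -> Prop) x : P x -> span P x.
Proof. by move=> Px; rewrite -[x]scale1r -[_ *: _]addr0; do !constructor. Qed.

Lemma spanD (P : g -> Prop) x y : span P x -> span P y -> span P (x + y).
Proof.
move=> + Py; elim=> [|a z t Pz _ IH]; first by rewrite add0r.
by rewrite -addrA; constructor.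
Qed.

Lemma spanZ (P : g -> Prop) a x : span P x -> span P (a *: x).
Proof.
elim=> [|b z t Pz _ IH]; first by rewrite scaler0; constructor.
by rewrite scalerDr scalerA; constructor.
Qed.

Lemma span_subspace (P : g -> Prop) : lin_subspace (span P).
Proof. by split=> [|a x y *]; [constructor|apply: spanD => //; apply: spanZ]. Qed.

Lemma span_ind_sub (P : g -> Prop) (S : set g) : lin_subspace S ->
  (forall x, P x -> S x) -> forall x, span P x -> S x.
Proof. by move=> [S0 SP] PS x; elim=> // a y z /PS Sy _; apply: SP. Qed.

Lemma stable_subspace (T : set g) (z : g) :
  lin_subspace T -> lin_subspace [set x | T (br z x)].
Proof.
by move=> [T0 TP]; split=> [|a x y]; rewrite /= ?br0r ?brPr //; apply: TP.
Qed.

Inductive generated : g -> Prop :=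
| generated0 : generated 0
| generated_lin a x y : generated x -> generated y -> generated (a *: x + y)
| generated_br x y : generated x -> generated y -> generated (br x y)
| generated_h u : generated (h u)
| generated_e i : generated (e i)
| generated_f i : generated (f i).

(** By the Jacobi identity the elements whose bracket preserves [T] form a subalgebra, so only the
    generators have to be tested. *)
Lemma generated_stable (T : set g) : lin_subspace T ->
  (forall u t, T t -> T (br (h u) t)) ->
  (forall i t, T t -> T (br (e i) t)) ->
  (forall i t, T t -> T (br (f i) t)) ->
  forall x y, generated x -> T y -> T (br x y).
Proof.
move=> [T0 TP] Th Te Tf x y gx; elim: gx y => {x}.
- by move=> y _; rewrite br0l.
- by move=> a x z _ Tx _ Tz y Ty; rewrite brPl; apply: TP; [apply: Tx|apply: Tz].
- move=> x z _ Tx _ Tz y Ty.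
  have -> : br (br x z) y = (-1) *: br z (br x y) + br x (br z y).
    by rewrite (br_deriv x) scaleN1r addrC addrK.
  by apply: TP; [apply/Tz/Tx|apply/Tx/Tz].
- by move=> u y; apply: Th.
- by move=> i y; apply: Te.
- by move=> i y; apply: Tf.
Qed.

(** Right-nested brackets are enough: together with the Cartan part, these monomials span a subspace
    stable under all generators. *)
Definition emon (i : I) (s : seq I) : g := foldr (fun j => br (e j)) (e i) s.
Definition fmon (i : I) (s : seq I) : g := foldr (fun j => br (f j)) (f i) s.

Lemma has_weight_emon i s :
  has_weight (fun j => (count_mem j (i :: s))%:Z) (emon i s).
Proof.
elim: s => [|k s IH] /=.
  by apply: has_weight_eq (has_weight_e i) => j /=; rewrite addn0.
apply: has_weight_eq (has_weight_br (has_weight_e k) IH) => j /=.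
by rewrite /delta -PoszD addnCA.
Qed.

Lemma has_weight_fmon i s :
  has_weight (fun j => - (count_mem j (i :: s))%:Z) (fmon i s).
Proof.
elim: s => [|k s IH] /=.
  by apply: has_weight_eq (has_weight_f i) => j /=; rewrite addn0.
apply: has_weight_eq (has_weight_br (has_weight_f k) IH) => j /=.
by rewrite /delta -opprD -PoszD addnCA.
Qed.

Definition lower_gen : set g :=
  [set x | (exists u, x = h u) \/ exists i s, x = fmon i s].

Definition triangular_gen : set g :=
  [set x | (exists u, x = h u) \/ (exists i s, x = emon i s) \/
           exists i s, x = fmon i s].

Lemma lower_f i x : span lower_gen x -> span lower_gen (br (f i) x).
Proof.
move: x; apply: span_ind_sub; first exact: stable_subspace (span_subspace _).
move=> _ /= [[u ->]|[j [s ->]]]; last by apply: span_gen; right; exists j, (i :: s).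
rewrite brC cr_hf opprK; apply/spanZ/span_gen.
by right; exists i, [::].
Qed.

(** By the Leibniz rule [e i] meets one factor [f k] at a time; the Cartan element so produced acts
    on the remaining monomial, a weight vector, by a scalar. *)
Lemma lower_e_fmon i j s : span lower_gen (br (e i) (fmon j s)).
Proof.
elim: s => [|k s IH] /=.
  rewrite cr_ef; case: eqP => _; last exact: span0.
  by apply: span_gen; left; eexists.
rewrite br_deriv; apply: spanD; last exact: lower_f.
rewrite cr_ef; case: eqP => _; last by rewrite br0l; apply: span0.
rewrite has_weight_fmon; apply/spanZ/span_gen.
by right; exists j, s.
Qed.

Lemma triangular_e i x : span triangular_gen x -> span triangular_gen (br (e i) x).
Proof.
move: x; apply: span_ind_sub; first exact: stable_subspace (span_subspace _).
move=> _ /= [[u ->]|[[j [s ->]]|[j [s ->]]]].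
- rewrite brC cr_he -scaleNr; apply/spanZ/span_gen.
  by right; left; exists i, [::].
- by apply: span_gen; right; left; exists j, (i :: s).
- move: (lower_e_fmon i j s); apply: span_ind_sub.
    exact: span_subspace.
  by move=> x [hx|fx]; apply: span_gen; [left|right; right].
Qed.

Lemma triangular_h u x : span triangular_gen x -> span triangular_gen (br (h u) x).
Proof.
move: x; apply: span_ind_sub; first exact: stable_subspace (span_subspace _).
move=> _ /= [[v ->]|[[j [s ->]]|[j [s ->]]]].
- by rewrite cr_cartan_comm; apply: span0.
- by rewrite has_weight_emon; apply/spanZ/span_gen; right; left; exists j, s.
- by rewrite has_weight_fmon; apply/spanZ/span_gen; right; right; exists j, s.
Qed.

End Bracket.

(** Exchanging [e] and [f] reverses the sign of their bracket, which is absorbed by negating roots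
    and coroots. Each statement about [e] thus yields the one about [f]. *)
Definition chevalley_dual (g : chevalley_relations) : chevalley_relations.
Proof.
refine (@Build_chevalley_relations (cr_alg g) (@cr_br g) _ _ _ _
  (cr_dim g) (fun i => - cr_root g i) (fun i => - cr_coroot g i)
  (@cr_cartan g) (@cr_f g) (@cr_e g) _ _ _ _).
- exact: cr_br_linear_r.
- exact: cr_br_linear_l.
- exact: cr_br_alt.
- exact: cr_jacobi.
- exact: cr_cartan_comm.
- move=> i j; rewrite brC cr_ef eq_sym.
  by case: eqP => [->|_]; rewrite ?oppr0 // raddfN.
- by move=> u i; rewrite cr_hf mulNmx [in RHS]mxE scaleNr.
- by move=> u i; rewrite cr_he mulNmx [in RHS]mxE scaleNr opprK.
Defined.

Section TriangularGenerated.
Context (g : chevalley_relations).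
Local Notation br := (@cr_br g).
Local Notation f := (@cr_f g).

Lemma triangular_dual x :
  span (@triangular_gen (chevalley_dual g)) x <-> span (@triangular_gen g) x.
Proof.
split; apply: span_ind_sub; try exact: span_subspace; move=> y;
  by move=> [hx|[ex|fx]]; apply: span_gen; [left|right; right|right; left].
Qed.

Lemma triangular_f i x :
  span (@triangular_gen g) x -> span (@triangular_gen g) (br (f i) x).
Proof. by move/triangular_dual/(triangular_e i)/triangular_dual. Qed.

Lemma generated_triangular x : generated x -> span (@triangular_gen g) x.
Proof.
elim=> {x} [|a x y _ Tx _ Ty|x y gx _ _ Ty|u|i|i].
- exact: span0.
- by apply: spanD => //; apply: spanZ.
- apply: generated_stable gx Ty; first exact: span_subspace.
  + exact: triangular_h.
  + exact: triangular_e.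
  + exact: triangular_f.
- by apply: span_gen; left; exists u.
- by apply: span_gen; right; left; exists i, [::].
- by apply: span_gen; right; right; exists i, [::].
Qed.

End TriangularGenerated.

Definition relations_of (g : kac_moody_algebra K C) : chevalley_relations :=
  @Build_chevalley_relations (km_alg g) (@km_br _ _ _ g)
    (@km_br_linear_r _ _ _ g) (@km_br_linear_l _ _ _ g) (@km_br_alt _ _ _ g)
    (@km_jacobi _ _ _ g) (km_dim g) (km_root g) (km_coroot g)
    (@km_cartan _ _ _ g) (@km_e _ _ _ g) (@km_f _ _ _ g)
    (@km_cartan_comm _ _ _ g) (@km_ef _ _ _ g) (@km_he _ _ _ g)
    (@km_hf _ _ _ g).
Coercion relations_of : kac_moody_algebra >-> chevalley_relations.

(** The same algebra with the opposite labelling: its roots are the negatives of those of [g]. The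
    symmetry of the set of roots needs the Chevalley involution and is proved separately. *)
Definition km_dual (g : kac_moody_algebra K C) : kac_moody_algebra K C.
Proof.
refine (@Build_kac_moody_algebra K I C (km_alg g) (@km_br _ _ _ g) _ _ _ _
  (km_dim g) (fun i => - km_root g i) (fun i => - km_coroot g i) _ _ _ _
  (@km_cartan _ _ _ g) _ (@km_f _ _ _ g) (@km_e _ _ _ g) _ _ _ _ _ _).
- exact: km_br_linear_r.
- exact: km_br_linear_l.
- exact: km_br_alt.
- exact: km_jacobi.
- move=> c cr i; apply: (@km_root_free _ _ _ g c).
  apply: oppr_inj; rewrite oppr0 -[RHS]cr -sumrN.
  by apply: eq_bigr => j _; rewrite scalerN.
- move=> c cr i; apply: (@km_coroot_free _ _ _ g c).
  apply: oppr_inj; rewrite oppr0 -[RHS]cr -sumrN.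
  by apply: eq_bigr => j _; rewrite scalerN.
- by move=> i j; rewrite mulNmx mulmxN opprK km_pairing.
- exact: km_minimal.
- exact: km_cartan_inj.
- exact: km_cartan_comm.
- exact: (@cr_ef (chevalley_dual g)).
- exact: (@cr_he (chevalley_dual g)).
- exact: (@cr_hf (chevalley_dual g)).
- by move=> S subS Sbr Sh Se Sf; apply: (@km_generated _ _ _ g).
- exact: km_no_ideal.
Defined.

#[global] Arguments cr_alg : simpl never.
#[global] Arguments cr_br : simpl never.
#[global] Arguments cr_dim : simpl never.
#[global] Arguments cr_root : simpl never.
#[global] Arguments cr_coroot : simpl never.
#[global] Arguments cr_cartan : simpl never.
#[global] Arguments cr_e : simpl never.
#[global] Arguments cr_f : simpl never.

Section Triangular.
Context (g : kac_moody_algebra K C).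
Local Notation L := (cr_alg g).
Local Notation br := (@cr_br g).
Local Notation h := (@cr_cartan g).
Local Notation e := (@cr_e g).
Local Notation f := (@cr_f g).

Lemma km_all_generated (x : L) : generated x.
Proof.
suff /seteqP[_ /(_ x Logic.I)] : @generated g = setT by [].
apply: km_generated; first (split; first exact: generated0); by constructor.
Qed.

Lemma km_ideal_of_generators (T : set L) : lin_subspace T ->
  (forall u t, T t -> T (br (h u) t)) ->
  (forall i t, T t -> T (br (e i) t)) ->
  (forall i t, T t -> T (br (f i) t)) ->
  forall x y, T y -> T (br x y).
Proof.
by move=> subT Th Te Tf x y; apply: generated_stable => //; apply: km_all_generated.
Qed.

Lemma triangular_decomposition (x : L) : span (@triangular_gen g) x.
Proof. exact/generated_triangular/km_all_generated. Qed.

Context (char0 : forall m : int, (m%:~R : K) = 0 -> m = 0).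

(** The roots are free on the Cartan subalgebra and integers embed in [K], so distinct integral
    weights are distinct linear forms. *)
Lemma weight_form_sep (b b' : I -> int) : ~ (b =1 b') ->
  exists u : 'cV[K]_(cr_dim g), weight_form b u != weight_form b' u.
Proof.
move=> bb'; apply: contrapT => /forallNP eqbb'; apply: bb' => i.
apply/eqP; rewrite -subr_eq0; apply/eqP/char0.
pose c j : K := (b j - b' j)%:~R.
apply: (@km_root_free _ _ _ g c) => {i}; apply/rowP => k; rewrite mxE summxE.
have /negP/negPn := eqbb' (delta_mx k 0); rewrite -subr_eq0 /weight_form -sumrB => /eqP Hk; rewrite -[RHS]Hk {Hk}.
apply: eq_bigr => j _; rewrite mxE /c rmorphB mulrBl /=.
rewrite mxE (bigD1 k) //= mxE !eqxx mulr1 big1 ?addr0 // => l lk.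
by rewrite mxE (negPf lk) mulr0.
Qed.

(** The number of summands is recorded because the independence argument is an induction on it; the
    weights may repeat. *)
Inductive weight_sum (Q : (I -> int) -> Prop) : nat -> L -> Prop :=
| weight_sum0 : weight_sum Q 0 0
| weight_sumS m b x y : Q b -> has_weight b x -> weight_sum Q m y ->
    weight_sum Q m.+1 (x + y).

Lemma weight_sum_shift Q m y u (c : K) :
  weight_sum Q m y -> weight_sum Q m (br (h u) y - c *: y).
Proof.
elim=> [|{}m b x z Qb bx _ IH].
  by rewrite br0r scaler0 subr0; constructor.
have -> : br (h u) (x + z) - c *: (x + z) =
    (weight_form b u - c) *: x + (br (h u) z - c *: z).
  by rewrite brDr bx scalerBl scalerDr opprD addrACA.
by apply: weight_sumS IH; [exact: Qb|exact: has_weightZ].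
Qed.

Lemma weight_sum_span (P : L -> Prop) (Q : (I -> int) -> Prop) x :
  (forall x, P x -> exists2 b, Q b & has_weight b x) -> span P x ->
  exists m, weight_sum Q m x.
Proof.
move=> PQ; elim=> [|a y z /PQ[b Qb bx] _ [m IH]]; first by exists 0%N; constructor.
by exists m.+1; apply: weight_sumS IH; [exact: Qb|exact: has_weightZ].
Qed.

Lemma weight_sumSP Q m x : weight_sum Q m.+1 x ->
  exists b y z, [/\ Q b, has_weight b y, weight_sum Q m z & x = y + z].
Proof. by move=> sx; inversion sx as [|m' b y z]; exists b, y, z. Qed.

(** Independence of eigenvectors: bracketing with a Cartan element that separates [b] from the first
    weight and subtracting the eigenvalue of the first summand removes that summand and multiplies
    [x] by a nonzero scalar. *)
Lemma weight_sum_indep Q m b x :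
  has_weight b x -> ~ Q b -> weight_sum Q m x -> x = 0.
Proof.
elim: m x => [|m IH] x bx nQb sx; first by inversion sx.
have [b1 [x1 [y [Qb1 b1x1 sy defx]]]] := weight_sumSP sx.
have [u /negPf bu] : exists u : 'cV[K]_(cr_dim g),
    weight_form b u != weight_form b1 u.
  by apply: weight_form_sep => /funext bb1; apply: nQb; rewrite bb1.
have /eqP : (weight_form b u - weight_form b1 u) *: x = 0.
  apply: IH => //; first exact: has_weightZ.
  have -> : (weight_form b u - weight_form b1 u) *: x =
      br (h u) y - weight_form b1 u *: y.
    rewrite scalerBl -bx defx brDr b1x1 scalerDr opprD addrACA.
    by rewrite subrr add0r.
  exact: weight_sum_shift.
by rewrite scaler_eq0 subr_eq0 bu => /eqP.
Qed.

(** The spanning monomials of the triangular decomposition have weights of one sign or zero, and no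
    nonzero vector of another weight lies in their span. *)
Lemma km_root_sign b : km_is_root g b -> (forall i, 0 <= b i) \/ (forall i, b i <= 0).
Proof.
move=> [[i0 bi0] [x x0 bx]].
pose Q (b : I -> int) := (b = fun=> 0) \/ (forall i, 0 <= b i) \/ (forall i, b i <= 0).
have [|//] : Q b.
  apply: contrapT => nQb; move/negP: x0; apply; apply/eqP.
  have [|m] := @weight_sum_span _ Q x _ (triangular_decomposition x).
    move=> y [[u ->]|[[i [s ->]]|[i [s ->]]]].
    - by exists (fun=> 0); [left|exact: has_weight_cartan].
    - exists (fun j => (count_mem j (i :: s))%:Z); last exact: has_weight_emon.
      by right; left.
    - exists (fun j => - (count_mem j (i :: s))%:Z); last exact: has_weight_fmon.
      by right; right => j; rewrite oppr_le0.
  exact: weight_sum_indep bx nQb.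
by move=> b0; rewrite b0 eqxx in bi0.
Qed.

End Triangular.
End KacMoody.

(** * Kac--Moody algebras: Serre relations and reflections *)

Section Serre.
Context (K : fieldType) (I : finType) (C : I -> I -> int).
Context (hC : kac_moody_matrix C).
Context (char0 : forall m : int, (m%:~R : K) = 0 -> m = 0).

Definition coroot_pairing (b : I -> int) (i : I) : int := \sum_j b j * C i j.

Section Adjoint.
Context (g : kac_moody_algebra K C).
Local Notation L := (cr_alg g).
Local Notation br := (@cr_br _ _ g).
Local Notation h := (@cr_cartan _ _ g).
Local Notation e := (@cr_e _ _ g).
Local Notation f := (@cr_f _ _ g).

Lemma relations_of_pairing i j :
  (cr_root g j *m cr_coroot g i) 0 0 = (C i j)%:~R.
Proof. exact: km_pairing. Qed.

Lemma weight_form_coroot (b : I -> int) i :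
  weight_form b (cr_coroot g i) = (coroot_pairing b i)%:~R.
Proof.
rewrite rmorph_sum; apply: eq_bigr => j _.
by rewrite relations_of_pairing rmorphM.
Qed.

Lemma coroot_pairingD (b b' : I -> int) i :
  coroot_pairing (fun j => b j + b' j) i =
  coroot_pairing b i + coroot_pairing b' i.
Proof. by rewrite -big_split; apply: eq_bigr => j _; rewrite mulrDl. Qed.

Lemma coroot_pairingZ (m : int) (b : I -> int) i :
  coroot_pairing (fun j => m * b j) i = m * coroot_pairing b i.
Proof. by rewrite mulr_sumr; apply: eq_bigr => j _; rewrite mulrA. Qed.

Lemma coroot_pairingN (b : I -> int) i :
  coroot_pairing (fun j => - b j) i = - coroot_pairing b i.
Proof. by rewrite /coroot_pairing -sumrN; apply: eq_bigr => j _; rewrite mulNr. Qed.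

Lemma coroot_pairing_delta i j : coroot_pairing (delta j) i = C i j.
Proof.
rewrite /coroot_pairing (bigD1 j) //= /delta eqxx mul1r big1 ?addr0 // => k.
by rewrite eq_sym => /negPf ->; rewrite mul0r.
Qed.

Lemma has_weight_iter (b : I -> int) i (x : L) m : has_weight b x ->
  has_weight (fun j => b j + m%:Z * delta i j) (iter m (br (e i)) x).
Proof.
move=> bx; elim: m => [|m IH] /=.
  by apply: has_weight_eq bx => j; rewrite mul0r addr0.
apply: has_weight_eq (has_weight_br (has_weight_e i) IH) => j.
by rewrite -addn1 PoszD; ring.
Qed.

Lemma br_fe_weight (b : I -> int) i (x : L) : has_weight b x ->
  br (br (f i) (e i)) x = (- coroot_pairing b i)%:~R *: x.
Proof.
move=> bx; rewrite (brC (f i)) cr_ef eqxx -scaleN1r brZl bx.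
by rewrite weight_form_coroot scalerA mulN1r rmorphN.
Qed.

(** The sl2 computation on a lowest weight vector: each passage of [f i] through an [e i]
    contributes a term [- (coroot_pairing b i + 2 l)], and these add up for [l] from 0 to [m]. *)
Lemma sl2_lower (b : I -> int) i (x : L) m : br (f i) x = 0 -> has_weight b x ->
  br (f i) (iter m.+1 (br (e i)) x) =
  (- (m.+1%:Z * (coroot_pairing b i + m%:Z)))%:~R *: iter m (br (e i)) x.
Proof.
move=> fx bx; elim: m => [|m IH].
  by rewrite /= br_deriv fx br0r (br_fe_weight i bx) !addr0 mul1r.
rewrite iterS br_deriv IH brZr -iterS (br_fe_weight i (has_weight_iter i m.+1 bx)).
rewrite -scalerDl -rmorphD; congr (_%:~R *: _).
rewrite coroot_pairingD coroot_pairingZ coroot_pairing_delta.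
have [-> _ _] := hC; rewrite -(addn1 m.+1) -(addn1 m) !PoszD; ring.
Qed.

Definition emulti (r : seq I) (x : L) : L := foldr (fun j => br (e j)) x r.

Lemma has_weight_emulti r (b : I -> int) (x : L) : has_weight b x ->
  has_weight (fun j => b j + (count_mem j r)%:Z) (emulti r x).
Proof.
move=> bx; elim: r => [|k r IH] /=.
  by apply: has_weight_eq bx => j; rewrite addr0.
apply: has_weight_eq (has_weight_br (has_weight_e k) IH) => j.
by rewrite /delta PoszD addrCA.
Qed.

(* A vector of positive weight killed by all lowering operators generates an
   ideal meeting the Cartan subalgebra trivially. *)
Lemma singular_vector_eq0 (b : I -> int) (x : L) : has_weight b x -> (forall i, 0 <= b i) ->
  (exists i, b i != 0) -> (forall i, br (f i) x = 0) -> x = 0.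
Proof.
move=> bx b_ge0 [i0 bi0] fx.
pose J : set L := span [set y | exists r, y = emulti r x].
suff J0 : J = [set 0].
  have : J x by apply: span_gen; exists [::].
  by rewrite J0.
have Je i y : J y -> J (br (e i) y).
  move: y; apply: span_ind_sub; first exact: stable_subspace (span_subspace _).
  by move=> _ /= [r ->]; apply: span_gen; exists (i :: r).
apply: km_no_ideal.
- exact: span_subspace.
- move=> y z; apply: km_ideal_of_generators => [|u t|//|i t].
  + exact: span_subspace.
  + move: t; apply: span_ind_sub; first exact: stable_subspace (span_subspace _).
    move=> _ /= [r ->]; rewrite (has_weight_emulti r bx).
    by apply/spanZ/span_gen; exists r.
  + move: t; apply: span_ind_sub; first exact: stable_subspace (span_subspace _).
    move=> _ /= [r ->]; elim: r => [|k r IH] /=; first by rewrite fx; apply: span0.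
    rewrite br_deriv; apply: spanD; last exact: Je.
    rewrite (brC (f i)) cr_ef; case: eqP => _; last first.
      by rewrite oppr0 br0l; apply: span0.
    rewrite -scaleN1r brZl (has_weight_emulti r bx).
    by apply/spanZ/spanZ/span_gen; exists r.
- apply/seteqP; split=> [y [Jy [u _ huy]]|_ ->]; last first.
    split; first exact: span0.
    by exists 0 => //; rewrite raddf0.
  (* All weights occurring in [J] have a positive coefficient at [i0], whereas elements of the
     Cartan subalgebra have weight 0. *)
  pose Q (b : I -> int) := b i0 != 0.
  have [|m] := @weight_sum_span _ _ _ _ _ Q y _ Jy.
    move=> _ /= [r ->]; exists (fun j => b j + (count_mem j r)%:Z).
      rewrite /Q gt_eqF //; apply: ltr_wpDr => //.
      by rewrite lt_neqAle eq_sym bi0 b_ge0.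
    exact: has_weight_emulti.
  have hy : @has_weight _ _ g (fun=> 0) y.
    by rewrite -huy; apply: (@has_weight_cartan _ _ g).
  by apply: (weight_sum_indep char0 hy); rewrite /Q eqxx.
Qed.

(** The left-hand side has a positive weight and is killed by every [f k], so it is a singular
    vector. For [k = i] the sl2 coefficient vanishes exactly at this power. *)
Lemma serre i j : i != j -> iter `|1 - C i j|%N (br (e i)) (e j) = 0.
Proof.
move=> ij; have [Cii Cle C0] := hC.
have Cij := Cle _ _ ij.
pose m := `|C i j|%N; have mE : C i j = - m%:Z by rewrite /m; lia.
have -> : `|1 - C i j|%N = m.+1 by rewrite mE; lia.
have we := has_weight_iter i m.+1 (has_weight_e j).
apply: (singular_vector_eq0 we).
- by move=> k; rewrite addr_ge0 // mulr_ge0.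
- by exists j; rewrite /delta eqxx (negPf ij) mulr0.
move=> k; have [->|ki] := eqVneq k i.
  have fe : br (f i) (e j) = 0.
    by rewrite brC cr_ef eq_sym (negPf ij) oppr0.
  rewrite (sl2_lower m fe (has_weight_e j)) coroot_pairing_delta mE addNr.
  by rewrite mulr0 oppr0 scale0r.
have comm y : br (f k) (br (e i) y) = br (e i) (br (f k) y).
  by rewrite br_deriv (brC (f k)) cr_ef eq_sym (negPf ki) oppr0 br0l add0r.
have -> : br (f k) (iter m.+1 (br (e i)) (e j)) =
    iter m.+1 (br (e i)) (br (f k) (e j)).
  by elim: (m.+1) => //= l IH; rewrite comm IH.
have iter0 l : iter l (br (e i)) 0 = 0 :> L.
  by elim: l => //= l ->; rewrite br0r.
rewrite (brC (f k)) cr_ef; case: eqVneq => [_|_]; last by rewrite oppr0 iter0.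
rewrite iterSr -scaleN1r brZr brC cr_he relations_of_pairing.
(* Case [k = j]: one bracket with [e i] turns the coroot into a multiple of [e i] with coefficient
   [- C j i], and a second one kills it. When [m = 0] only one is available, but then [C i j = 0]
   forces [C j i = 0]. *)
case: (m) mE => [|l] mE.
  have -> : C j i = 0 by apply/C0; rewrite mE.
  by rewrite scale0r oppr0 scaler0.
rewrite iterSr -scaleN1r brZr brZr brZr cr_br_alt !scaler0.
exact: iter0.
Qed.

Lemma iter_brD m i (x y : L) :
  iter m (br (e i)) (x + y) = iter m (br (e i)) x + iter m (br (e i)) y.
Proof. by elim: m => //= m ->; rewrite brDr. Qed.

Lemma iter_brZ m i a (x : L) :
  iter m (br (e i)) (a *: x) = a *: iter m (br (e i)) x.
Proof. by elim: m => //= m ->; rewrite brZr. Qed.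

Lemma iter_br0 m i : iter m (br (e i)) 0 = 0 :> L.
Proof. by elim: m => //= m ->; rewrite br0r. Qed.

Lemma iter_br_nilpotent i m p (x y : L) :
  iter m (br (e i)) x = 0 -> iter p (br (e i)) y = 0 ->
  iter (m + p) (br (e i)) (br x y) = 0.
Proof.
elim: m p x y => [|m IHm]; first by move=> p x y /= -> _; rewrite br0l iter_br0.
elim=> [|p IHp] x y; first by move=> _; rewrite [iter 0 _ y]/= => ->; rewrite br0r iter_br0.
move=> xm yp; rewrite addSn iterSr br_deriv iter_brD.
have -> : iter (m + p.+1) (br (e i)) (br (br (e i) x) y) = 0.
  by apply: IHm => //; rewrite -iterSr.
by rewrite add0r addnS -addSn; apply: IHp => //; rewrite -iterSr.
Qed.

(** By the Leibniz rule the vectors killed by some power form a subalgebra; the Serre relations put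
    the generators in it. *)
Lemma ad_nilpotent i (x : L) : exists m, iter m (br (e i)) x = 0.
Proof.
suff /seteqP[_ /(_ x Logic.I)] :
  [set x : L | exists m, iter m (br (e i)) x = 0] = setT by [].
have mono m p y : (m <= p)%N -> iter m (br (e i)) y = 0 -> iter p (br (e i)) y = 0.
  by move=> /subnK <- ym; rewrite iterD ym iter_br0.
have eh u : br (e i) (br (e i) (h u)) = 0.
  by rewrite (brC _ (h u)) cr_he -scaleNr brZr cr_br_alt scaler0.
apply: km_generated.
- split=> [|a y z [m ym] [p zp]]; first by exists 0%N.
  exists (maxn m p); rewrite iter_brD iter_brZ.
  by rewrite (mono _ _ _ (leq_maxl m p) ym) (mono _ _ _ (leq_maxr m p) zp) scaler0 addr0.
- move=> y z [m ym] [p zp]; exists (m + p)%N.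
  exact: iter_br_nilpotent.
- by move=> u; exists 2%N; apply: eh.
- move=> j; have [<-|ij] := eqVneq i j; last by eexists; apply: serre.
  by exists 1%N; rewrite /= cr_br_alt.
- move=> j; exists 3%N; rewrite /= cr_ef; case: eqP => _; last by rewrite !br0r.
  exact: eh.
Qed.

End Adjoint.

Definition reflect_weight (i : I) (b : I -> int) (j : I) : int :=
  b j - coroot_pairing b i * delta i j.

Lemma km_is_root_dual (g : kac_moody_algebra K C) b :
  km_is_root (km_dual g) b <-> km_is_root g (fun j => - b j).
Proof.
have wE u : \sum_j (- b j)%:~R * (km_root g j *m u) 0 0 =
    \sum_j (b j)%:~R * (km_root (km_dual g) j *m u) 0 0.
  by apply: eq_bigr => j _; rewrite rmorphN mulNmx [in RHS]mxE mulNr mulrN.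
split=> -[[j bj] [x x0 bx]]; split.
- by exists j; rewrite oppr_eq0.
- by exists x => // u; rewrite wE; apply: bx.
- by exists j; rewrite -oppr_eq0.
- by exists x => // u; rewrite -wE; apply: bx.
Qed.

Lemma reflect_weightN i b :
  reflect_weight i (fun j => - b j) =1 fun j => - reflect_weight i b j.
Proof.
by move=> j; rewrite /reflect_weight coroot_pairingN; ring.
Qed.

(** The vector is first raised by [e i] to the top [y] of its string, which is a lowest weight
    vector for [km_dual g]; then [y] is lowered by [f i] until the reflected weight is reached. *)
Lemma km_root_reflect_pos (g : kac_moody_algebra K C) i b :
  km_is_root g b -> 0 <= coroot_pairing b i -> km_is_root g (reflect_weight i b).
Proof.
move=> [[i0 bi0] [x x0 bx]] bge0; have [Cii _ _] := hC.
split.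
  apply: contrapT => /forallNP rb0.
  have {}rb0 j : b j = coroot_pairing b i * delta i j.
    by have /negP/negPn := rb0 j; rewrite subr_eq0 => /eqP.
  have := coroot_pairingZ (coroot_pairing b i) (delta i) i.
  rewrite coroot_pairing_delta Cii -(funext rb0) => b2.
  have {}b2 : coroot_pairing b i = 0 by lia.
  by move: bi0; rewrite rb0 b2 mul0r eqxx.

have [k [y0 ey]] : exists k, iter k (@cr_br _ _ g (cr_e g i)) x != 0 /\
    iter k.+1 (@cr_br _ _ g (cr_e g i)) x = 0.
  have [m] := ad_nilpotent i x; elim: m => [/= x_eq0|m IH xm].
    by rewrite x_eq0 eqxx in x0.
  have [xm0|xm0] := eqVneq (iter m (@cr_br _ _ g (cr_e g i)) x) 0; first exact: IH.
  by exists m.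
set y := iter k _ x in y0.
have wy : @has_weight _ _ (km_dual g) (fun j => - (b j + k%:Z * delta i j)) y.
  move=> u; rewrite weight_formN; have := has_weight_iter i k bx u.
  rewrite /weight_form /= => ->; rewrite -sumrN; congr (_ *: _).
  by apply: eq_bigr => j _; rewrite mulNmx [in RHS]mxE mulrN opprK.
pose p := `|coroot_pairing b i|%N; have pE : coroot_pairing b i = p%:Z.
  by rewrite /p gez0_abs.
(* The sl2 coefficient is a nonzero multiple of [p + 2 k - l], so the descent cannot stop before
   step [p + 2 k], while [k + p] steps are needed. *)
have fy l : (l <= k + p)%N -> iter l (@cr_br _ _ g (cr_f g i)) y != 0.
  elim: l => // l IH lk.
  apply/eqP => fl; have := @sl2_lower (km_dual g) _ i y l ey wy.
  rewrite /= in fl *; rewrite fl br0r => /esym/eqP.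
  rewrite scaler_eq0 (negPf (IH (ltnW lk))) orbF => /eqP/char0/eqP.
  rewrite oppr_eq0 mulf_eq0 /=.
  rewrite (_ : coroot_pairing _ i = - (p%:Z + k%:Z * 2)) ?lia; last first.
    by rewrite coroot_pairingN coroot_pairingD coroot_pairingZ pE coroot_pairing_delta Cii.
  lia.
exists (iter (k + p) (@cr_br _ _ g (cr_f g i)) y); first exact: fy.
move=> u; apply: etrans (@has_weight_iter (km_dual g) _ i y (k + p) wy u) _.
congr (_ *: _); apply: eq_bigr => j _.
rewrite mulNmx [in LHS]mxE mulrN -mulNr -rmorphN; congr (_%:~R * _).
by rewrite /reflect_weight pE PoszD; ring.
Qed.

Lemma km_root_reflect (g : kac_moody_algebra K C) i b :
  km_is_root g b -> km_is_root g (reflect_weight i b).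
Proof.
move=> gb; have [b_ge0|b_lt0] := leP 0 (coroot_pairing b i).
  exact: km_root_reflect_pos.
have : km_is_root (km_dual g) (fun j => - b j).
  by apply/km_is_root_dual; under [fun j => - _]funext => j do rewrite opprK.
move=> /(@km_root_reflect_pos _ i); rewrite (funext (reflect_weightN i b)).
rewrite coroot_pairingN oppr_ge0 => /(_ (ltW b_lt0))/km_is_root_dual.
by under [fun j => - - _]funext => j do rewrite opprK.
Qed.

Lemma km_root_delta (g : kac_moody_algebra K C) i :
  km_is_root g (delta i) /\ km_is_root g (fun j => - delta i j).
Proof.
suff gi (g' : kac_moody_algebra K C) : km_is_root g' (delta i).
  by split=> //; apply/km_is_root_dual.
split; first by exists i; rewrite /delta eqxx.
exists (km_e g' i); last exact: (@has_weight_e _ _ g' i).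
apply/eqP => e0; have := cr_ef g' i i.
rewrite (e0 : cr_e g' i = 0) br0l eqxx -(raddf0 (cr_cartan g')) => /km_cartan_inj c0.
have := relations_of_pairing g' i i; rewrite -c0 mulmx0 mxE; have [-> _ _] := hC.
by move=> /esym/char0.
Qed.

End Serre.

(** * Kac--Moody algebras: the Chevalley involution *)

Section ChevalleyInvolution.
Context (K : fieldType) (I : finType) (C : I -> I -> int).
Context (char0 : forall m : int, (m%:~R : K) = 0 -> m = 0).
Context (g : kac_moody_algebra K C).
Local Notation L := (cr_alg g).
Local Notation br := (@cr_br _ _ g).
Local Notation h := (@cr_cartan _ _ g).
Local Notation e := (@cr_e _ _ g).
Local Notation f := (@cr_f _ _ g).

Definition graph_cartan (u : 'cV[K]_(cr_dim g)) : (L * L)%type := (h u, - h u).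

Lemma graph_cartan_linear : linear graph_cartan.
Proof.
move=> a u v; rewrite /graph_cartan linearP; congr pair.
by rewrite /= opprD scalerN.
Qed.

HB.instance Definition _ := GRing.isLinear.Build K _ _ _ graph_cartan
  graph_cartan_linear.

(** The involution sends [e i] to [- f i], [f i] to [- e i] and [h u] to [- h u]. As no presentation
    by generators and relations is at hand, it is obtained as a correspondence: the subalgebra of
    the product generated by these pairs, later shown to be the graph of a bijection. *)
Definition graph_relations : chevalley_relations K I.
Proof.
refine (@Build_chevalley_relations K I (L * L)%type
  (fun p q => (br p.1 q.1, br p.2 q.2)) _ _ _ _
  (cr_dim g) (@cr_root _ _ g) (@cr_coroot _ _ g) graph_cartan
  (fun i => (e i, - f i)) (fun i => (f i, - e i)) _ _ _ _).
- by move=> p a x y /=; rewrite !brPr.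
- by move=> p a x y /=; rewrite !brPl.
- by move=> p /=; rewrite !cr_br_alt.
- by move=> x y z /=; congr pair; apply: cr_jacobi.
- by move=> u v /=; rewrite -[- h u]scaleN1r -[- h v]scaleN1r brZr brZl !cr_cartan_comm !scaler0.
- move=> i j /=; rewrite -[- f i]scaleN1r -[- e j]scaleN1r brZr brZl !scaleN1r opprK.
  rewrite (brC (f i)) !cr_ef (eq_sym j); case: eqP => [->|_] //.
  by rewrite oppr0.
- move=> u i /=; rewrite cr_he -[- h u]scaleN1r -[- f i]scaleN1r brZr brZl cr_hf.
  by rewrite !scaleN1r opprK -scalerN.
- move=> u i /=; rewrite cr_hf -[- h u]scaleN1r -[- e i]scaleN1r brZr brZl cr_he.
  by rewrite !scaleN1r opprK; congr pair; rewrite /= scalerN opprK.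
Defined.

Definition nonzero_weight : set L :=
  [set x | exists2 b, (exists i, b i != 0) & has_weight b x].

Lemma has_weight_graph (b : I -> int) (p : cr_alg graph_relations) :
  has_weight b p -> @has_weight _ _ g b p.1 /\ @has_weight _ _ g (fun i => - b i) p.2.
Proof.
move=> bp; split=> u; first exact: (congr1 (@fst L L) (bp u)).
have : br (- h u) p.2 = weight_form b u *: p.2 := congr1 (@snd L L) (bp u).
rewrite -scaleN1r brZl scaleN1r.
move=> /(congr1 -%R); rewrite opprK => ->.
by rewrite weight_formN scaleNr.
Qed.

(** The triangular decomposition in the product shows that the Cartan parts of the two components
    are opposite; if one component is 0, both parts vanish. *)
Lemma graph_decomposition (p : cr_alg graph_relations) : generated p ->
  exists u, span nonzero_weight (p.1 - h u) /\ span nonzero_weight (p.2 + h u).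
Proof.
have [N0 NP] := span_subspace nonzero_weight.
move/generated_triangular; move: p; apply: span_ind_sub.
  split=> [|a p q [u [pu1 pu2]] [v [qv1 qv2]]].
    by exists 0; rewrite (raddf0 h) subr0 addr0.
  exists (a *: u + v); rewrite (linearP h); split.
    rewrite [X in span _ X](_ : _ = a *: (p.1 - h u) + (q.1 - h v)); first exact: NP.
    by rewrite /= opprD addrACA scalerBr.
  rewrite [X in span _ X](_ : _ = a *: (p.2 + h u) + (q.2 + h v)); first exact: NP.
  by rewrite /= addrACA scalerDr.
have step (b : I -> int) (p : cr_alg graph_relations) :
    (exists i, b i != 0) -> has_weight b p ->
  exists u, span nonzero_weight (p.1 - h u) /\ span nonzero_weight (p.2 + h u).
  move=> [i bi] /has_weight_graph[bp1 bp2].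
  exists 0; rewrite (raddf0 h) subr0 addr0; split; apply: span_gen.
    by exists b; first exists i.
  by exists (fun i => - b i); first (exists i; rewrite oppr_eq0).
move=> _ [[u ->]|[[i [s ->]]|[i [s ->]]]].
- by exists u; rewrite /= subrr addNr.
- by apply: step (has_weight_emon i s); exists i; rewrite /= eqxx.
- by apply: step (has_weight_fmon i s); exists i; rewrite /= eqxx oppr_eq0.
Qed.

Lemma cartan_nonzero_weight u : span nonzero_weight (h u) -> h u = 0.
Proof.
pose Q (b : I -> int) := exists i, b i != 0.
move=> hN; have [|m] := weight_sum_span (Q := Q) _ hN; first by [].
apply: weight_sum_indep => //; first exact: has_weight_cartan.
by move=> [j]; rewrite eqxx.
Qed.

Lemma graph_surjective1 (x : L) : exists y, @generated _ _ graph_relations (x, y).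
Proof.
suff /seteqP[_ /(_ x Logic.I)] :
  [set x : L | exists y, @generated _ _ graph_relations (x, y)] = setT by [].
apply: km_generated.
- split=> [|a {}x y [x' gx] [y' gy]]; first by exists 0; apply: generated0.
  exists (a *: x' + y'); exact: (@generated_lin _ _ graph_relations a (x, x') (y, y')).
- move=> {}x y [x' gx] [y' gy].
  by exists (br x' y'); exact: (@generated_br _ _ graph_relations (x, x') (y, y')).
- by move=> u; exists (- h u); exact: (@generated_h _ _ graph_relations u).
- by move=> i; exists (- f i); exact: (@generated_e _ _ graph_relations i).
- by move=> i; exists (- e i); exact: (@generated_f _ _ graph_relations i).
Qed.

Lemma graph_surjective2 (y : L) : exists x, @generated _ _ graph_relations (x, y).
Proof.
suff /seteqP[_ /(_ y Logic.I)] :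
  [set y : L | exists x, @generated _ _ graph_relations (x, y)] = setT by [].
have neg (x z : L) : @generated _ _ graph_relations (x, - z) ->
    @generated _ _ graph_relations (- x, z).
  move=> gxz; have := generated_lin (-1) gxz (generated0 _).
  rewrite addr0 scaleN1r; congr (@generated _ _ graph_relations); congr pair.
  by rewrite /= opprK.
apply: km_generated.
- split=> [|a {}y z [y' gy] [z' gz]]; first by exists 0; apply: generated0.
  exists (a *: y' + z'); exact: (@generated_lin _ _ graph_relations a (y', y) (z', z)).
- move=> {}y z [y' gy] [z' gz].
  by exists (br y' z'); exact: (@generated_br _ _ graph_relations (y', y) (z', z)).
- by move=> u; exists (- h u); apply: neg; exact: (@generated_h _ _ graph_relations u).
- by move=> i; exists (- f i); apply: neg; exact: (@generated_f _ _ graph_relations i).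
- by move=> i; exists (- e i); apply: neg; exact: (@generated_e _ _ graph_relations i).
Qed.

(** Since every element is a second component, these [y] form an ideal; by the decomposition it
    meets the Cartan subalgebra trivially. *)
Lemma graph_functional2 (y : L) : @generated _ _ graph_relations (0, y) -> y = 0.
Proof.
suff J0 : [set y : L | @generated _ _ graph_relations (0, y)] = [set 0].
  by move=> gy; have : [set 0] y by rewrite -J0.
apply: km_no_ideal.
- split=> [|a {}y z gy gz]; first exact: generated0.
  have := @generated_lin _ _ graph_relations a _ _ gy gz.
  by rewrite /GRing.scale /Algebra.add /= /add_pair /scale_pair /= scaler0 addr0.
- move=> x {}y gy; have [x' gx] := graph_surjective2 x.
  by have := generated_br gx gy; rewrite /cr_br /= (br0r x').
- apply/seteqP; split=> [{}y [gy [v _ hv]]|_ ->]; last first.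
    by split; [exact: generated0|exists 0 => //; rewrite raddf0].
  have [u /= []] := graph_decomposition gy.
  rewrite sub0r -raddfN => /cartan_nonzero_weight/eqP.
  rewrite raddfN oppr_eq0 => /eqP ->; rewrite addr0 -hv.
  exact: cartan_nonzero_weight.
Qed.

Lemma graph_functional1 (x : L) : @generated _ _ graph_relations (x, 0) -> x = 0.
Proof.
suff J0 : [set x : L | @generated _ _ graph_relations (x, 0)] = [set 0].
  by move=> gx; have : [set 0] x by rewrite -J0.
apply: km_no_ideal.
- split=> [|a {}x z gx gz]; first exact: generated0.
  have := @generated_lin _ _ graph_relations a _ _ gx gz.
  by rewrite /GRing.scale /Algebra.add /= /add_pair /scale_pair /= scaler0 addr0.
- move=> y {}x gx; have [y' gy] := graph_surjective1 y.
  by have := generated_br gy gx; rewrite /cr_br /= (br0r y').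
- apply/seteqP; split=> [{}x [gx [v _ hv]]|_ ->]; last first.
    by split; [exact: generated0|exists 0 => //; rewrite raddf0].
  have [u /= []] := graph_decomposition gx.
  rewrite add0r => xu /cartan_nonzero_weight hu; move: xu.
  by rewrite hu subr0 -hv; apply: cartan_nonzero_weight.
Qed.

Lemma km_rootN b : km_is_root g b -> km_is_root g (fun i => - b i).
Proof.
move=> [[i bi] [x x0 bx]]; split; first by exists i; rewrite oppr_eq0.
have [y gxy] := graph_surjective1 x; exists y.
  by apply/eqP => y0; move: x0; rewrite (@graph_functional1 x) ?eqxx // -y0.
move=> u; rewrite -[RHS]/(@weight_form _ _ g _ u *: (y : L)).
rewrite weight_formN scaleNr; apply/eqP; rewrite -addr_eq0; apply/eqP.
(* The bracket of [(h u, - h u)] with [(x, y)], minus its weight multiple of [(x, y)], has first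
   component 0; its second component is the difference to be killed, up to sign. *)
apply: graph_functional2.
have gh := generated_br (@generated_h _ _ graph_relations u) gxy.
have := generated_lin (-1) gh (generated_lin (@weight_form _ _ g b u) gxy (generated0 _)).
rewrite addr0; congr (@generated _ _ graph_relations); congr pair.
  by rewrite /= (bx u : br (h u) x = @weight_form _ _ g b u *: x) scaleN1r addNr.
by rewrite /= -[- h u]scaleN1r brZl scalerA mulrNN mulr1 scale1r.
Qed.

End ChevalleyInvolution.

(** * The Weyl group *)

Section IntegralFreeness.
Context (I : finType) (n : nat) (v : I -> 'rV[int]_n).
Context (free_v : lin_indep v).

Lemma common_denominator m (x : 'rV[rat]_m) :
  exists2 d : int, d != 0 & forall j, exists z : int, x 0 j * d%:~R = z%:~R.
Proof.
exists (\prod_j denq (x 0 j)).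
  by apply/prodf_neq0 => j _; apply: denq_neq0.
move=> j; rewrite (bigD1 j) //= rmorphM mulrA -numqE -rmorphM.
by eexists.
Qed.

(** Freeness over the integers gives freeness over the rationals by clearing denominators, and row
    rank does not change from the rationals to [R]; a matrix with free rows has a right inverse. *)
Lemma free_int_dual (R : realFieldType) (t : I -> R) :
  exists y : 'cV[R]_n, forall i, ((map_mx intr (v i) : 'rV[R]_n) *m y) 0 0 = t i.
Proof.
pose A : 'M[rat]_(#|I|, n) := \matrix_(i, j) (v (enum_val i) 0 j)%:~R.
have freeA : row_free A.
  apply: inj_row_free => x xA.
  have [d d0 dx] := common_denominator x.
  have {dx} [c cx] := boolp.choice dx.
  have c0 : forall i, c i = 0.
    suff c0 : forall i : I, c (enum_rank i) = 0.
      by move=> i; rewrite -(enum_valK i).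
    apply: free_v; apply/rowP => j; rewrite summxE mxE.
    have := congr1 (fun B : 'rV_n => B 0 j * d%:~R) xA.
    rewrite !mxE mul0r mulr_suml => xAj.
    apply: (@intr_inj rat); rewrite rmorph_sum -[RHS]xAj.
    rewrite (reindex (@enum_val I I)) /=; last first.
      exact: onW_bij (enum_val_bij _).
    apply: eq_bigr => i _; rewrite mxE enum_valK intrM -cx mxE.
    by rewrite mulrAC.
  apply/rowP => j; have /eqP := cx j; rewrite c0 mulf_eq0 intr_eq0 (negPf d0) orbF.
  by rewrite mxE => /eqP.
have : row_free (map_mx ratr A : 'M[R]_(_, _)) by rewrite row_free_map.
case/row_freeP => B AB.
exists (B *m \col_i t (enum_val i)) => i.
have -> : map_mx intr (v i) = row (enum_rank i) (map_mx ratr A) :> 'rV[R]_n.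
  by apply/rowP => j; rewrite !mxE enum_rankK ratr_int.
by rewrite mulmxA -row_mul AB -row_mul mul1mx !mxE enum_rankK.
Qed.

End IntegralFreeness.

Section RootSystem.
Context (R : realType) (I : finType) (C : I -> I -> int) (n : nat).
Context (hC : kac_moody_matrix C) (S : root_datum C n).

Local Notation V := 'cV[R]_n.
Local Notation alpha := (@alpha R I C n S).
Local Notation alphav := (@alphav R I C n S).
Local Notation sr := (@simple_reflection R I C n S).
Local Notation weyl := (@weyl R I C n S).

Lemma evDr (a : 'rV[R]_n) x y : ev a (x + y) = ev a x + ev a y.
Proof. by rewrite /ev mulmxDr mxE. Qed.
Lemma evZr (a : 'rV[R]_n) c x : ev a (c *: x) = c * ev a x.
Proof. by rewrite /ev -scalemxAr mxE. Qed.
Lemma evNr (a : 'rV[R]_n) x : ev a (- x) = - ev a x.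
Proof. by rewrite /ev mulmxN mxE. Qed.
Lemma evBr (a : 'rV[R]_n) x y : ev a (x - y) = ev a x - ev a y.
Proof. by rewrite evDr evNr. Qed.
Lemma ev0r (a : 'rV[R]_n) : ev a 0 = 0.
Proof. by rewrite /ev mulmx0 mxE. Qed.
Lemma evZl c (a : 'rV[R]_n) x : ev (c *: a) x = c * ev a x.
Proof. by rewrite /ev -scalemxAl mxE. Qed.
Lemma evNl (a : 'rV[R]_n) x : ev (- a) x = - ev a x.
Proof. by rewrite /ev mulNmx mxE. Qed.
Lemma ev0l x : ev (0 : 'rV[R]_n) x = 0.
Proof. by rewrite /ev mul0mx mxE. Qed.
Lemma ev_suml (c : I -> R) (a : I -> 'rV[R]_n) x :
  ev (\sum_i c i *: a i) x = \sum_i c i * ev (a i) x.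
Proof.
by rewrite /ev mulmx_suml summxE; apply: eq_bigr => i _; rewrite -evZl.
Qed.
Lemma ev_sumr (c : I -> R) (a : 'rV[R]_n) (x : I -> V) :
  ev a (\sum_i c i *: x i) = \sum_i c i * ev a (x i).
Proof.
by rewrite /ev mulmx_sumr summxE; apply: eq_bigr => i _; rewrite -evZr.
Qed.
Lemma evM (a : 'rV[R]_n) (w : 'M[R]_n) x : ev a (w *m x) = ev (a *m w) x.
Proof. by rewrite /ev mulmxA. Qed.

Lemma ev_outer (a : 'rV[R]_n) (c : V) x : c *m a *m x = ev a x *: c.
Proof.
by rewrite -mulmxA [a *m x]mx11_scalar mul_mx_scalar.
Qed.

Lemma ev_outerl (a b : 'rV[R]_n) (c : V) : b *m (c *m a) = ev b c *: a.
Proof. by rewrite mulmxA [b *m c]mx11_scalar mul_scalar_mx. Qed.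

Lemma ev_alphav i j : ev (alpha j) (alphav i) = (C i j)%:~R.
Proof. by rewrite /ev -map_mxM mxE root_coroot. Qed.

Lemma Cii i : C i i = 2. Proof. by have [] := hC. Qed.

Lemma srE i x : sr i *m x = x - ev (alpha i) x *: alphav i.
Proof. by rewrite mulmxBl mul1mx ev_outer. Qed.

Lemma srEl i (a : 'rV[R]_n) : a *m sr i = a - ev a (alphav i) *: alpha i.
Proof. by rewrite mulmxBr mulmx1 ev_outerl. Qed.

Lemma sr_alpha i : alpha i *m sr i = - alpha i.
Proof.
rewrite srEl ev_alphav Cii (_ : 2%:~R = 2 :> R) // scaler_nat mulr2n.
by rewrite opprD addrA subrr add0r.
Qed.

Lemma sr_inv i : sr i *m sr i = 1%:M.
Proof.
rewrite {1}/simple_reflection mulmxBl mul1mx -mulmxA sr_alpha mulmxN opprK.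
by rewrite /simple_reflection subrK.
Qed.

Lemma weylMM w w' : weyl w -> weyl w' -> weyl (w *m w').
Proof.
by move=> + w'W; elim=> [|i v _ IH]; rewrite ?mul1mx // -mulmxA; constructor.
Qed.

Lemma weyl_sr i : weyl (sr i).
Proof. by rewrite -[sr i]mulmx1; do !constructor. Qed.

Lemma weyl_inverse w : weyl w ->
  exists2 w', weyl w' & w *m w' = 1%:M /\ w' *m w = 1%:M.
Proof.
elim=> [|i v _ [v' v'W [vv' v'v]]].
  by exists 1%:M; [constructor|rewrite mulmx1].
exists (v' *m sr i); first exact: weylMM (weyl_sr i).
split; first by rewrite mulmxA -(mulmxA _ v) vv' mulmx1 sr_inv.
by rewrite mulmxA -(mulmxA v') sr_inv mulmx1.
Qed.

Lemma weyl_unit w : weyl w -> w \in unitmx.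
Proof. by move=> /weyl_inverse[w' _ [ww' _]]; case/mulmx1_unit: ww'. Qed.

Lemma weyl_inv w : weyl w -> weyl (invmx w).
Proof.
move=> wW; have [w' w'W [_ w'w]] := weyl_inverse wW.
suff -> : invmx w = w' by [].
by rewrite -[RHS]mulmx1 -(mulmxV (weyl_unit wW)) mulmxA w'w mul1mx.
Qed.

Lemma weyl_mulVx w (x : V) : weyl w -> invmx w *m (w *m x) = x.
Proof. by move=> /weyl_unit wu; rewrite mulmxA mulVmx ?mul1mx. Qed.

Lemma weyl_mulxV w (x : V) : weyl w -> w *m (invmx w *m x) = x.
Proof. by move=> /weyl_unit wu; rewrite mulmxA mulmxV ?mul1mx. Qed.

Lemma alpha_dual (t : I -> R) : exists v : V, forall i, ev (alpha i) v = t i.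
Proof. by have [y yt] := free_int_dual (@simple_root_free _ _ _ S) t; exists y. Qed.

Lemma alphav_dual (t : I -> R) :
  exists a : 'rV[R]_n, forall i, ev a (alphav i) = t i.
Proof.
have free_tr : lin_indep (fun i => (simple_coroot S i)^T).
  move=> c c0; apply: (@simple_coroot_free _ _ _ S); apply: trmx_inj.
  rewrite trmx0 -[RHS]c0 linear_sum; apply: eq_bigr => i _.
  by rewrite linearZ.
have [y yt] := free_int_dual free_tr t; exists y^T => i.
rewrite -yt /ev; transitivity ((y^T *m alphav i)^T 0 0); first by rewrite [RHS]mxE.
by rewrite trmx_mul trmxK map_trmx.
Qed.

Lemma coroot_lattice0 : coroot_lattice S (0 : V).
Proof. by exists (fun=> 0); rewrite big1 // => i _; rewrite scale0r. Qed.

Lemma coroot_latticeD (p q : V) :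
  coroot_lattice S p -> coroot_lattice S q -> coroot_lattice S (p + q).
Proof.
move=> [c ->] [c' ->]; exists (fun i => c i + c' i).
by rewrite -big_split; apply: eq_bigr => i _; rewrite rmorphD scalerDl.
Qed.

Lemma coroot_latticeZ (z : int) (p : V) :
  coroot_lattice S p -> coroot_lattice S (z%:~R *: p).
Proof.
move=> [c ->]; exists (fun i => z * c i).
by rewrite scaler_sumr; apply: eq_bigr => i _; rewrite scalerA rmorphM.
Qed.

Lemma coroot_lattice_alphav i : coroot_lattice S (alphav i).
Proof.
exists (fun j => (i == j)%:Z); rewrite (bigD1 i) //= eqxx scale1r.
by rewrite big1 ?addr0 // => j; rewrite eq_sym => /negPf ->; rewrite scale0r.
Qed.

Lemma coroot_lattice_alpha i (q : V) : coroot_lattice S q ->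
  exists z : int, ev (alpha i) q = z%:~R.
Proof.
move=> [c ->]; exists (\sum_j c j * C j i).
rewrite ev_sumr rmorph_sum; apply: eq_bigr => j _.
by rewrite ev_alphav rmorphM.
Qed.

Lemma coroot_lattice_weyl w (q : V) : weyl w ->
  coroot_lattice S q -> coroot_lattice S (w *m q).
Proof.
move=> + qQ; elim=> [|i v _ IH]; first by rewrite mul1mx.
rewrite -mulmxA srE; have [z ->] := coroot_lattice_alpha i IH.
apply: coroot_latticeD => //; rewrite -scaleNr -rmorphN.
exact/coroot_latticeZ/coroot_lattice_alphav.
Qed.

Lemma weyl_sub_coroot_span w (x : V) : weyl w ->
  exists c : I -> R, w *m x - x = \sum_i c i *: alphav i.
Proof.
elim=> [|i v _ [c vx]].
  by exists (fun=> 0); rewrite mul1mx subrr big1 // => i _; rewrite scale0r.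
exists (fun j => c j - (i == j)%:R * ev (alpha i) (v *m x)).
rewrite -mulmxA srE addrAC vx.
under [RHS]eq_bigr do rewrite scalerBl.
rewrite sumrB; congr (_ - _); rewrite (bigD1 i) //= eqxx mul1r.
by rewrite big1 ?addr0 // => j; rewrite eq_sym => /negPf ->; rewrite mul0r scale0r.
Qed.

Definition integral_mx m p (w : 'M[R]_(m, p)) : Prop :=
  exists z : 'M[int]_(m, p), w = map_mx intr z.

Lemma weyl_integral w : weyl w -> integral_mx w.
Proof.
elim=> [|i v _ [z ->]]; first by exists 1%:M; rewrite map_mx1.
exists ((1%:M - simple_coroot S i *m simple_root S i) *m z).
by rewrite map_mxM map_mxB map_mx1 map_mxM.
Qed.

Lemma affine_weyl_id : affine_weyl S (@id V).
Proof.
exists 1%:M, 0; split; [by constructor|exact: coroot_lattice0|].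
by apply/funext => x; rewrite mul1mx addr0.
Qed.

Lemma affine_weyl_lin w : weyl w -> affine_weyl S (fun x : V => w *m x).
Proof.
by exists w, 0; split=> //; [exact: coroot_lattice0|apply/funext => x; rewrite addr0].
Qed.

Lemma affine_weyl_comp u u' : affine_weyl S u -> affine_weyl S u' ->
  affine_weyl S (u \o u' : V -> V).
Proof.
move=> [w [q [wW qQ ->]]] [w' [q' [w'W q'Q ->]]].
exists (w *m w'), (w *m q' + q); split; first exact: weylMM.
  exact: coroot_latticeD (coroot_lattice_weyl wW q'Q) qQ.
by apply/funext => x /=; rewrite mulmxDr mulmxA addrA.
Qed.

Lemma affine_weyl_inv u : affine_weyl S u ->
  exists u' : V -> V, [/\ affine_weyl S u', cancel u u' & cancel u' u].
Proof.
move=> [w [q [wW qQ ->]]].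
exists (fun x => invmx w *m x - invmx w *m q); split.
- exists (invmx w), (- (invmx w *m q)); split; first exact: weyl_inv.
    rewrite -scaleN1r -[-1]/((-1)%:~R).
    exact: coroot_latticeZ (coroot_lattice_weyl (weyl_inv wW) qQ).
  by [].
- by move=> x; rewrite mulmxDr weyl_mulVx // addrK.
- by move=> x; rewrite mulmxBr !weyl_mulxV // subrK.
Qed.

End RootSystem.

(** * Roots, chambers and neighbourhoods in the standard apartment *)

Section ColumnTopology.
Context (R : realType) (n : nat).
Local Notation V := 'cV[R]_n.

Lemma nbhs_cVP (x : V) (U : set V) :
  nbhs x U <-> exists2 e : R, 0 < e & forall y, `|y - x| < e -> U y.
Proof.
split=> [/nbhs_ballP[e /= e0 xU]|[e e0 xU]].
  by exists e => // y yx; apply: xU; rewrite -ball_normE /ball_ /= distrC.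
apply/nbhs_ballP; exists e => // y; rewrite -ball_normE /ball_ /= distrC.
exact: xU.
Qed.

Lemma cV_entry_le (x : V) i : `|x i 0| <= `|x|.
Proof.
rewrite [leRHS]/Num.Def.normr /= mx_normrE.
by apply/bigmax_geP; right => /=; exists (i, 0).
Qed.

Lemma cV_norm_le (x : V) (c : R) : 0 <= c -> (forall i, `|x i 0| <= c) -> `|x| <= c.
Proof.
move=> c0 xc; rewrite [leLHS]/Num.Def.normr /= mx_normrE.
by apply/bigmax_leP; split=> // -[i j] _ /=; rewrite ord1.
Qed.

Lemma mulmx_norm_bound (A : 'M[R]_n) :
  exists2 K : R, 0 < K & forall x : V, `|A *m x| <= K * `|x|.
Proof.
exists (1 + \sum_i \sum_j `|A i j|).
  by rewrite ltr_pwDl // sumr_ge0 // => i _; rewrite sumr_ge0.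
move=> x; apply: cV_norm_le => [|i].
  by rewrite mulr_ge0 // addr_ge0 // sumr_ge0 // => i _; rewrite sumr_ge0.
rewrite mxE; apply: (le_trans (ler_norm_sum _ _ _)).
apply: (@le_trans _ _ ((\sum_j `|A i j|) * `|x|)).
  rewrite mulr_suml; apply: ler_sum => j _; rewrite normrM.
  by apply: ler_wpM2l => //; apply: cV_entry_le.
apply: ler_wpM2r => //; rewrite [X in _ <= 1 + X](bigD1 i) //= addrCA lerDl addr_ge0 // sumr_ge0 //.
by move=> k _; rewrite sumr_ge0.
Qed.

Lemma ev_norm_bound (a : 'rV[R]_n) :
  exists2 K : R, 0 < K & forall x : V, `|ev a x| <= K * `|x|.
Proof.
exists (1 + \sum_j `|a 0 j|); first by rewrite ltr_pwDl // sumr_ge0.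
move=> x; rewrite /ev mxE; apply: (le_trans (ler_norm_sum _ _ _)).
rewrite mulrDl mul1r mulr_suml; apply: ler_wpDl => //; apply: ler_sum => j _.
by rewrite normrM; apply: ler_wpM2l => //; apply: cV_entry_le.
Qed.

Lemma nbhs_preimage_affine (w : 'M[R]_n) (q x : V) (U : set V) :
  nbhs (w *m x + q) U -> nbhs x [set y | U (w *m y + q)].
Proof.
move/nbhs_cVP => [e e0 xU]; have [K K0 wK] := mulmx_norm_bound w.
apply/nbhs_cVP; exists (e / K); first exact: divr_gt0.
move=> y yx; apply: xU; rewrite opprD addrACA subrr addr0 -mulmxBr.
by apply: (le_lt_trans (wK _)); rewrite -ltr_pdivlMl // mulrC.
Qed.

Lemma nbhs_ev (a : 'rV[R]_n) (x : V) (e : R) : 0 < e ->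
  nbhs x [set y | `|ev a y - ev a x| < e].
Proof.
move=> e0; have [K K0 aK] := ev_norm_bound a.
apply/nbhs_cVP; exists (e / K); first exact: divr_gt0.
move=> y yx; rewrite /= -evBr; apply: (le_lt_trans (aK _)).
by rewrite -ltr_pdivlMl // mulrC.
Qed.

Lemma nbhs_ev_gt (a : 'rV[R]_n) (x : V) (c : R) : c < ev a x ->
  nbhs x [set y | c < ev a y].
Proof.
rewrite -subr_gt0 => /(nbhs_ev a x); apply: filterS => y /=.
by rewrite ltr_norml => /andP[]; lra.
Qed.

Lemma nbhs_ev_lt (a : 'rV[R]_n) (x : V) (c : R) : ev a x < c ->
  nbhs x [set y | ev a y < c].
Proof.
rewrite -subr_gt0 => /(nbhs_ev a x); apply: filterS => y /=.
by rewrite ltr_norml => /andP[]; lra.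
Qed.

Lemma nbhs_forall (I : finType) (x : V) (U : I -> set V) :
  (forall i, nbhs x (U i)) -> nbhs x [set y | forall i, U i y].
Proof.
move=> xU; have : \forall y \near x, forall i, i \in enum I -> U i y.
  elim: (enum I) => [|i s IH]; first by near=> y.
  near=> y => j; rewrite inE => /predU1P[->|js]; first by near: y; apply: xU.
  by move: j js; near: y.
apply: filterS => y + i; apply; exact: mem_enum.
Unshelve. all: by end_near.
Qed.

Lemma nbhs_direction (x v : V) (U : set V) : nbhs x U ->
  exists2 e : R, 0 < e & forall t, `|t| < e -> U (x + t *: v).
Proof.
move=> /nbhs_cVP[e e0 xU]; exists (e / (1 + `|v|)).
  by rewrite divr_gt0 // ltr_pwDl.
move=> t te; apply: xU; rewrite addrC addKr normrZ.
have v1 : 0 < 1 + `|v| by rewrite ltr_pwDl.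
move: te; rewrite ltr_pdivlMr // => te.
apply: le_lt_trans te; apply: ler_wpM2l => //; lra.
Qed.

End ColumnTopology.

Section AllRoots.
Context (R : realType) (I : finType) (C : I -> I -> int) (n : nat).
Context (hC : kac_moody_matrix C) (S : root_datum C n).
Context (g : kac_moody_algebra R[i] C).
Local Notation V := 'cV[R]_n.
Local Notation alpha := (@alpha R I C n S).
Local Notation alphav := (@alphav R I C n S).
Local Notation sr := (@simple_reflection R I C n S).
Local Notation weyl := (@weyl R I C n S).
Local Notation Delta := (@all_roots R I C n S g).
Local Notation Cf := (@fund_chamber R I C n S).

Definition root_comb (b : I -> int) : 'rV[R]_n := \sum_i (b i)%:~R *: alpha i.

Lemma complex_char0 (m : int) : (m%:~R : R[i]) = 0 -> m = 0.
Proof. by move/eqP; rewrite intr_eq0 => /eqP. Qed.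

Lemma root_combN b : root_comb (fun i => - b i) = - root_comb b.
Proof.
by rewrite /root_comb -sumrN; apply: eq_bigr => i _; rewrite rmorphN scaleNr.
Qed.

Lemma root_comb_delta i : root_comb (delta i) = alpha i.
Proof.
rewrite /root_comb (bigD1 i) //= /delta eqxx scale1r big1 ?addr0 // => j.
by rewrite eq_sym => /negPf ->; rewrite scale0r.
Qed.

Lemma root_comb_reflect i b :
  root_comb b *m sr i = root_comb (reflect_weight C i b).
Proof.
rewrite srEl /root_comb ev_suml.
have -> : \sum_j (b j)%:~R * ev (alpha j) (alphav i) =
    (coroot_pairing C b i)%:~R :> R.
  by rewrite rmorph_sum; apply: eq_bigr => j _; rewrite ev_alphav rmorphM.
rewrite -[X in _ - _ *: X]root_comb_delta /root_comb scaler_sumr -sumrB.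
apply: eq_bigr => j _; rewrite /reflect_weight rmorphB scalerBl rmorphM.
by rewrite scalerA.
Qed.

Definition positive_root (a : 'rV[R]_n) : Prop :=
  exists b : I -> int,
    [/\ a = root_comb b, forall i, 0 <= b i & exists i, b i != 0].

Lemma all_rootsN a : Delta a -> Delta (- a).
Proof.
move=> [b gb ->]; rewrite -/(root_comb b) -root_combN.
by eexists; [apply: (km_rootN complex_char0 gb)|].
Qed.

Lemma all_roots_weyl w a : weyl w -> Delta a -> Delta (a *m w).
Proof.
move=> wW; elim: wW a => [|i v _ IH] a Da; first by rewrite mulmx1.
rewrite mulmxA; apply: IH; case: Da => b gb ->.
rewrite -/(root_comb b) root_comb_reflect.
by eexists; [apply: (km_root_reflect hC complex_char0 i gb)|].
Qed.

Lemma all_roots_alpha i : Delta (alpha i).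
Proof.
exists (delta i); last by rewrite -/(root_comb _) root_comb_delta.
by have [] := km_root_delta hC complex_char0 g i.
Qed.

Lemma all_roots_sign a : Delta a -> positive_root a \/ positive_root (- a).
Proof.
move=> [b gb ->]; have [[j bj] _] := gb.
have [b0|b0] := km_root_sign complex_char0 gb; [left|right].
  by exists b; split=> //; exists j.
exists (fun i => - b i); split; first by rewrite root_combN.
  by move=> i; rewrite oppr_ge0.
by exists j; rewrite oppr_eq0.
Qed.

Lemma positive_root_ge0 a (x : V) : positive_root a ->
  (forall i, 0 <= ev (alpha i) x) -> 0 <= ev a x.
Proof.
move=> [b [-> b0 _]] x0; rewrite /root_comb ev_suml sumr_ge0 // => i _.
by rewrite mulr_ge0 // ler0z.
Qed.

Lemma positive_root_le a (x y : V) : positive_root a ->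
  (forall i, ev (alpha i) x <= ev (alpha i) y) -> ev a x <= ev a y.
Proof.
move=> a0 xy; rewrite -subr_ge0 -evBr; apply: positive_root_ge0 => // i.
by rewrite evBr subr_ge0.
Qed.

Lemma positive_root_gt0 a (x : V) : positive_root a -> Cf x -> 0 < ev a x.
Proof.
move=> [b [-> b0 [j bj]]] x0; rewrite /root_comb ev_suml (bigD1 j) //=.
rewrite ltr_pwDl ?sumr_ge0 // => [|i _].
  by rewrite mulr_gt0 // ltr0z lt_neqAle eq_sym bj b0.
by rewrite mulr_ge0 ?ler0z // ltW.
Qed.

Lemma all_roots_lattice a (q : V) : Delta a -> coroot_lattice S q ->
  exists z : int, ev a q = z%:~R.
Proof.
move=> [b _ ->] qQ.
have /boolp.choice[z zE] : forall i, exists z : int, ev (alpha i) q = z%:~R.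
  by move=> i; apply: coroot_lattice_alpha.
exists (\sum_i b i * z i); rewrite ev_suml rmorph_sum.
by apply: eq_bigr => i _; rewrite zE rmorphM.
Qed.

Lemma vface_root_sign Fv a : is_vface S Fv -> Delta a ->
  [\/ forall v, Fv v -> 0 < ev a v, forall v, Fv v -> ev a v < 0
    | forall v, Fv v -> ev a v = 0].
Proof.
have pos w J : weyl w -> Delta a ->
    [\/ forall v, positive_vface S w J v -> 0 < ev a v,
        forall v, positive_vface S w J v -> ev a v < 0
      | forall v, positive_vface S w J v -> ev a v = 0].
  move=> wW /(all_roots_weyl wW) /all_roots_sign aw.
  have sgn b : positive_root b ->
      (forall v : V, (forall i, if i \in J then ev (alpha i) v = 0
                            else 0 < ev (alpha i) v) -> 0 < ev b v) \/
      (forall v : V, (forall i, if i \in J then ev (alpha i) v = 0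
                            else 0 < ev (alpha i) v) -> ev b v = 0).
    move=> [c [-> c0 _]].
    have [[j jJ cj]|Jc] := pselect (exists2 j, j \notin J & c j != 0); [left|right].
      move=> v vJ; rewrite /root_comb ev_suml (bigD1 j) //= ltr_pwDl //.
        apply: mulr_gt0; first by rewrite ltr0z lt_neqAle eq_sym cj c0.
        by have := vJ j; rewrite (negPf jJ).
      rewrite sumr_ge0 // => i _; rewrite mulr_ge0 ?ler0z //.
      by have := vJ i; case: ifP => // _; [move->|move/ltW].
    move=> v vJ; rewrite /root_comb ev_suml big1 // => i _.
    have := vJ i; case: ifPn => [_ ->|iJ _]; first by rewrite mulr0.
    have [->|ci] := eqVneq (c i) 0; first by rewrite mul0r.
    by case: Jc; exists i.
  case: aw => /sgn[H|H].
  - by apply: Or31 => _ [v vJ <-]; rewrite evM; apply: H.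
  - by apply: Or33 => _ [v vJ <-]; rewrite evM; apply: H.
  - apply: Or32 => _ [v vJ <-]; rewrite evM -oppr_gt0 -evNl; exact: H.
  - by apply: Or33 => _ [v vJ <-]; apply: oppr_inj; rewrite evM -evNl oppr0; apply: H.
move=> [w [J [wW [->|->]]]] Da; first exact: pos.
have [H|H|H] := pos w J wW Da.
- by apply: Or32 => _ [v vJ <-]; rewrite evNr oppr_lt0; apply: H.
- by apply: Or31 => _ [v vJ <-]; rewrite evNr oppr_gt0; apply: H.
- by apply: Or33 => _ [v vJ <-]; rewrite evNr H ?oppr0.
Qed.

Lemma fund_chamber_nonempty : exists v : V, Cf v.
Proof.
have [v v1] := alpha_dual S (fun=> 1 : R); exists v => i.
by rewrite v1.
Qed.

Lemma nbhs_fund_chamber x : Cf x -> nbhs x Cf.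
Proof. by move=> xC; apply: nbhs_forall => i; apply: nbhs_ev_gt. Qed.

Lemma chamber_absorb (w v : V) : Cf v ->
  exists2 T : R, 1 <= T & Cf (w + T *: v).
Proof.
move=> vC; exists (1 + \sum_i `|ev (alpha i) w| / ev (alpha i) v).
  by rewrite lerDl sumr_ge0 // => i _; rewrite divr_ge0 // ltW.
move=> i; rewrite evDr evZr mulrDl mul1r (bigD1 i) //= mulrDl divfK ?gt_eqF //.
set x := ev _ w; set y := ev _ v; set T := \sum_(_ | _) _.
have y0 : 0 < y by apply: vC.
have T0 : 0 <= T by rewrite sumr_ge0 // => j _; rewrite divr_ge0 // ltW.
have := ler_norm (- x); rewrite normrN; have := mulr_ge0 T0 (ltW y0); lra.
Qed.

Lemma closure_fund_chamberP x :
  closure Cf x <-> forall i, 0 <= ev (alpha i) x.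
Proof.
split=> [xC i|x0].
  rewrite leNgt; apply/negP => /nbhs_ev_lt/xC[y [yC /= yi]].
  by have := yC i; rewrite ltNge (ltW yi).
have [v vC] := fund_chamber_nonempty.
move=> U /(nbhs_direction v)[e e0 xU]; exists (x + (e / 2) *: v); split.
  by move=> i; rewrite evDr evZr ltr_wpDl // mulr_gt0 // divr_gt0.
by apply: xU; rewrite ger0_norm; lra.
Qed.

Lemma vface_nonempty (Fv : set V) : is_vface S Fv -> exists v, Fv v.
Proof.
move=> [w [J [_ FvE]]].
have [v vE] := alpha_dual S (fun i => if i \in J then 0 else 1 : R).
have FJ : positive_vface S w J (w *m v).
  by exists v => // i; have := vE i; case: ifP => // _ ->.
by case: FvE => ->; eexists; [apply: FJ|exists (w *m v)].
Qed.

Lemma vfaceZ (Fv : set V) (v : V) (t : R) : is_vface S Fv -> Fv v -> 0 < t -> Fv (t *: v).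
Proof.
have pos w J x : positive_vface S w J x -> 0 < t -> positive_vface S w J (t *: x).
  move=> [y yJ <-] t0; exists (t *: y); last by rewrite -scalemxAr.
  by move=> i; have := yJ i; rewrite evZr; case: ifP => _ ; [move->; rewrite mulr0|apply: mulr_gt0].
move=> [w [J [_ [->|->]]]] => [Fv1 t0|[x xJ <-] t0]; first exact: pos.
by exists (t *: x); [apply: pos|rewrite scalerN].
Qed.

End AllRoots.

(** * Faces under the affine Weyl group *)

Section FaceImages.
Context (R : realType) (I : finType) (C : I -> I -> int) (n : nat).
Context (hC : kac_moody_matrix C) (S : root_datum C n).
Context (g : kac_moody_algebra R[i] C).
Local Notation V := 'cV[R]_n.
Local Notation weyl := (@weyl R I C n S).

Lemma face_superset (x : V) Fv E E' : face S g x Fv E -> E `<=` E' -> face S g x Fv E'.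
Proof.
move=> [k [k' [Om [xOm PE OmP]]]] EE'; exists k, k', Om; split=> //.
exact: subset_trans EE'.
Qed.

(** The Weyl group permutes the roots, and roots take integral values on the coroot lattice, so an
    affine Weyl element permutes the half-apartments and only shifts their levels by integers. *)
Lemma face_affine_sub (w : 'M[R]_n) (q y : V) (Fv E : set V) :
  weyl w -> coroot_lattice S q ->
  face S g y Fv [set x | E (w *m x + q)] ->
  face S g (w *m y + q) ((fun v => w *m v) @` Fv) E.
Proof.
move=> wW qQ [k [k' [Om [yOm PE OmP]]]].
have /boolp.choice[z zE] : forall a : 'rV[R]_n, exists z : int,
    all_roots S g a -> ev a q = z%:~R.
  move=> a; have [Da|nDa] := pselect (all_roots S g a); last by exists 0.
  by have [z zE] := all_roots_lattice Da qQ; exists z.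
pose shift (k : 'rV[R]_n -> option int) a := omap (fun m => m - z a) (k (a *m w)).
have shE a x m : ev (a *m w) x + (z a)%:~R + (m - z a)%:~R =
    ev (a *m w) x + m%:~R by rewrite rmorphB /=; ring.
have shiftE (k0 : 'rV[R]_n -> option int) a x : all_roots S g a ->
    half a (shift k0 a) (w *m x + q) <-> half (a *m w) (k0 (a *m w)) x.
  move=> Da; rewrite /shift; case: (k0 _) => //= m.
  by rewrite evDr evM (zE _ Da) shE.
have oshiftE (k0 : 'rV[R]_n -> option int) a x : all_roots S g a ->
    open_half a (shift k0 a) (w *m x + q) <-> open_half (a *m w) (k0 (a *m w)) x.
  move=> Da; rewrite /shift; case: (k0 _) => //= m.
  by rewrite evDr evM (zE _ Da) shE.
have wK x : x = w *m (invmx w *m (x - q)) + q by rewrite (weyl_mulxV hC _ wW) subrK.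
exists (shift k), (shift k'), [set x | Om (invmx w *m x + - (invmx w *m q))]; split.
- apply: (@nbhs_preimage_affine _ _ (invmx w)).
  by rewrite mulmxDr (weyl_mulVx hC _ wW) addrK.
- move=> x Px; rewrite (wK x); apply: PE => a Da.
  have Da' : all_roots S g (a *m invmx w).
    by apply: (all_roots_weyl hC) => //; apply: (weyl_inv hC).
  have [Px1 Px2] := Px _ Da'; rewrite (wK x) in Px1 Px2.
  move/shiftE: Px1 => /(_ Da'); move/oshiftE: Px2 => /(_ Da').
  by rewrite mulmxKV ?(weyl_unit hC wW).
- move=> x [xOm [_ [v vFv <-] xE]] a Da.
  have xE' : x = w *m (y + v) + q by rewrite -xE mulmxDr addrAC.
  have [] : (half (a *m w) (k (a *m w)) `&` open_half (a *m w) (k' (a *m w))) (y + v).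
    apply: OmP; last exact: (all_roots_weyl hC).
    split; last by exists v.
    by move: xOm; rewrite /= -mulmxBr xE' addrK (weyl_mulVx hC _ wW).
  by rewrite xE' => ? ?; split; [apply/shiftE|apply/oshiftE].
Qed.

Lemma vface_image (w : 'M[R]_n) (Fv : set V) : weyl w -> is_vface S Fv ->
  is_vface S ((fun v => w *m v) @` Fv).
Proof.
move=> wW [w' [J [w'W FvE]]]; exists (w *m w'), J; split; first exact: weylMM.
have pE : positive_vface S (w *m w') J = (fun v => w *m v) @` positive_vface S w' J.
  apply/seteqP; split=> [_ [v vJ <-]|_ [_ [v vJ <-] <-]].
    by exists (w' *m v); [exists v|rewrite mulmxA].
  by exists v => //; rewrite mulmxA.
rewrite pE; case: FvE => ->; [by left|right].
apply/seteqP; split=> [_ [_ [v vJ <-] <-]|_ [_ [v vJ <-] <-]].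
  by exists (w *m v); [exists v|rewrite mulmxN].
by exists (- v); [exists v|rewrite mulmxN].
Qed.

Lemma face_affine (w : 'M[R]_n) (q y : V) (Fv E : set V) :
  weyl w -> coroot_lattice S q ->
  face S g (w *m y + q) ((fun v => w *m v) @` Fv) E <->
  face S g y Fv [set x | E (w *m x + q)].
Proof.
move=> wW qQ; split; last exact: face_affine_sub.
have q'Q : coroot_lattice S (- (invmx w *m q)).
  rewrite -scaleN1r -[-1]/((-1)%:~R).
  exact: coroot_latticeZ (coroot_lattice_weyl (weyl_inv hC wW) qQ).
move=> FE; have := @face_affine_sub (invmx w) (- (invmx w *m q)) (w *m y + q)
  ((fun v => w *m v) @` Fv) [set x | E (w *m x + q)] (weyl_inv hC wW) q'Q.
rewrite mulmxDr addrK (weyl_mulVx hC _ wW).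
rewrite (_ : _ @` (_ @` Fv) = Fv); last first.
  apply/seteqP; split=> [_ [_ [v vFv <-] <-]|v vFv].
    by rewrite (weyl_mulVx hC _ wW).
  by exists (w *m v); [exists v|rewrite (weyl_mulVx hC _ wW)].
apply; apply: face_superset FE _ => x /=.
by rewrite mulmxBr !(weyl_mulxV hC _ wW) subrK.
Qed.

Lemma chamber_image (u : V -> V) (F : set_system V) : affine_weyl S u ->
  is_chamber S g F -> is_chamber S g [set E | F (u @^-1` E)].
Proof.
move=> [w [q [wW qQ uE]]] [[y [Fv [vFv FE]]] [_ FT Fmin]].
split.
  exists (w *m y + q), ((fun v => w *m v) @` Fv); split; first exact: vface_image.
  by apply/seteqP; split=> E; rewrite /= uE FE => /(face_affine y Fv E wW qQ).
split=> //.
- by split=> //; exists 0.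
- move=> E' [E'0 E'aff] FE' x _.
  have -> : x = u (invmx w *m (x - q)) by rewrite uE (weyl_mulxV hC _ wW) subrK.
  apply: (Fmin _ _ FE' (invmx w *m (x - q)) Logic.I); split.
    have [z E'z] := E'0; exists (invmx w *m (z - q)).
    by rewrite /= uE (weyl_mulxV hC _ wW) subrK.
  move=> a b t /= E'a E'b; have := E'aff _ _ t E'a E'b; rewrite uE.
  rewrite mulmxDr -!scalemxAr !scalerDr addrACA -scalerDl subrK scale1r.
  by [].
Qed.

End FaceImages.

(** * Charts of apartments *)

Section Norms.
Context (R : realType) (n : nat) (N : 'cV[R]_n -> R) (hN : is_norm N).

Lemma is_normZ (a : R) x : N (a *: x) = `|a| * N x.
Proof. by have [] := hN. Qed.

Lemma is_norm0 : N 0 = 0.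
Proof. by rewrite -(scale0r 0) is_normZ normr0 mul0r. Qed.

Lemma is_normN x : N (- x) = N x.
Proof. by rewrite -scaleN1r is_normZ normrN1 mul1r. Qed.

Lemma is_norm_ge0 x : 0 <= N x.
Proof.
have [_ _ tri] := hN; have := tri x (- x).
by rewrite subrr is_norm0 is_normN; lra.
Qed.

Lemma is_norm_gt0 x : x != 0 -> 0 < N x.
Proof.
move=> x0; rewrite lt_neqAle is_norm_ge0 andbT eq_sym.
by apply: contra x0 => /eqP; have [N0 _ _] := hN => /N0 ->.
Qed.

Lemma is_norm_le_mx_norm : exists2 K : R, 0 < K & forall x, N x <= K * `|x|.
Proof.
have [_ _ tri] := hN.
exists (1 + \sum_i N (delta_mx i 0)).
  by rewrite ltr_pwDl // sumr_ge0 // => i _; apply: is_norm_ge0.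
move=> x; rewrite [X in N X]matrix_sum_delta.
under eq_bigr do rewrite big_ord1.
apply: (@le_trans _ _ (\sum_i N (x i 0 *: delta_mx i 0))).
  elim/big_ind2 : _ => // [|a b c e ab ce]; first by rewrite is_norm0.
  by apply: le_trans (tri _ _) _; apply: lerD.
rewrite mulrDl mul1r mulr_suml; apply: ler_wpDl => //; apply: ler_sum => i _.
by rewrite is_normZ mulrC; apply: ler_wpM2l; [apply: is_norm_ge0|apply: cV_entry_le].
Qed.

End Norms.

(** * Charts, the masure axioms and the distance *)

Section Charts.
Context (R : realType) (I : finType) (C : I -> I -> int) (n : nat).
Context (hC : kac_moody_matrix C) (S : root_datum C n).
Context (g : kac_moody_algebra R[i] C).
Context (M : apartment_system R n) (hM : is_masure S g M).
Context (d : M -> M -> R) (hd : is_distance d).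
Context (hnorm : forall A : set M, apartments A -> induced_by_norm d A).
Local Notation V := 'cV[R]_n.
Local Notation Delta := (@all_roots R I C n S g).

Definition chart (A : set M) (f : V -> M) : Prop := apartments A /\ isomW A f.

Lemma chart_exists A : apartments A -> exists f, chart A f.
Proof.
move=> aA; have [f [_ _ fE]] := MA1 hM aA; exists f; split=> //; rewrite fE.
by exists id => //; apply: affine_weyl_id.
Qed.

Lemma affine_weyl_inj (u : V -> V) : affine_weyl S u -> injective u.
Proof. by move=> /(affine_weyl_inv hC)[v [_ /can_inj]]. Qed.

Lemma chart_inj A f : chart A f -> injective f.
Proof.
move=> [aA]; have [f0 [f0i _ ->]] := MA1 hM aA.
by move=> [u uW <-]; apply: inj_comp => //; apply: affine_weyl_inj.
Qed.

Lemma chart_range A f : chart A f -> range f = A.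
Proof.
move=> [aA]; have [f0 [_ <- ->]] := MA1 hM aA.
move=> [u /(affine_weyl_inv hC)[v [_ _ uv]] <-].
apply/seteqP; split=> [_ [x _ <-]|_ [x _ <-]]; first by exists (u x).
by exists (v x) => //=; rewrite uv.
Qed.

Lemma chart_in A f x : chart A f -> A (f x).
Proof. by move=> /chart_range <-; exists x. Qed.

Lemma chart_comp A f u : chart A f -> affine_weyl S u -> chart A (f \o u).
Proof.
move=> [aA]; have [f0 [_ _ fE]] := MA1 hM aA.
rewrite fE => -[v vW <-] uW; split=> //; rewrite fE; exists (v \o u) => //.
exact: affine_weyl_comp.
Qed.

Lemma chart_trans A f f' : chart A f -> chart A f' ->
  exists2 u, affine_weyl S u & f' = f \o u.
Proof.
move=> [aA]; have [f0 [_ _ fE]] := MA1 hM aA.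
rewrite /chart fE => -[u uW <-] [_ [u' u'W <-]].
have [v [vW uv vu]] := affine_weyl_inv hC uW.
exists (v \o u'); first exact: affine_weyl_comp.
by apply/funext => x /=; rewrite vu.
Qed.

Lemma weyl_isom_chart A A' f phi : chart A f -> apartments A' ->
  weyl_isom S A A' phi -> chart A' (phi \o f).
Proof.
move=> [_ fA] /chart_exists[f' f'A'] /(_ f f' fA (proj2 f'A'))[u uW phiE].
rewrite (_ : phi \o f = f' \o u); first exact: chart_comp.
by apply/funext => x; apply: phiE.
Qed.

Lemma chart_norm A f : chart A f ->
  exists2 N, is_norm N & forall x y, d (f x) (f y) = N (x - y).
Proof. by move=> [aA fA]; apply: hnorm fA. Qed.

Lemma d_eq0 x y : d x y = 0 -> x = y.
Proof. by have [H _ _] := hd => /H. Qed.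

Lemma dC x y : d x y = d y x. Proof. by have [] := hd. Qed.

Lemma d_triangle y x z : d x z <= d x y + d y z. Proof. by have [] := hd. Qed.

Lemma dxx x : d x x = 0. Proof. by have [H _ _] := hd; apply/H. Qed.

Lemma d_ge0 x y : 0 <= d x y.
Proof. by have := d_triangle y x x; rewrite dxx (dC y x); lra. Qed.

(** Both charts are Lipschitz for [d], so [d (f x) (f' x)] is at most a constant times the distance
    from [x] to [X]. *)
Lemma charts_eq_closure A A' f f' (X : set V) : chart A f -> chart A' f' ->
  (forall x, X x -> f x = f' x) -> forall x, closure X x -> f x = f' x.
Proof.
move=> fA f'A' fX x xX; apply: d_eq0; apply/eqP; rewrite eq_le d_ge0 andbT.
rewrite leNgt; apply/negP => d0.
have [N hN fN] := chart_norm fA; have [N' hN' f'N'] := chart_norm f'A'.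
have [K K0 NK] := is_norm_le_mx_norm hN.
have [K' K'0 N'K'] := is_norm_le_mx_norm hN'.
have KK' : 0 < K + K' by apply: addr_gt0.
have /xX[y [Xy /= yx]] : nbhs x [set y | `|y - x| < d (f x) (f' x) / (K + K')].
  by apply/nbhs_cVP; eexists; first exact: (divr_gt0 d0 KK').
have := d_triangle (f y) (f x) (f' x); rewrite fN (fX _ Xy) f'N'.
have := NK (x - y); have := N'K' (y - x); rewrite [`|x - y|]distrC.
move: yx; rewrite ltr_pdivlMr //; nra.
Qed.

Lemma MA2_chart A A' f F : apartments A -> chart A f -> apartments A' ->
  MA2_filter S g F -> F (f @^-1` A') ->
  exists (k : 'rV[R]_n -> option int) f', 
    [/\ F (\bigcap_(a in Delta) half a (k a)), chart A' f' &
        forall x, (\bigcap_(a in Delta) half a (k a)) x -> f' x = f x].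
Proof.
move=> aA [_ fA] aA' MF FA'; pose F' : set_system M := f @ F.
have cfg : MA2_config S g A A' f F' by split=> //; exists f, F.
have [_ [phi phiW [E [k [FP PE]] phiE]]] := MA2 hM cfg.
exists k, (phi \o f); split.
- suff -> : \bigcap_(a in Delta) half a (k a) =
      f @^-1` (f @` \bigcap_(a in Delta) half a (k a)) by [].
  apply/seteqP; split=> [x Px|x [y Py]]; first by exists x.
  by move=> /(@chart_inj A f (conj aA fA)) <-.
- exact: (weyl_isom_chart (conj aA fA) aA' phiW).
- by move=> x Px /=; apply: phiE; apply: PE.
Qed.

Definition preordered (x y : V) : Prop := tits_le S x y \/ tits_le S y x.

Lemma segmentC (x y : V) : segment x y = segment y x.
Proof.
have sub (a b : V) : segment a b `<=` segment b a.
  move=> z [t [/andP[t0 t1] ->]]; exists (1 - t); split.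
    by apply/andP; split; lra.
  by apply/colP => i; rewrite !mxE; ring.
by apply/seteqP; split; apply: sub.
Qed.

Lemma charts_segment A A' f f' x y x' y' : chart A f -> chart A' f' ->
  f x = f' x' -> f y = f' y' -> preordered x y ->
  f @` segment x y = f' @` segment x' y'.
Proof.
move=> [aA fA] [aA' f'A'] fx fy [xy|yx]; first exact: (MAO hM aA aA' fA f'A' fx fy).
by rewrite segmentC (segmentC x'); apply: (MAO hM aA aA' fA f'A' fy fx).
Qed.

(** (MAO) equates the two segments as sets. A point of either one is determined by its [d]-distance
    to the common end, so the parametrisations agree too. *)
Lemma charts_agree_segment A A' f f' x y (t : R) : chart A f -> chart A' f' ->
  f x = f' x -> f y = f' y -> preordered x y -> 0 <= t <= 1 ->
  f (x + t *: (y - x)) = f' (x + t *: (y - x)).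
Proof.
move=> fA f'A' fx fy xy /andP[t0 t1].
have [->|nxy] := eqVneq y x; first by rewrite subrr scaler0 addr0.
have : (f @` segment x y) (f (x + t *: (y - x))).
  by exists (x + t *: (y - x)) => //; exists t; rewrite t0.
rewrite (charts_segment fA f'A' fx fy xy) => -[_ [s [/andP[s0 s1] ->]] fs].
have [N hN fN] := chart_norm fA; have [N' hN' f'N'] := chart_norm f'A'.
rewrite -fs; congr (f' (_ + _ *: _)).
have Nyx : N (y - x) = N' (y - x) by rewrite -fN -f'N' fx fy.
have : d (f (x + t *: (y - x))) (f x) = d (f' (x + s *: (y - x))) (f' x).
  by rewrite fs fx.
rewrite fN f'N' ![x + _]addrC !addrK !is_normZ // !ger0_norm // Nyx.
have N0 : N' (y - x) != 0 by rewrite gt_eqF // is_norm_gt0 // subr_eq0.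
by move/(mulIf N0).
Qed.

(** If [f y = f' y'], then (MAO) gives [t (y - x) = s (y' - x)] for some [s]. Lengths from [x],
    measured by both norms, force [s = t], hence [y' = y]. *)
Lemma charts_agree_extend A A' f f' x y (t : R) : chart A f -> chart A' f' ->
  f x = f' x -> 0 < t <= 1 -> f (x + t *: (y - x)) = f' (x + t *: (y - x)) ->
  A' (f y) -> preordered x y -> f y = f' y.
Proof.
move=> fA f'A' fx /andP[t0 t1] ft A'y xy.
have [->//|nxy] := eqVneq y x.
have [y' _ fy] : range f' (f y) by rewrite (chart_range f'A').
have : (f @` segment x y) (f (x + t *: (y - x))).
  by exists (x + t *: (y - x)) => //; exists t; rewrite (ltW t0).
rewrite (charts_segment fA f'A' fx (esym fy) xy) => -[_ [s [/andP[s0 s1] ->]]].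
rewrite ft => /(chart_inj f'A')/addrI st.
have [N hN fN] := chart_norm fA; have [N' hN' f'N'] := chart_norm f'A'.
have Nyx : N (y - x) = N' (y' - x) by rewrite -fN -f'N' fx fy.
have tN : t * N (y - x) = t * N' (y - x).
  have : d (f (x + t *: (y - x))) (f x) = d (f' (x + t *: (y - x))) (f' x).
    by rewrite ft fx.
  by rewrite fN f'N' ![x + _]addrC !addrK !is_normZ // !ger0_norm // ltW.
have sN : s * N' (y' - x) = t * N' (y - x).
  by have := congr1 N' st; rewrite !is_normZ // !ger0_norm // ltW.
have N0 : N (y - x) != 0 by rewrite gt_eqF // is_norm_gt0 // subr_eq0.
have : s * N (y - x) = t * N (y - x) by rewrite tN Nyx.
move/(mulIf N0) => ts; move: st; rewrite ts => /(scalerI (lt0r_neq0 t0))/addIr.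
by rewrite -fy => ->.
Qed.

Lemma fund_chamber_tits x : (forall i, 0 <= ev (alpha R S i) x) -> tits_cone S x.
Proof.
move=> x0; exists 1%:M, x; split; [by constructor| |by rewrite mul1mx].
exact/closure_fund_chamberP.
Qed.

Lemma germ_chart A A' f x y (e : R) : chart A f -> apartments A' ->
  preordered x y -> 0 < e ->
  (forall t, 0 <= t < e -> A' (f (x + t *: (y - x)))) ->
  exists (k : 'rV[R]_n -> option int) f' (e' : R), 
    [/\ 0 < e', chart A' f',
        forall t, 0 <= t < e' ->
          (\bigcap_(a in Delta) half a (k a)) (x + t *: (y - x)) &
        forall x, (\bigcap_(a in Delta) half a (k a)) x -> f' x = f x].
Proof.
move=> fA aA' xy e0 A'f; have [xE|xny] := eqVneq x y.
  have MF : MA2_filter S g (globally [set x]) by apply: Or41; exists x.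
  have [|k [f' [Fk f'A' f'E]]] := MA2_chart (proj1 fA) fA aA' MF.
    by move=> _ ->; have := A'f 0; rewrite scale0r addr0; apply; rewrite lexx.
  exists k, f', 1; split=> // t _.
  by rewrite -xE subrr scaler0 addr0; apply: Fk.
have yx : 0 < `|y - x| by rewrite normr_gt0 subr_eq0 eq_sym.
have MF : MA2_filter S g (within (segment x y) (nbhs x)).
  by apply: Or42; exists x, y.
have FA' : within (segment x y) (nbhs x) (f @^-1` A').
  apply/nbhs_cVP; exists (e * `|y - x|); first exact: mulr_gt0.
  move=> z zx [t [/andP[t0 t1] zE]]; rewrite /= zE; apply: A'f; rewrite t0 /=.
  by move: zx; rewrite zE addrC addKr normrZ ger0_norm // ltr_pM2r.
have [k [f' [Fk f'A' f'E]]] := MA2_chart (proj1 fA) fA aA' MF FA'.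
have [e1 e10 kE] := nbhs_direction (y - x) Fk.
exists k, f', (Num.min e1 1); split=> //; first by rewrite lt_min e10 ltr01.
move=> t /andP[t0]; rewrite lt_min => /andP[te1 t1].
apply: (kE t); first by rewrite ger0_norm.
by exists t; rewrite t0 ltW.
Qed.

End Charts.

(** * Charts agreeing on open convex sets *)

Section Convexity.
Context (R : realType) (n : nat).
Local Notation V := 'cV[R]_n.

Definition convex (E : set V) : Prop :=
  forall x y (t : R), E x -> E y -> 0 <= t <= 1 -> E (x + t *: (y - x)).

Lemma convex_ball (E : set V) (x y : V) (r t : R) : convex E ->
  (forall z, `|z - x| < r -> E z) -> (forall z, `|z - y| < r -> E z) ->
  0 <= t <= 1 -> forall z, `|z - (x + t *: (y - x))| < r -> E z.
Proof.
move=> cE xE yE t01 z zr; pose w := z - (x + t *: (y - x)).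
have -> : z = (x + w) + t *: ((y + w) - (x + w)).
  by apply/colP => i; rewrite !mxE; ring.
by apply: cE => //; [apply: xE|apply: yE]; rewrite addrC addKr.
Qed.

Lemma convex_interior (E : set V) : convex E -> convex [set x | nbhs x E].
Proof.
move=> cE x y t /= /nbhs_cVP[e e0 xE] /nbhs_cVP[e' e'0 yE] t01.
apply/nbhs_cVP; exists (Num.min e e'); first by rewrite lt_min e0.
apply: (convex_ball cE) => // z; rewrite lt_min => /andP[ze ze'].
  exact: xE.
exact: yE.
Qed.

Lemma convex_closure_interior (E : set V) (o : V) : convex E -> nbhs o E ->
  forall z, closure E z -> closure [set x | nbhs x E] z.
Proof.
move=> cE /nbhs_cVP[r r0 oE] z zE U /nbhs_interior/zE[x [Ex xU]].
have [e e0 xeU] := nbhs_direction (o - x) xU.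
pose t := Num.min (e / 2) 1.
have t0 : 0 < t by rewrite lt_min ltr01 divr_gt0.
have te : t < e by rewrite (@le_lt_trans _ _ (e / 2)) ?ge_min ?lexx //; lra.
have t1 : t <= 1 by rewrite ge_min lexx orbT.
exists (x + t *: (o - x)); split; last by apply: xeU; rewrite ger0_norm ?ltW.
apply/nbhs_cVP; exists (t * r); first exact: mulr_gt0.
move=> y yr; pose w := t^-1 *: (y - (x + t *: (o - x))).
have -> : y = x + t *: ((o + w) - x).
  rewrite /w addrAC scalerDr scalerA divff ?gt_eqF // scale1r.
  by apply/colP => i; rewrite !mxE; ring.
apply: cE; rewrite ?(ltW t0) //; apply: oE; rewrite addrC addKr normrZ.
by rewrite ger0_norm ?invr_ge0 ?ltW // ltr_pdivrMl.
Qed.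

Lemma convex_mid (E : set V) x y : convex E -> E x -> E y ->
  E (2^-1 *: (x + y)).
Proof.
move=> cE Ex Ey; have -> : 2^-1 *: (x + y) = x + 2^-1 *: (y - x).
  by apply/colP => i; rewrite !mxE; field.
by apply: cE => //; apply/andP; split; lra.
Qed.

(* The directions in which a convex set extends both ways from one of its
   points form a linear subspace, which by minimality is everything. *)
Lemma convex_full_nbhs (E : set V) : convex E -> E !=set0 ->
  (forall E', affine_subspace E' -> E `<=` E' -> [set: V] `<=` E') ->
  exists o : V, nbhs o E.
Proof.
move=> cE [p0 Ep0] fullE.
pose X := [set v : V | exists p (e : R), [/\ 0 < e, E (p + e *: v) & E (p - e *: v)]].
have X_lin (a : R) v : X v -> X (a *: v).
  move=> [p [e [e0 pv1 pv2]]]; have [->|a0] := eqVneq a 0.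
    exists p0, 1; rewrite ltr01 scale0r scaler0 addr0 subr0; split=> //.
  exists p, (e / `|a|); split; first by rewrite divr_gt0 ?normr_gt0.
    rewrite scalerA; have [a0'|a0'] := ltrP 0 a.
      by rewrite gtr0_norm // divfK.
    by rewrite ler0_norm // invrN mulrN mulNr divfK // scaleNr.
  rewrite scalerA; have [a0'|a0'] := ltrP 0 a.
    by rewrite gtr0_norm // divfK.
  by rewrite ler0_norm // invrN mulrN mulNr divfK // scaleNr opprK.
have X_seg p v (e t : R) : 0 < e -> E (p + e *: v) -> E (p - e *: v) ->
    `|t| <= e -> E (p + t *: v).
  move=> e0 Ep Em; rewrite ler_norml => /andP[te1 te2].
  have -> : p + t *: v = (p - e *: v) +
      ((t + e) / (2 * e)) *: ((p + e *: v) - (p - e *: v)).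
    by apply/colP => i; rewrite !mxE; field; rewrite gt_eqF.
  apply: cE => //; rewrite divr_ge0 /= ?ler_pdivrMr; lra.
have X_add v w : X v -> X w -> X (v + w).
  move=> [p [e [e0 pv1 pv2]]] [q [e' [e'0 qw1 qw2]]].
  pose m := Num.min e e'; have m0 : 0 < m by rewrite lt_min e0.
  have me : `|m| <= e /\ `|m| <= e'.
    by rewrite gtr0_norm // !ge_min !lexx orbT.
  have me' : `|- m| <= e /\ `|- m| <= e' by rewrite normrN.
  exists (2^-1 *: (p + q)), (m / 2); split; first by rewrite divr_gt0.
    have := convex_mid cE (X_seg _ _ _ _ e0 pv1 pv2 me.1) (X_seg _ _ _ _ e'0 qw1 qw2 me.2).
    by congr E; apply/colP => i; rewrite !mxE; field.
  have := convex_mid cE (X_seg _ _ _ _ e0 pv1 pv2 me'.1) (X_seg _ _ _ _ e'0 qw1 qw2 me'.2).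
  by congr E; apply/colP => i; rewrite !mxE; field.
have X0 : X 0.
  by exists p0, 1; rewrite ltr01 scaler0 addr0 subr0.
have XT v : X v.
  have := fullE [set z | X (z - p0)] _ _ (p0 + v) Logic.I.
  rewrite /= [p0 + v]addrC addrK; apply.
    split=> [|x y t Xx Xy]; first by exists p0; rewrite /= subrr.
    rewrite /=; have -> : (1 - t) *: x + t *: y - p0 = (1 - t) *: (x - p0) + t *: (y - p0).
      by apply/colP => i; rewrite !mxE; ring.
    by apply: X_add; apply: X_lin.
  move=> x Ex; exists (2^-1 *: (p0 + x)), 2^-1; split; first by rewrite invr_gt0.
    by move: Ex; congr E; apply/colP => i; rewrite !mxE; field.
  by move: Ep0; congr E; apply/colP => i; rewrite !mxE; field.
(* Induction on the coordinates: [E] contains a small ball of the span of those already treated. A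
   new one is added by averaging the centre with a point around which [E] extends along this
   coordinate. *)
have [ctr [e [e0 oE]]] : exists (o : V) (e : R), 0 < e /\
    forall x : V, (forall j, j \notin enum 'I_n -> x j 0 = 0) -> `|x| <= e -> E (o + x).
  elim: (enum 'I_n) => [|j s [ o1 [e [e0 oE]]]].
    exists p0, 1; split=> // x x0 _; rewrite (_ : x = 0) ?addr0 //.
    by apply/colP => j; rewrite x0 // mxE.
  have [p [e' [e'0 pj1 pj2]]] := XT (delta_mx j 0).
  exists (2^-1 *: (o1 + p)), (Num.min e e' / 2).
  split=> [|x x0 xe]; first by rewrite divr_gt0 // lt_min e0.
  pose xj := x j 0; pose y := x - xj *: delta_mx j 0.
  have xje : `|2 * xj| <= e'.
    rewrite normrM gtr0_norm // mulrC -ler_pdivlMr //.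
    apply: (le_trans (cV_entry_le x j)); apply: (le_trans xe).
    by rewrite ler_pM2r ?invr_gt0 // ge_min lexx orbT.
  have ye : `|2 *: y| <= e.
    rewrite normrZ gtr0_norm // mulrC -ler_pdivlMr //.
    apply: (@le_trans _ _ `|x|); last first.
      by apply: (le_trans xe); rewrite ler_pM2r ?invr_gt0 // ge_min lexx.
    apply: cV_norm_le => // i; rewrite !mxE eqxx andbT.
    have [->|_] := eqVneq i j; first by rewrite mulr1 subrr normr0.
    by rewrite mulr0 subr0; apply: cV_entry_le.
  have := convex_mid cE (oE (2 *: y) _ ye) (X_seg _ _ _ _ e'0 pj1 pj2 xje).
  rewrite (_ : 2^-1 *: _ = 2^-1 *: (o1 + p) + x); last first.
    by apply/colP => i; rewrite !mxE; field.
  apply=> i is_; rewrite !mxE eqxx andbT.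
  have [->|ij] := eqVneq i j; first by rewrite mulr1 subrr mulr0.
  by rewrite mulr0 subr0 x0 ?mulr0 // inE negb_or ij.
exists ctr; apply/nbhs_cVP; exists e => // y ye.
have := oE (y - ctr); rewrite [ctr + _]addrC subrK; apply; last exact: ltW.
by move=> j; rewrite mem_enum.
Qed.

End Convexity.

(** * Propagation of the agreement of charts *)

Section OpenCharts.
Context (R : realType) (I : finType) (C : I -> I -> int) (n : nat).
Context (hC : kac_moody_matrix C) (S : root_datum C n).
Context (g : kac_moody_algebra R[i] C).
Context (M : apartment_system R n) (hM : is_masure S g M).
Context (d : M -> M -> R) (hd : is_distance d).
Context (hnorm : forall A : set M, apartments A -> induced_by_norm d A).
Local Notation V := 'cV[R]_n.
Local Notation Cf := (@fund_chamber R I C n S).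

(** As [B] is open, the segment from [p] to [p + v] begins inside [B], and agreement on this
    beginning extends to its other end. *)
Lemma charts_agree_translate (A A' : set M) (f f' : V -> M) (B : set V) (v : V) :
  chart A f -> chart A' f' -> (forall p, B p -> nbhs p B) ->
  (forall p, B p -> f p = f' p) -> (forall p, B p -> A' (f (p + v))) ->
  (forall p, preordered S p (p + v)) ->
  forall p, B p -> f (p + v) = f' (p + v).
Proof.
move=> fA f'A' oB ff' A'f pv p Bp.
have [e e0 pB] := nbhs_direction v (oB _ Bp).
pose t := Num.min (e / 2) 1.
have t0 : 0 < t by rewrite lt_min ltr01 divr_gt0.
have te : t < e by rewrite (@le_lt_trans _ _ (e / 2)) ?ge_min ?lexx //; lra.
have t1 : t <= 1 by rewrite ge_min lexx orbT.
apply: (charts_agree_extend hC hM hnorm (x := p) (t := t) fA f'A') => //.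
- exact: ff'.
- by rewrite t0.
- by rewrite [p + v]addrC addrK; apply/ff'/pB; rewrite ger0_norm ?ltW.
- exact: A'f.
Qed.

Lemma charts_norm_eq (A A' : set M) (f f' : V -> M) (o : V) N N' : chart A f -> chart A' f' ->
  nbhs o [set x | f x = f' x] ->
  is_norm N -> (forall x y, d (f x) (f y) = N (x - y)) ->
  is_norm N' -> (forall x y, d (f' x) (f' y) = N' (x - y)) -> N =1 N'.
Proof.
move=> fA f'A' oU hN fN hN' f'N' v.
have [e e0 ovU] := nbhs_direction v oU.
have fo : f o = f' o by apply: (nbhs_singleton oU).
have e2 : `|e / 2| < e by rewrite gtr0_norm ?divr_gt0 //; lra.
have : d (f (o + (e / 2) *: v)) (f o) = d (f' (o + (e / 2) *: v)) (f' o).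
  by rewrite (ovU _ e2) fo.
rewrite fN f'N' [ o + _]addrC addrK !is_normZ //; apply: mulfI.
by rewrite normr_eq0 gt_eqF // divr_gt0.
Qed.

(* The enclosure of the germ of a segment in a direction of [Cf] has interior
   points; from there the agreement propagates by dominant and antidominant steps,
   because only preordered pairs are controlled by the axioms. *)
Lemma open_chart (A A' : set M) (f : V -> M) (U : set V) : chart A f -> apartments A' ->
  convex U -> U !=set0 -> (forall p, U p -> nbhs p U) ->
  (forall p, U p -> A' (f p)) ->
  exists2 f', chart A' f' & forall p, U p -> f p = f' p.
Proof.
move=> fA aA' cU [z0 Uz0] oU UA'.
have [v0 v0C] := @fund_chamber_nonempty R I C n S.
have tits_pos (v : V) (c : R) p : Cf v -> 0 < c -> preordered S p (p + c *: v).
  move=> vC c0; left; rewrite /tits_le addrC addKr; apply: fund_chamber_tits => i.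
  by rewrite evZr mulr_ge0 // ltW.
have [e e0 zU] := nbhs_direction v0 (oU _ Uz0).
have [| |k [f' [e' [e'0 f'A' kE f'E]]]] :=
    germ_chart hC hM (x := z0) (y := z0 + v0) fA aA' _ e0 _.
- by have := tits_pos v0 1 z0 v0C ltr01; rewrite scale1r.
- move=> t /andP[t0 te]; rewrite [z0 + v0]addrC addrK; apply/UA'/zU.
  by rewrite ger0_norm.
exists f' => // z Uz; rewrite [z0 + v0]addrC addrK in kE.
pose del := e' / 2; have del0 : 0 < del by rewrite divr_gt0.
(* The open order interval between two points of the germ. A half-apartment containing both ends
   contains it: a positive root is bounded below by its value at the lower end, a negative one by
   its value at the upper end. *)
pose O := [set z : V | Cf (z - z0) /\ Cf (z0 + del *: v0 - z)].
have OE p : O p -> f p = f' p.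
  move=> [pC1 pC2]; apply/esym/f'E => a Da.
  have := kE 0; rewrite lexx e'0 scale0r addr0 => /(_ erefl a Da).
  have := kE del; rewrite ltW //= ltr_pdivrMr // ltr_pMr ?ltr1n //.
  move=> /(_ erefl a Da); case: (k a) => //= m Hdel H0.
  have [a0|a0] := all_roots_sign Da.
    have := positive_root_gt0 a0 pC1; rewrite evBr; lra.
  have := positive_root_gt0 a0 pC2; rewrite evNl evBr; lra.
pose s := Num.min del e / 2.
have m0 : 0 < Num.min del e by rewrite lt_min del0.
have s0 : 0 < s by rewrite divr_gt0.
have sdel : s < del.
  by rewrite ltr_pdivrMr // (@le_lt_trans _ _ del) ?ge_min ?lexx // ltr_pMr ?ltr1n.
have se : s < e.
  by rewrite ltr_pdivrMr // (@le_lt_trans _ _ e) ?ge_min ?lexx ?orbT // ltr_pMr ?ltr1n.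
pose o := z0 + s *: v0.
have [r r0 [ orO orU zrU]] : exists2 r : R, 0 < r &
    [/\ forall p, `|p - o| < r -> f p = f' p, forall p, `|p - o| < r -> U p
      & forall p, `|p - z| < r -> U p].
  have oO : nbhs o O.
    have H1 : nbhs o [set z | forall i, 0 < ev (alpha R S i) z - ev (alpha R S i) z0].
      apply: nbhs_forall => i; under [X in nbhs _ X]eq_set do rewrite subr_gt0.
      by apply: nbhs_ev_gt; rewrite evDr evZr ltrDl mulr_gt0.
    have H2 : nbhs o [set z | forall i, 0 < ev (alpha R S i) (z0 + del *: v0) - ev (alpha R S i) z].
      apply: nbhs_forall => i; under [X in nbhs _ X]eq_set do rewrite subr_gt0.
      by apply: nbhs_ev_lt; rewrite !evDr !evZr ltrD2l ltr_pM2r.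
    apply: filterS2 H1 H2 => p p1 p2; split=> i; rewrite evBr; [exact: p1|exact: p2].
  have oUo : nbhs o U by apply/oU/zU; rewrite gtr0_norm.
  have /nbhs_cVP[r1 r10 H1] : nbhs o (O `&` U) by apply: filterI.
  have /nbhs_cVP[r2 r20 H2] := oU _ Uz.
  exists (Num.min r1 r2); first by rewrite lt_min r10.
  split=> p; rewrite lt_min => /andP[pr1 pr2].
  - by apply: OE; case: (H1 _ pr1).
  - by case: (H1 _ pr1).
  - exact: H2.
(* This writes [z - o] as the difference of the dominant vectors [c1] and [K *: v0]. *)
have [K K1 zC] := chamber_absorb (z - o) v0C.
have K0 : 0 < K by lra.
set c1 := z - o + K *: v0 in zC.
have [m mr] : exists m : nat, 2 * `|c1| / r < m.+1%:R.
  exists (Num.bound (2 * `|c1| / r)).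
  rewrite (lt_trans (archi_boundP _)) ?ltr_nat //.
  by rewrite divr_ge0 ?mulr_ge0 // ltW.
have {}mr : `|c1| / m.+1%:R < r / 2.
  by move: mr; rewrite !ltr_pdivrMr //; lra.
(* The segment from [o] to [z] is followed by balls of half the available radius. With [m.+1] steps
   the dominant part [w1] of each step is shorter than the other half, so the detour [B1] between
   two balls stays in [U]. *)
pose B (j : nat) := [set p : V | `|p - (o + (j%:R / m.+1%:R) *: (z - o))| < r / 2].
have oB j p : B j p -> nbhs p (B j).
  rewrite /B /= -subr_gt0 => pB; apply/nbhs_cVP; eexists; first exact: pB.
  move=> y yp; set c := o + _ in yp *.
  have : `|y - c| <= `|y - p| + `|p - c|.
    by apply: le_trans (ler_normD _ _); rewrite addrA subrK.
  by move: yp; rewrite ltrBrDr => yp /le_lt_trans; apply.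
have BU j p w : (j <= m.+1)%N -> B j p -> `|w| < r / 2 -> U (p + w).
  move=> jm pB wr; apply: (convex_ball cU orU zrU (t := j%:R / m.+1%:R)).
    by rewrite divr_ge0 //= ler_pdivrMr // mul1r ler_nat.
  rewrite addrAC; apply: le_lt_trans (ler_normD _ _) _.
  by rewrite [ltRHS](splitr r); apply: ltrD.
have agreeB j p : (j <= m.+1)%N -> B j p -> f p = f' p.
  elim: j p => [|j IH] p jm pB.
    apply: orO; move: pB; rewrite /B /= mul0r scale0r addr0; lra.
  pose w1 := m.+1%:R^-1 *: c1; pose w2 := - ((m.+1%:R^-1 * K) *: v0).
  have w1r : `|w1| < r / 2 by rewrite normrZ ger0_norm ?invr_ge0 // mulrC.
  have m1 : 0 < m.+1%:R^-1 :> R by rewrite invr_gt0.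
  pose B1 := [set q | exists2 q', B j q' & q = q' + w1].
  have agree1 q : B1 q -> f q = f' q.
    move=> [q' q'B ->]; apply: (charts_agree_translate fA f'A' (oB j)) => //.
    - by move=> x xB; apply: IH => //; apply: ltnW.
    - by move=> x xB; apply/UA'/(BU j) => //; apply: ltnW.
    - by move=> x; apply: tits_pos.
  have pE : p = (p - (w1 + w2)) + w1 + w2 by rewrite -addrA subrK.
  have pB1 : B j (p - (w1 + w2)).
    move: pB; rewrite /B /=; congr (`|_| < _).
    rewrite /w1 /w2 /c1; apply/colP => i; rewrite !mxE.
    by rewrite -[j.+1%:R]natr1; field; rewrite nat1r pnatr_eq0.
  rewrite pE; apply: (charts_agree_translate fA f'A' (B := B1)) => //.
  - move=> _ [q' q'B ->]; have /nbhs_cVP[e1 e10 eB] := oB _ _ q'B.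
    apply/nbhs_cVP; exists e1 => // y ye; exists (y - w1); last by rewrite subrK.
    by apply: eB; rewrite addrAC -addrA -opprD.
  - move=> _ [q' q'B ->]; apply: UA'.
    have q'B1 : B j.+1 (q' + w1 + w2).
      move: q'B; rewrite /B /=; congr (`|_| < _).
      rewrite /w1 /w2 /c1; apply/colP => i; rewrite !mxE.
      by rewrite -[j.+1%:R]natr1; field; rewrite nat1r pnatr_eq0.
    by rewrite -[_ + w2]addr0; apply: (BU j.+1) => //; rewrite normr0 divr_gt0.
  - move=> x; right; rewrite /tits_le opprD addNKr opprK.
    by apply: fund_chamber_tits => i; rewrite evZr !mulr_ge0 // ltW.
  - by exists (p - (w1 + w2)).
apply: (agreeB m.+1) => //; rewrite /B /= divff ?pnatr_eq0 // scale1r.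
by rewrite [ o + _]addrC subrK subrr normr0 divr_gt0.
Qed.

End OpenCharts.

(** * The panel of a simple wall at the origin *)

Section SimplePanel.
Context (R : realType) (I : finType) (C : I -> I -> int) (n : nat).
Context (hC : kac_moody_matrix C) (S : root_datum C n).
Context (g : kac_moody_algebra R[i] C).
Local Notation V := 'cV[R]_n.
Local Notation alpha := (@alpha R I C n S).
Local Notation Delta := (@all_roots R I C n S g).
Local Notation Cf := (@fund_chamber R I C n S).

Definition simple_face (i : I) : set V := positive_vface S 1%:M [set i]%SET.

Lemma simple_faceP i v : simple_face i v <->
  ev (alpha i) v = 0 /\ forall j, j != i -> 0 < ev (alpha j) v.
Proof.
split=> [[x xJ <-]|[vi vj]].
  rewrite mul1mx; split=> [|j ji].
    by have := xJ i; rewrite inE eqxx.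
  by have := xJ j; rewrite inE (negPf ji).
exists v; last by rewrite mul1mx.
by move=> j; rewrite inE; case: eqVneq => [->|/vj].
Qed.

Lemma simple_face_vface i : is_vface S (simple_face i).
Proof. by exists 1%:M, [set i]%SET; split; [constructor|left]. Qed.

Lemma fund_chamber_vface : is_vface S Cf.
Proof.
exists 1%:M, finset.set0; split; [by constructor|left].
apply/seteqP; split=> [v vC|_ [v vJ <-] j].
  by exists v; [move=> j; rewrite inE; apply: vC|rewrite mul1mx].
by rewrite mul1mx; have := vJ j; rewrite inE.
Qed.

Lemma face_germ (y : V) Fv E : face S g y Fv E ->
  nbhs y [set z | (exists2 v, Fv v & z = y + v) -> E z].
Proof.
move=> [k [k' [Om [yOm PE OmP]]]]; apply: filterS yOm => z zOm [v vFv zE].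
by apply/PE/OmP; split=> //; exists v.
Qed.

Lemma face_germ_direction (y v : V) Fv E : is_vface S Fv -> face S g y Fv E ->
  Fv v -> exists2 e : R, 0 < e & forall t, 0 < t < e -> E (y + t *: v).
Proof.
move=> vF /face_germ/(nbhs_direction v)[e e0 yE] Fvv; exists e => // t /andP[t0 te].
by apply: (yE t); [rewrite gtr0_norm|exists (t *: v) => //; apply: (vfaceZ vF)].
Qed.

Lemma face_open_half (y : V) Fv a m : Delta a ->
  nbhs y [set z | (exists2 v, Fv v & z = y + v) -> open_half a (Some m) z] ->
  face S g y Fv (open_half a (Some m)).
Proof.
move=> Da yU; exists (fun=> None), (fun a' => if a' == a then Some m else None).
eexists; split; first exact: yU.
  by move=> x /(_ a Da)[_]; rewrite eqxx.
move=> x [xU [v vFv xE]] a' _; split=> //; case: eqP => // ->.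
by apply: xU; exists v.
Qed.

Lemma root_neq0 a : Delta a -> exists x : V, ev a x != 0.
Proof.
have [v vC] := @fund_chamber_nonempty R I C n S.
move=> /all_roots_sign[]/positive_root_gt0/(_ vC) av; exists v.
  by rewrite gt_eqF.
by rewrite lt_eqF // -oppr_gt0 -evNl.
Qed.

Lemma root_neqN a : Delta a -> - a != a.
Proof.
move=> /root_neq0[x ax]; apply: contra ax => /eqP aN.
have := evNl a x; rewrite aN => axN; clear aN; apply/eqP; lra.
Qed.

Lemma face_hyperplane (y : V) Fv a m : Delta a ->
  (forall v, Fv v -> ev a (y + v) + m%:~R = 0) ->
  face S g y Fv (hyperplane a m).
Proof.
move=> Da yE.
exists (fun a' => if a' == a then Some m else if a' == - a then Some (- m) else None).
exists (fun=> None), setT; split; first exact: filterT.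
  move=> x Px; have [] := Px a Da; rewrite eqxx /= => xa _.
  have [] := Px (- a) (all_rootsN Da); rewrite eqxx (negPf (root_neqN Da)) /=.
  by rewrite evNl rmorphN /hyperplane /= => h1 _; lra.
move=> x [_ [v vFv <-]] a' _; split=> //.
case: eqP => [->|_]; first by rewrite /= yE.
by case: eqP => [->|_] //=; rewrite evNl rmorphN -opprD yE // oppr0.
Qed.

Lemma simple_face_perturb i v (x : V) : simple_face i v -> ev (alpha i) x = 0 ->
  exists2 s : R, 0 < s & simple_face i (v + s *: x).
Proof.
move=> /simple_faceP[vi vj] xi.
have : nbhs v [set z | forall j, j != i -> 0 < ev (alpha j) z].
  apply: nbhs_forall => j; have [->|ji] := eqVneq j i; first exact: filterE.
  by apply: filterS (nbhs_ev_gt (vj j ji)) => z + _.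
move=> /(nbhs_direction x)[r r0 vr]; exists (r / 2); first by rewrite divr_gt0.
apply/simple_faceP; split; first by rewrite evDr evZr vi xi mulr0 addr0.
by apply: vr; rewrite gtr0_norm ?divr_gt0 //; lra.
Qed.

Lemma panel_support i : has_support (face S g 0 (simple_face i)) (hyperplane (alpha i) 0).
Proof.
split.
- split; first by exists 0; rewrite /hyperplane /= ev0r addr0.
  move=> x y t; rewrite /hyperplane /= !addr0 => xi yi.
  by rewrite evDr !evZr xi yi !mulr0 addr0.
- apply: face_hyperplane; first exact: all_roots_alpha.
  by move=> v /simple_faceP[vi _]; rewrite add0r vi addr0.
- move=> E' [_ affE'] FE' x; rewrite /hyperplane /= addr0 => xi.
  have [v vF] := vface_nonempty (simple_face_vface i).
  have /nbhs_cVP[e e0 E'e] := face_germ FE'.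
  have line a b t : E' a -> E' b -> E' (a + t *: (b - a)).
    by move=> Ea Eb; have := affE' a b t Ea Eb; congr E'; apply/colP => j; rewrite !mxE; ring.
  have [s s0 vsF] := simple_face_perturb vF xi.
  have small u : simple_face i u -> exists2 t : R, 0 < t & forall r, 0 < r <= t -> E' (r *: u).
    move=> uF; have [r r0 ur] := face_germ_direction (simple_face_vface i) FE' uF.
    exists (r / 2); first by rewrite divr_gt0.
    by move=> r' /andP[r'0 r'r]; have := ur r'; rewrite add0r; apply; lra.
  have [t1 t10 E1] := small _ vF; have [t2 t20 E2] := small _ vsF.
  pose t := Num.min t1 t2; have t0 : 0 < t by rewrite lt_min t10.
  have tt1 : t <= t1 by rewrite ge_min lexx.
  have tt2 : t <= t2 by rewrite ge_min lexx orbT.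
  have Ev : E' (t *: v) by apply: E1; rewrite t0.
  have Ev2 : E' ((t / 2) *: v) by apply: E1; lra.
  have Ew : E' (t *: (v + s *: x)) by apply: E2; rewrite t0.
  (* Only points near 0 in the open simple face are known to lie in [E']. Affine combinations of
     [t v] and [t v / 2] reach 0, and then those of [- t v] and [t (v + s x)] reach multiples of
     [x]. *)
  have E0 : E' 0.
    by have := line _ _ 2 Ev Ev2; congr E'; apply/colP => j; rewrite !mxE; field.
  have EX : E' ((t * s) *: x).
    have Em := line _ _ 2^-1 (line _ _ (-1) E0 Ev) Ew.
    by have := line _ _ 2 E0 Em; congr E'; apply/colP => j; rewrite !mxE; field.
  have := line _ _ (t * s)^-1 E0 EX; congr E'.
  by apply/colP => j; rewrite !mxE; field; rewrite !gt_eqF.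
Qed.

Lemma simple_panel i : is_panel S g (face S g 0 (simple_face i)).
Proof.
split; first by exists 0, (simple_face i); split=> //; apply: simple_face_vface.
exists (hyperplane (alpha i) 0); last exact: panel_support.
exists (alpha i), 0; split=> //; exists (alphav R S i), 1%:M, i.
split; [by constructor|by rewrite invmx1 mulmx1|by rewrite mul1mx].
Qed.

(** If the base point is on the hyperplane, the sign of [a] on the vectorial face decides; that sign
    cannot be zero, or the hyperplane would contain the support of the chamber. *)
Lemma chamber_side F a m : is_chamber S g F -> Delta a ->
  F (open_half a (Some m)) \/ F (open_half (- a) (Some (- m))).
Proof.
move=> [[y [Fv [vF ->]]] [_ _ Fmin]] Da.
have Na : Delta (- a) by apply: all_rootsN.
have [ay|ay|ay] := ltrgtP 0 (ev a y + m%:~R).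
- left; apply: face_open_half => //.
  have : nbhs y [set z | - m%:~R < ev a z] by apply: nbhs_ev_gt; lra.
  by apply: filterS => z /= az _; lra.
- right; apply: face_open_half => //.
  have : nbhs y [set z | ev a z < - m%:~R] by apply: nbhs_ev_lt; lra.
  by apply: filterS => z /= az _; rewrite evNl rmorphN /=; lra.
- have [av|av|av] := vface_root_sign hC vF Da.
  + left; apply: face_open_half => //; apply: filterE => z [v /av vF' ->] /=.
    by rewrite evDr; lra.
  + right; apply: face_open_half => //; apply: filterE => z [v /av vF' ->] /=.
    by rewrite evNl evDr rmorphN /=; lra.
  + have FH : face S g y Fv (hyperplane a m).
      by apply: face_hyperplane => // v /av vF'; rewrite evDr; lra.
    have [x ax] := root_neq0 Da.
    have HT : [set: V] `<=` hyperplane a m.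
      apply: Fmin FH; split; first by exists y; rewrite /hyperplane /=; lra.
      move=> p q t; rewrite /hyperplane /= evDr !evZr => ap aq.
      have -> : ev a p = - m%:~R by lra.
      have -> : ev a q = - m%:~R by lra.
      by ring.
    have := HT 0 Logic.I; have := HT x Logic.I; rewrite /hyperplane /= ev0r => h1 h2.
    by case/eqP: ax; lra.
Qed.

Lemma half_closure_ge0 (a : 'rV[R]_n) (k : int) (v : V) (E : set V) :
  E `<=` half a (Some k) ->
  (exists2 e : R, 0 < e & forall t, 0 < t < e -> closure E (t *: v)) ->
  0 <= k /\ (k <= 0 -> 0 <= ev a v).
Proof.
move=> EH [e e0 clE].
have H t : 0 < t < e -> 0 <= t * ev a v + k%:~R.
  move=> /clE cl; rewrite leNgt; apply/negP => neg.
  have /cl[y [/EH /= H1 H2]] : nbhs (t *: v) [set y | ev a y < - k%:~R].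
    by apply: nbhs_ev_lt; rewrite evZr; lra.
  by rewrite /= in H2; lra.
split.
  (* As [k] is an integer, [k > -1] suffices; [t] is taken so small that [t * ev a v < 1]. *)
  rewrite -ltzD1 -(ltr_int R) rmorphD /= mulr1z.
  pose t := Num.min (e / 2) (1 + `|ev a v|)^-1 / 2.
  have v0 : 0 < 1 + `|ev a v| by rewrite ltr_pwDl.
  have m0 : 0 < Num.min (e / 2) (1 + `|ev a v|)^-1.
    by rewrite lt_min divr_gt0 // invr_gt0.
  have t0 : 0 < t by rewrite divr_gt0.
  have te : t < e.
    rewrite ltr_pdivrMr // (@le_lt_trans _ _ (e / 2)) ?ge_min ?lexx //; lra.
  have t1 : t < (1 + `|ev a v|)^-1.
    rewrite ltr_pdivrMr // (@le_lt_trans _ _ (1 + `|ev a v|)^-1) ?ge_min ?lexx ?orbT //.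
    by rewrite ltr_pMr ?invr_gt0 // ltr1n.
  have := H t; rewrite t0 te => /(_ erefl).
  move: t1; rewrite -[X in _ < X]mul1r ltr_pdivlMr // => t1.
  have := ler_norm (ev a v) => nv.
  have : t * ev a v <= t * `|ev a v| by rewrite ler_pM2l.
  by lra.
rewrite -(ler_int R) => k0.
have H1 : 0 <= e / 2 * ev a v + k%:~R by apply: H; apply/andP; split; lra.
have : 0 <= e / 2 * ev a v by lra.
by rewrite pmulr_rge0 // divr_gt0.
Qed.

End SimplePanel.

(** * Uniqueness of the chamber on a given side of the panel *)

Section UniqueChamber.
Context (R : realType) (I : finType) (C : I -> I -> int) (n : nat).
Context (hC : kac_moody_matrix C) (S : root_datum C n).
Context (g : kac_moody_algebra R[i] C).
Local Notation V := 'cV[R]_n.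
Local Notation alpha := (@alpha R I C n S).
Local Notation Delta := (@all_roots R I C n S g).
Local Notation Cf := (@fund_chamber R I C n S).

(** The values below 1 are finite in number, although the roots need not be: a coefficient [b i] is
    bounded when [ev (alpha i) y > 0] and has no effect when it is 0. *)
Lemma positive_root_values_gap (y : V) : (forall i, 0 <= ev (alpha i) y) ->
  exists2 eta : R, 0 < eta <= 1 &
    forall a, positive_root S a -> ev a y < 1 -> ev a y <= 1 - eta.
Proof.
move=> y0.
pose B := (\sum_i Num.bound (ev (alpha i) y)^-1)%N.
pose val (c : {ffun I -> 'I_B.+1}) : R := \sum_i (c i)%:R * ev (alpha i) y.
exists (\big[Num.min/1]_(c | val c < 1) (1 - val c)).
  apply/andP; split; last exact: bigmin_le_id.
  by apply: lt_bigmin => // c; rewrite subr_gt0.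
move=> a [b [-> b0 _]]; rewrite /root_comb ev_suml => by1.
pose c := [ffun i => inord (if ev (alpha i) y == 0 then 0%N else `|b i|%N)] : {ffun I -> 'I_B.+1}.
have valE : \sum_i (b i)%:~R * ev (alpha i) y = val c.
  apply: eq_bigr => i _; rewrite ffunE; case: eqP => [->|/eqP yi]; first by rewrite !mulr0.
  have yi0 : 0 < ev (alpha i) y by rewrite lt_neqAle eq_sym yi y0.
  have bE : (`|b i|%N%:R : R) = (b i)%:~R.
    by rewrite -[in RHS](gez0_abs (b0 i)).
  suff bB : (`|b i| <= B)%N by rewrite inordK ?bE.
  have bi1 : `|b i|%N%:R <= (ev (alpha i) y)^-1 :> R.
    rewrite -[X in _ <= X]mul1r ler_pdivlMr // (le_trans _ (ltW by1)) //.
    rewrite (bigD1 i) //= bE lerDl sumr_ge0 // => j _.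
    by rewrite mulr_ge0 // ler0z.
  apply: (@leq_trans (Num.bound (ev (alpha i) y)^-1)).
    apply: ltnW; rewrite -(ltr_nat R); apply: le_lt_trans bi1 _.
    by apply: archi_boundP; rewrite invr_ge0.
  by rewrite /B (bigD1 i) //= leq_addr.
rewrite valE in by1 *; rewrite lerBrDr -lerBrDl; exact: bigmin_le_cond.
Qed.

(* All hyperplanes [a = 0] pass through the panel, so [F] is on the positive side
   of each of them and on the lower side of [a = 1]: its base point [y] is dominant
   and [a y <= 1] for every positive root [a]. As there may be infinitely many
   roots, the two inclusions have to be uniform in [a]; one compares with a point
   of [Cf] in the given set, using the gap below 1 of the values [a y]. *)
Lemma unique_chamber i F : is_chamber S g F ->
  (forall E, F E -> nbhs (0 : V) [set x | simple_face S i x -> closure E x]) ->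
  F (open_half (alpha i) (Some 0)) -> F = face S g 0 Cf.
Proof.
move=> chF clF Fi.
have [[y [Fv [vF FE0]]] _] := chF.
have {FE0} FE E : F E = face S g y Fv E by rewrite FE0.
have [v1 v1F] := vface_nonempty vF.
have [u uF] := vface_nonempty (simple_face_vface R S i).
have Fi_dir E : F E -> exists2 e : R, 0 < e & forall t, 0 < t < e -> closure E (t *: u).
  move=> /clF/(nbhs_direction u)[e e0 H]; exists e => // t /andP[t0 te].
  have := H t; rewrite add0r gtr0_norm //; apply=> //.
  exact: (vfaceZ (simple_face_vface R S i)).
have half_ge0 (a : 'rV[R]_n) (k : int) : F (half a (Some k)) -> 0 <= k.
  by move=> /Fi_dir H; case: (half_closure_ge0 (@subset_refl _ _) H).
have open_sub (a : 'rV[R]_n) (k : int) : open_half a (Some k) `<=` half a (Some k).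
  by move=> x /= /ltW.
have F_sub E E' : F E -> E `<=` E' -> F E'.
  by rewrite !FE; apply: face_superset.
have F_germ E : F E -> nbhs y [set z | (exists2 v, Fv v & z = y + v) -> E z].
  by rewrite FE; apply: face_germ.
(* For [j != i] the negative side is excluded: the closure of each set of [F] contains small
   multiples of [u], on which [alpha j] is positive. *)
have Falpha j : F (open_half (alpha j) (Some 0)).
  have [->//|ji] := eqVneq j i.
  have [//|H] := chamber_side hC 0 chF (all_roots_alpha hC S g j).
  have [_] := half_closure_ge0 (@open_sub _ _) (Fi_dir _ H).
  rewrite oppr0 lexx evNl => /(_ isT).
  by have [_ /(_ j ji)] := (simple_faceP S i u).1 uF; lra.
have yC : nbhs y [set z | (exists2 v, Fv v & z = y + v) -> Cf z].
  have := nbhs_forall (fun j => F_germ _ (Falpha j)).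
  apply: filterS => z zE vz j; have := zE j vz; rewrite /= addr0; exact.
have y0 j : 0 <= ev (alpha j) y.
  rewrite leNgt; apply/negP => yj.
  have [e e0 H] := nbhs_direction v1 (filterI yC (nbhs_ev_lt yj)).
  have e2 : `|e / 2| < e by rewrite gtr0_norm ?divr_gt0 //; lra.
  have v1F' : Fv ((e / 2) *: v1) by apply: (vfaceZ vF) => //; rewrite divr_gt0.
  have [/(_ (ex_intro2 _ _ _ v1F' erefl) j) h1 /= h2] := H _ e2.
  by lra.
have [v0 v0C] := @fund_chamber_nonempty R I C n S.
apply/seteqP; split=> E.
- rewrite FE => -[k [k' [Om [yOm PE OmP]]]].
  have FP : F (\bigcap_(a in Delta) (half a (k a) `&` open_half a (k' a))).
    by rewrite FE; exists k, k', Om; split.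
  have [e e0 H] := nbhs_direction v1 (filterI yC yOm).
  have e2 : `|e / 2| < e by rewrite gtr0_norm ?divr_gt0 //; lra.
  have v1F' : Fv ((e / 2) *: v1) by apply: (vfaceZ vF) => //; rewrite divr_gt0.
  have [z0C z0Om] := H _ e2; have {}z0C := z0C (ex_intro2 _ _ _ v1F' erefl).
  set z0 := y + (e / 2) *: v1 in z0C z0Om.
  have Pz0 : (\bigcap_(a in Delta) (half a (k a) `&` open_half a (k' a))) z0.
    by apply: OmP; split=> //; exists ((e / 2) *: v1).
  (* A dominant [z] below [z0] satisfies all the conditions: those of positive roots because their
     levels are nonnegative, those of negative roots by comparison with [z0]. *)
  exists k, k', [set z | forall j, ev (alpha j) z < ev (alpha j) z0]; split=> //.
    by apply: nbhs_forall => j; apply: nbhs_ev_lt; rewrite ev0r.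
  move=> x [zz0 [z zC zx]]; move: zz0; rewrite -zx add0r => zz0 a Da.
  have [Pa1 Pa2] := Pz0 a Da.
  have Fk m : k a = Some m -> F (half a (Some m)).
    by move=> km; apply: F_sub FP _ => p /(_ a Da)[]; rewrite km.
  have Fk' m : k' a = Some m -> F (half a (Some m)).
    by move=> km; apply: F_sub FP _ => p /(_ a Da)[_]; rewrite km => /open_sub.
  have [a0|a0] := all_roots_sign Da.
    have az : 0 < ev a z by apply: positive_root_gt0 a0 zC.
    split.
      case: (k a) Fk => //= m /(_ m erefl)/half_ge0 m0.
      by rewrite addr_ge0 ?ler0z // ltW.
    case: (k' a) Fk' => //= m /(_ m erefl)/half_ge0 m0.
    by rewrite ltr_pwDl ?ler0z.
  have : ev (- a) z <= ev (- a) z0.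
    by apply: (positive_root_le a0) => j; apply: ltW.
  rewrite !evNl => azz0; split.
    by case: (k a) Pa1 => //= m; lra.
  by case: (k' a) Pa2 => //= m; lra.
- move=> [k [k' [Om [zOm PE OmP]]]]; rewrite FE.
  have CfZ t : 0 < t -> Cf (t *: v0) by move=> t0 j; rewrite evZr mulr_gt0.
  have [e e0 H] := nbhs_direction v0 zOm.
  have P_dir t : 0 < t < e ->
      (\bigcap_(a in Delta) (half a (k a) `&` open_half a (k' a))) (t *: v0).
    move=> /andP[t0 te]; apply: OmP; split.
      by have := H t; rewrite add0r gtr0_norm //; apply.
    by exists (t *: v0); [apply: CfZ|rewrite add0r].
  have e2 : 0 < e / 2 < e by apply/andP; split; lra.
  set z1 := (e / 2) *: v0.
  have Pz1 := P_dir _ e2; rewrite -/z1 in Pz1.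
  have z1C : Cf z1 by apply: CfZ; lra.
  (* The far side of [a = 1] would put [half a (Some (-1))] in [F], against [half_ge0]. If [y] is on
     that hyperplane, then [a] must decrease along [Fv]. *)
  have root_le1 a : Delta a -> positive_root S a ->
      ev a y <= 1 /\ (ev a y = 1 -> forall v, Fv v -> ev a v < 0).
    move=> Da a0; have Na := all_rootsN Da.
    have [/(F_sub _ _)/(_ (@open_sub _ _))/half_ge0//|Hm] := chamber_side hC (-1) chF Da.
    rewrite opprK FE in Hm.
    have H1 v : Fv v -> exists2 r : R, 0 < r & forall t, 0 < t < r -> ev a (y + t *: v) < 1.
      move=> vFv; have [r r0 rH] := face_germ_direction vF Hm vFv.
      by exists r => // t /rH /=; rewrite evNl; lra.
    have ay1 : ev a y <= 1.
      rewrite leNgt; apply/negP => ay.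
      have [r r0 rH] := H1 _ v1F.
      have [r' r'0 r'H] := nbhs_direction v1 (nbhs_ev_gt ay).
      pose t := Num.min r r' / 2.
      have m0 : 0 < Num.min r r' by rewrite lt_min r0.
      have tr : t < r by rewrite ltr_pdivrMr // (@le_lt_trans _ _ r) ?ge_min ?lexx //; lra.
      have tr' : t < r'.
        by rewrite ltr_pdivrMr // (@le_lt_trans _ _ r') ?ge_min ?lexx ?orbT //; lra.
      have t0 : 0 < t by rewrite divr_gt0.
      have := rH t; rewrite t0 tr => /(_ isT).
      have := r'H t; rewrite gtr0_norm // => /(_ tr') /=; lra.
    split=> // ay v vFv; have [r r0 rH] := H1 _ vFv.
    have : ev a (y + (r / 2) *: v) < 1 by apply: rH; apply/andP; split; lra.
    rewrite evDr evZr ay => rv; have : r / 2 * ev a v < 0 by lra.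
    by rewrite pmulr_rlt0 // divr_gt0.
  have [eta /andP[eta0 eta1] gap] := positive_root_values_gap y0.
  exists k, k', ([set z | forall j, ev (alpha j) (z - y) <= eta * ev (alpha j) z1] `&`
     [set z | (exists2 v, Fv v & z = y + v) -> Cf z]).
  split=> //.
    apply: filterI yC; apply: nbhs_forall => j.
    have : nbhs y [set z | ev (alpha j) z < ev (alpha j) y + eta * ev (alpha j) z1].
      by apply: nbhs_ev_lt; rewrite ltrDl mulr_gt0.
    by apply: filterS => z /=; rewrite evBr; lra.
  move=> z [[zy zC] [v vFv zE]] a Da.
  have {}zC : Cf z by apply: zC; exists v.
  have [Pa1 Pa2] := Pz1 a Da.
  have [a0|a0] := all_roots_sign Da.
    have az : 0 < ev a z by apply: positive_root_gt0 a0 zC.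
    have k_ge0 m : (forall t, 0 < t < e -> 0 <= ev a (t *: v0) + m%:~R) -> 0 <= m.
      move=> tm.
      suff H2 : exists2 e : R, 0 < e &
          forall t, 0 < t < e -> closure (half a (Some m)) (t *: v0).
        by case: (half_closure_ge0 (@subset_refl _ _) H2).
      by exists e => // t /tm te; apply: subset_closure.
    split.
      case ka : (k a) => [m|] //=.
      have : 0 <= m.
        by apply: k_ge0 => t te; have [+ _] := P_dir t te a Da; rewrite ka.
      by rewrite -(ler0z R); lra.
    case ka : (k' a) => [m|] //=.
    have : 0 <= m.
      by apply: k_ge0 => t te; apply: ltW; have [_ +] := P_dir t te a Da; rewrite ka.
    by rewrite -(ler0z R); lra.
  have Na := all_rootsN Da.
  have [ay1 ay1v] := root_le1 _ Na a0.
  have az1 : 0 < ev (- a) z1 by apply: positive_root_gt0 a0 z1C.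
  have azy : ev (- a) (z - y) <= ev (- a) (eta *: z1).
    by apply: (positive_root_le a0) => j; rewrite evZr.
  (* A negative root [a] at level [m] requires [ev (- a) z <= m], where [m >= 1] and
     [ev (- a) z1 <= m]. The bound is below 1 or the convex combination with weights [1 - eta] and
     [eta] of 1 and [ev (- a) z1], so it is at most [m]. *)
  have key (m : int) : 0 < m%:~R :> R ->
      ev (- a) z < 1 \/ ev (- a) z <= (1 - eta) + eta * ev (- a) z1.
    move=> m0; have [ay|ay] := ltP (ev (- a) y) 1.
      right; have := gap _ a0 ay; move: azy; rewrite evBr evZr; lra.
    left; have ayE : ev (- a) y = 1 by lra.
    by have := ay1v ayE _ vFv; rewrite -zE evDr; lra.
  have int1 (m : int) : 0 < m%:~R :> R -> 1 <= m%:~R :> R.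
    by rewrite ltr0z ler1z gtz0_ge1.
  rewrite !evNl in az1 key *; split.
    case: (k a) Pa1 => //= m Pm.
    have m0 : 0 < m%:~R :> R by lra.
    have m1 := int1 _ m0.
    have [?|H1] := key _ m0; first by lra.
    have : eta * - ev a z1 <= eta * m%:~R by apply: ler_wpM2l; lra.
    have : (1 - eta) * 1 <= (1 - eta) * m%:~R by apply: ler_wpM2l; lra.
    lra.
  case: (k' a) Pa2 => //= m Pm.
  have m0 : 0 < m%:~R :> R by lra.
  have m1 := int1 _ m0.
  have [?|H1] := key _ m0; first by lra.
  have : eta * - ev a z1 < eta * m%:~R by rewrite ltr_pM2l //; lra.
  have : (1 - eta) * 1 <= (1 - eta) * m%:~R by apply: ler_wpM2l; lra.
  lra.
Qed.

End UniqueChamber.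

(** * Retractions centred at sector germs *)

Section ThirdChamber.
Context (R : realType) (I : finType) (C : I -> I -> int) (n : nat).
Context (hC : kac_moody_matrix C) (S : root_datum C n).
Context (g : kac_moody_algebra R[i] C).
Context (M : apartment_system R n) (hM : is_masure S g M).
Context (d : M -> M -> R) (hd : is_distance d).
Context (hnorm : forall A : set M, apartments A -> induced_by_norm d A).
Local Notation V := 'cV[R]_n.
Local Notation Cf := (@fund_chamber R I C n S).

Lemma convex_half (a : 'rV[R]_n) k : convex (half a k).
Proof.
case: k => // k x y t /= ax ay /andP[t0 t1]; rewrite evDr evZr evBr.
have := mulr_ge0 t0 ay; have t1' : 0 <= 1 - t by lra.
by have := mulr_ge0 t1' ax; lra.
Qed.

Lemma convex_open_half (a : 'rV[R]_n) k : convex (open_half a k).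
Proof.
case: k => // k x y t /= ax ay /andP[t0 t1]; rewrite evDr evZr evBr.
have [->|t_neq0] := eqVneq t 0; first by rewrite mul0r addr0.
have {}t0 : 0 < t by rewrite lt_neqAle eq_sym t_neq0.
have := mulr_gt0 t0 ay; have t1' : 0 <= 1 - t by lra.
by have := mulr_ge0 t1' (ltW ax); lra.
Qed.

Lemma convex_bigcap (D : set 'rV[R]_n) (E : 'rV[R]_n -> set V) :
  (forall a, convex (E a)) -> convex (\bigcap_(a in D) E a).
Proof. by move=> cE x y t Ex Ey t01 a Da; apply: cE; [apply: Ex|apply: Ey|]. Qed.

Lemma convexI (E E' : set V) : convex E -> convex E' -> convex (E `&` E').
Proof. by move=> cE cE' x y t [? ?] [? ?] t01; split; [apply: cE|apply: cE']. Qed.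

Lemma sector_germ (x : V) (X : set V) :
  chimney_germ S g (face S g x Cf) Cf X -> exists z, forall c, Cf c -> X (z + c).
Proof.
move=> [u _ [k [[E0 [E1 FE1 E10] E0P] PX]]].
have [v vC] := @fund_chamber_nonempty R I C n S.
have [e e0 xE] := face_germ_direction (fund_chamber_vface R S) FE1 vC.
exists (x + (e / 2) *: v + u) => c cC; apply/PX/E0P.
exists (x + (e / 2) *: v + u); last by exists c.
apply: E10; exists (x + (e / 2) *: v); last by exists u.
by apply: xE; apply/andP; split; lra.
Qed.

Lemma fund_chamber_spherical : spherical S Cf.
Proof.
have [v vC] := @fund_chamber_nonempty R I C n S.
exists v; split=> //; left.
apply: (@filterS _ _ _ Cf); last exact: nbhs_fund_chamber.
by move=> x xC; apply: fund_chamber_tits => i; apply: ltW.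
Qed.

Lemma face_nonempty (x : V) (Fv : set V) E : is_vface S Fv -> face S g x Fv E -> E !=set0.
Proof.
move=> vF FE; have [v vFv] := vface_nonempty vF.
have [e e0 H] := face_germ_direction vF FE vFv.
by exists (x + (e / 2) *: v); apply: H; apply/andP; split; lra.
Qed.

(** (MA3) gives an apartment [A1] containing the chamber and a subsector of [iota]. A chart [h] of
    [A1] agreeing with [iota] on the subsector agrees on the panel, which is in the closure of the
    chamber, and then on all of [Cf], between the two. *)
Lemma sector_retraction (A0 : set M) (iota : V -> M) (A : set M) (f : V -> M) F i : chart A0 iota -> chart A f ->
  is_chamber S g F ->
  (forall E, F E -> face S g 0 (simple_face S i) (iota @^-1` (f @` closure E))) ->
  exists A1 h u, [/\ chart A1 h, affine_weyl S u, F [set x | f x = h (u x)],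
    (exists o : V, nbhs o [set x | f x = h (u x)]) & forall x, Cf x -> iota x = h x].
Proof.
move=> iA0 fA [[y [Fv [vF FE0]]] [_ _ Fmin]] clF.
have {FE0} FE E : F E = face S g y Fv E by rewrite FE0.
have [v0 v0C] := @fund_chamber_nonempty R I C n S.
pose Rg : set_system M := iota @ chimney_germ S g (face S g 0 Cf) Cf.
pose Fc : set_system M := f @ face S g y Fv.
have pair : MA3_pair S g Rg Fc.
  split.
    exists A0; first by case: iA0.
    exists iota, (chimney_germ S g (face S g 0 Cf) Cf); split=> //.
      by case: iA0.
    exists (face S g 0 Cf), Cf; split=> //.
    - by exists 0, Cf; split=> //; apply: fund_chamber_vface.
    - exact: fund_chamber_vface.
    - exact: fund_chamber_spherical.
  left; exists A; first by case: fA.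
  exists f, (face S g y Fv); split=> //; first by case: fA.
  by exists y, Fv.
have [A1 aA1 [/sector_germ[x' sector] FA1]] := MA3 hM pair.
pose U : set V := [set z | Cf (z - x')].
have UA1 z : U z -> A1 (iota z).
  by move=> /sector; rewrite addrC subrK.
have oU z : U z -> nbhs z U.
  move=> zU; apply: nbhs_forall => j.
  have : nbhs z [set z | ev (alpha R S j) x' < ev (alpha R S j) z].
    by apply: nbhs_ev_gt; have := zU j; rewrite evBr subr_gt0.
  by apply: filterS => z1 /=; rewrite evBr subr_gt0.
have cU : convex U.
  move=> z z' t zU z'U /andP[t0 t1] j; have := zU j; have := z'U j.
  rewrite !evBr evDr evZr evBr => h1 h2.
  have [->|t_neq0] := eqVneq t 0; first by rewrite mul0r addr0.
  have {}t0 : 0 < t by rewrite lt_neqAle eq_sym t_neq0.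
  have := mulr_gt0 t0 h1; have t1' : 0 <= 1 - t by lra.
  by have := mulr_ge0 t1' (ltW h2); lra.
have U0 : U !=set0.
  by exists (x' + v0); rewrite /U /= addrC addKr; apply: v0C.
have [h hA1 hU] := open_chart hC hM hnorm iA0 aA1 cU U0 oU UA1.
have [k [k' [Om [yOm PA1 OmP]]]] := FA1.
set P := \bigcap_(_ in _) _ in PA1 OmP.
have FP : F P by rewrite FE; exists k, k', Om; split.
have cP : convex P.
  by apply: convex_bigcap => a; apply: convexI; [apply: convex_half|apply: convex_open_half].
(* A chamber has full support, so its convex element [P] has interior points; this makes
   [open_chart] applicable to [f] as well. *)
have [z0 z0P] : exists o : V, nbhs o P.
  apply: convex_full_nbhs => //; first by apply: (face_nonempty vF (E := P) (x := y)); rewrite -FE.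
  move=> E' aE' PE'; apply: Fmin => //; rewrite !FE in FP *.
  exact: face_superset FP PE'.
have [g1 g1A1 fg1] := open_chart hC hM hnorm fA aA1 (convex_interior cP)
  (ex_intro _ z0 z0P) (fun z zP => nbhs_interior zP)
  (fun z zP => PA1 _ (nbhs_singleton zP)).
have {}fg1 z : closure P z -> f z = g1 z.
  move=> zP; apply: (charts_eq_closure hd hnorm fA g1A1 fg1).
  exact: (convex_closure_interior cP z0P).
have [u uW g1E] := chart_trans hC hM hA1 g1A1.
have PX : P `<=` [set x | f x = h (u x)].
  by move=> z Pz /=; rewrite fg1 ?g1E //; apply: subset_closure.
exists A1, h, u; split=> //.
- by rewrite !FE in FP *; apply: face_superset FP PX.
- by exists z0; apply: filterS PX z0P.
have deep p c : Cf c -> exists2 T : R, 1 <= T & U (p + T *: c).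
  move=> cC; have [T T1 H] := chamber_absorb (p - x') cC; exists T => //.
  by rewrite /U /= addrAC.
have pre p c (T : R) : Cf c -> 1 <= T -> preordered S p (p + T *: c).
  move=> cC T1; left; rewrite /tits_le addrC addKr; apply: fund_chamber_tits => j.
  by rewrite evZr mulr_ge0 ?ltW //; lra.
have [[v vF0] germ] := (vface_nonempty (simple_face_vface R S i), face_germ (clF _ FP)).
have face_agree p : (iota @^-1` (f @` closure P)) p -> iota p = h p.
  move=> [q qP fq]; have [T T1 TU] := deep p v0 v0C.
  have [e e0 He] := nbhs_direction (p - (p + T *: v0)) (oU _ TU).
  pose t := Num.min (e / 2) 1.
  have t0 : 0 < t by rewrite lt_min ltr01 divr_gt0.
  have te : t < e by rewrite (@le_lt_trans _ _ (e / 2)) ?ge_min ?lexx //; lra.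
  have t1 : t <= 1 by rewrite ge_min lexx orbT.
  apply: (charts_agree_extend hC hM hnorm (x := p + T *: v0) (t := t) iA0 hA1).
  - exact: hU.
  - by rewrite t0.
  - by apply/hU/He; rewrite gtr0_norm.
  - by rewrite -fq fg1 //; apply: chart_in hM _ _ _ g1A1.
  - by case: (pre p v0 T v0C T1) => ?; [right|left].
move=> c cC.
(* For a small panel point [p], the vector [c - p] is still in [Cf], so [c] lies on a preordered
   segment from [p] to a point deep in the subsector. *)
have cU0 : nbhs (0 : V) [set p | Cf (c - p)].
  apply: nbhs_forall => j.
  have : nbhs (0 : V) [set p | ev (alpha R S j) p < ev (alpha R S j) c].
    by apply: nbhs_ev_lt; rewrite ev0r.
  by apply: filterS => p /=; rewrite evBr subr_gt0.
have [e e0 He] := nbhs_direction v (filterI germ cU0).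
have e2 : `|e / 2| < e by rewrite gtr0_norm ?divr_gt0 //; lra.
have vF2 : simple_face S i ((e / 2) *: v).
  by apply: (vfaceZ (simple_face_vface R S i)) => //; rewrite divr_gt0.
have [] := He _ e2; rewrite /= !add0r; set p := (e / 2) *: v in vF2 *.
move=> /(_ (ex_intro2 _ _ _ vF2 (esym (add0r p)))) pP cp.
have [T T1 TU] := deep p _ cp.
have T0 : 0 < T by lra.
have -> : c = p + T^-1 *: ((p + T *: (c - p)) - p).
  by apply/colP => j; rewrite !mxE; field; rewrite gt_eqF.
apply: (charts_agree_segment hM hnorm iA0 hA1).
- exact: face_agree.
- exact: hU.
- exact: pre.
- by rewrite invr_ge0 ltW //= invf_le1.
Qed.

End ThirdChamber.

(** * Isometries of the Weyl group *)

Section FaceFilters.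
Context (R : realType) (I : finType) (C : I -> I -> int) (n : nat).
Context (hC : kac_moody_matrix C) (S : root_datum C n).
Context (g : kac_moody_algebra R[i] C).
Local Notation V := 'cV[R]_n.
Local Notation Cf := (@fund_chamber R I C n S).

Lemma half_min (k k' : option int) : exists l : option int, forall a : 'rV[R]_n,
  half a l = half a k `&` half a k' /\ open_half a l = open_half a k `&` open_half a k'.
Proof.
case: k k' => [m|] [m'|]; last by exists None => a; rewrite !setTI.
- have [mm|mm] := leP m m'.
    have mmR : m%:~R <= m'%:~R :> R by rewrite ler_int.
    exists (Some m) => a; split; apply/seteqP; split=> x /=; try by case.
      by move=> ax; split=> //; lra.
    by move=> ax; split=> //; lra.
  have mmR : m'%:~R <= m%:~R :> R by rewrite ler_int ltW.
  exists (Some m') => a; split; apply/seteqP; split=> x /=; try by case.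
    by move=> ax; split=> //; lra.
  by move=> ax; split=> //; lra.
- by exists (Some m) => a; rewrite !setIT.
- by exists (Some m') => a; rewrite !setTI.
Qed.

Lemma faceI (x : V) Fv (E E' : set V) :
  face S g x Fv E -> face S g x Fv E' -> face S g x Fv (E `&` E').
Proof.
move=> [k1 [k1' [Om1 [ O1 P1 OP1]]]] [k2 [k2' [Om2 [ O2 P2 OP2]]]].
have [l lE] := boolp.choice (fun a => half_min (k1 a) (k2 a)).
have [l' l'E] := boolp.choice (fun a => half_min (k1' a) (k2' a)).
exists l, l', (Om1 `&` Om2); split; first exact: filterI.
  move=> z Pz; split; [apply: P1|apply: P2] => a Da; have [] := Pz a Da;
    by rewrite (lE a a).1 (l'E a a).2 => -[? ?] [? ?].
move=> z [[zO1 zO2] zF] a Da.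
have [? ?] := OP1 z (conj zO1 zF) a Da.
have [? ?] := OP2 z (conj zO2 zF) a Da.
by rewrite (lE a a).1 (l'E a a).2.
Qed.

Lemma face_fund_chamber : face S g 0 Cf Cf.
Proof.
exists (fun=> None).
exists (fun a => if `[< exists j, a = alpha R S j >] then Some 0 else None), setT.
split; first exact: filterT.
  move=> x Px j; have [_] := Px _ (all_roots_alpha hC S g j).
  case: asboolP => [_|]; first by rewrite /= addr0.
  by case; exists j.
move=> _ [_ [x xC <-]] a Da; split=> //.
case: asboolP => [[j ->]|] //; rewrite /= addr0 add0r; exact: xC.
Qed.

Lemma simple_face_closure i x : simple_face S i x -> closure Cf x.
Proof.
move=> /simple_faceP[xi xj]; apply/closure_fund_chamberP => j.
by have [->|/xj/ltW] := eqVneq j i; rewrite ?xi.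
Qed.

Lemma sr_simple_face i (x : V) : simple_face S i x -> simple_reflection R S i *m x = x.
Proof. by move=> /simple_faceP[xi _]; rewrite srE xi scale0r subr0. Qed.

Lemma face_reflect_panel i E : face S g 0 (simple_face S i) E ->
  face S g 0 (simple_face S i) [set x | E (simple_reflection R S i *m x)].
Proof.
move=> FE.
have := @face_affine _ _ _ _ hC S g (simple_reflection R S i) 0 0 (simple_face S i) E
  (weyl_sr _ _ _) (coroot_lattice0 _ _).
rewrite mulmx0 addr0 (_ : _ @` _ = simple_face S i); last first.
  apply/seteqP; split=> [_ [x xF <-]|x xF]; first by rewrite sr_simple_face.
  by exists x => //; rewrite sr_simple_face.
by move=> [/(_ FE) + _]; under eq_set do rewrite addr0.
Qed.

End FaceFilters.

Section ReflectionIsometry.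
Context (R : realType) (I : finType) (C : I -> I -> int) (n : nat).
Context (hC : kac_moody_matrix C) (S : root_datum C n).
Context (g : kac_moody_algebra R[i] C).
Context (M : apartment_system R n) (hM : is_masure S g M).
Context (d : M -> M -> R) (hd : is_distance d).
Context (hnorm : forall A : set M, apartments A -> induced_by_norm d A).
Local Notation V := 'cV[R]_n.
Local Notation Cf := (@fund_chamber R I C n S).
Local Notation alpha := (@alpha R I C n S).
Local Notation sr := (@simple_reflection R I C n S).

(* [iota \o u] plays the role of the retraction, centred at the sector germ of
   [iota] in direction [Cf], of the apartment of [f]. *)
Lemma retracted_chamber (A0 : set M) (iota : V -> M) (A : set M) (f : V -> M) F i :
  chart A0 iota -> chart A f -> is_chamber S g F ->
  (forall E, F E -> face S g 0 (simple_face S i) (iota @^-1` (f @` closure E))) ->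
  f @ F = iota @ face S g 0 Cf \/
  exists A1 h u, [/\ [/\ chart A1 h, affine_weyl S u, F [set x | f x = h (u x)] &
    exists o : V, nbhs o [set x | f x = h (u x)]],
    forall x, Cf x -> iota x = h x,
    F [set x | open_half (- alpha i) (Some 0) (u x)] &
    forall p q, simple_face S i p -> closure [set x | f x = h (u x)] q ->
      f q = iota p -> u q = p].
Proof.
move=> iA0 fA chF clF.
have [A1 [h [u [hA1 uW FX oX ih]]]] := sector_retraction hC hM hd hnorm iA0 fA chF clF.
have huA1 : chart A1 (h \o u) by apply: chart_comp hM _ _ _ hA1 uW.
have ihF p : simple_face S i p -> iota p = h p.
  by move=> /simple_face_closure; apply: (charts_eq_closure hd hnorm iA0 hA1 ih).
have fix_p p q : simple_face S i p -> closure [set x | f x = h (u x)] q ->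
    f q = iota p -> u q = p.
  move=> pF qX fq; apply: (chart_inj hC hM hA1); rewrite -(ihF p pF) -fq.
  by have /= -> := charts_eq_closure hd hnorm fA huA1 (X := [set x | f x = h (u x)]) (fun _ => id) qX.
pose F1 : set_system V := [set E | F (u @^-1` E)].
have chF1 : is_chamber S g F1 by apply: chamber_image.
have [[y [Fv [vF FE0]]] _] := chF.
have {FE0} FE E : F E = face S g y Fv E by rewrite FE0.
have FI E E' : F E -> F E' -> F (E `&` E') by rewrite !FE; apply: faceI.
have Fsub E E' : E `<=` E' -> F E -> F E' by rewrite !FE => EE' ?; apply: face_superset EE'.
have clF1 E : F1 E -> nbhs (0 : V) [set x | simple_face S i x -> closure E x].
  move=> /(FI _ _ FX) /clF /face_germ; apply: filterS => p + pF.
  move=> /(_ (ex_intro2 _ _ _ pF (esym (add0r p))))[q qX fq].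
  have qX1 : closure [set x | f x = h (u x)] q.
    by apply: closure_subset qX => x [].
  have <- := fix_p p q pF qX1 fq.
  have [w [t [wW tQ uE]]] := uW; rewrite uE => U /nbhs_preimage_affine.
  move=> /qX[x [[_ Ex] Ux]]; exists (w *m x + t); split=> //.
  by move: Ex; rewrite /= uE.
(* On the side of [Cf], uniqueness identifies the picture of the chamber with the one at 0 in
   direction [Cf]; as [iota = h] on [Cf], the chamber itself is then that of [iota]. *)
have [F1i|F1i] := chamber_side hC 0 chF1 (all_roots_alpha hC S g i); last first.
  right; exists A1, h, u; split=> //.
left; have F1E := unique_chamber hC chF1 clF1 F1i.
have KI E : face S g 0 Cf E = F (u @^-1` E) by rewrite -F1E.
have KCf := face_fund_chamber hC S g.
apply/seteqP; split=> E /= FE'.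
- apply: (@face_superset _ _ _ _ _ _ _ _ ([set x | E (h x)] `&` Cf)); last first.
    by move=> x [Ex xC]; rewrite /= ih.
  apply: faceI => //; rewrite KI; apply: Fsub (FI _ _ FE' FX) => x [Ex /= fx].
  by rewrite -fx.
- have : face S g 0 Cf [set x | E (h x)].
    apply: (@face_superset _ _ _ _ _ _ _ _ ((iota @^-1` E) `&` Cf)); first exact: faceI.
    by move=> x [Ex xC] /=; rewrite -ih.
  by rewrite KI => FE''; apply: Fsub (FI _ _ FE'' FX) => x [Ex /= fx]; rewrite fx.
Qed.

Lemma sr_affine_weyl i : affine_weyl S (fun x : V => sr i *m x).
Proof. exact: affine_weyl_lin (weyl_sr _ _ _). Qed.

Lemma third_element (T : Type) (X : set T) (a b : T) :
  (`I_3 #<= X)%card -> exists2 x, X x & x <> a /\ x <> b.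
Proof.
move=> X3; apply: contrapT => nX.
pose f k := if k == 0%N then a else b.
have Xf : X `<=` f @` `I_2.
  move=> x Xx; apply: contrapT => nab; apply: nX; exists x => //.
  by split=> xE; apply: nab; [exists 0%N|exists 1%N].
have := card_le_trans (card_le_trans X3 (subset_card_le Xf)) (card_image_le _ _).
by rewrite card_le_II.
Qed.

Lemma is_norm_weyl (w : 'M[R]_n) (N : V -> R) : weyl S w -> is_norm N ->
  is_norm (N \o mulmx w).
Proof.
move=> wW [N0 NZ ND]; split=> [x /= /N0 x0|a x /=|x z /=].
- by rewrite -(weyl_mulVx hC x wW) x0 mulmx0.
- by rewrite -scalemxAr NZ.
- by rewrite mulmxDr ND.
Qed.

(* [s] compares the retractions of a third chamber of the panel from the two
   sides of the wall. *)
Lemma wall_isometry (A0 : set M) (iota : V -> M) (N : V -> R) i :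
  thick_finite_panels S g M -> chart A0 iota -> is_norm N ->
  (forall x y, d (iota x) (iota y) = N (x - y)) ->
  exists2 s, weyl S s & exists c, [/\ forall x : V, s *m x = x + ev (alpha i) x *: c,
    0 < 1 + ev (alpha i) c & forall x, N (s *m x) = N (sr i *m x)].
Proof.
move=> thick iA0 hN iN.
(* The sector of [iota'] in direction [Cf] is the sector of [iota] across the wall, so one lemma
   serves for both retractions. *)
pose iota' := iota \o (fun x : V => sr i *m x).
have i'A0 : chart A0 iota' by apply: chart_comp hM _ _ _ iA0 (sr_affine_weyl i).
have [aA0 iA0'] := iA0.
pose P : set_system M := iota @ face S g 0 (simple_face S i).
have PP : transported_any (is_panel S g) P.
  exists A0 => //; exists iota, (face S g 0 (simple_face S i)).
  by split=> //; apply: simple_panel.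
have [_ P3] := thick P PP.
have [Ch [A [f [F [aA fA0 chF ChE clF]]]] []] :=
  third_element (iota @ face S g 0 Cf) (iota' @ face S g 0 Cf) P3.
rewrite ChE => Ch1 Ch2.
have fA : chart A f by [].
have clF' E : F E -> face S g 0 (simple_face S i) (iota' @^-1` (f @` closure E)).
  by move=> /clF; apply: face_reflect_panel.
have [//|[A1 [h [u [[hA1 uW FX [z0 oX]] ih uneg ufix]]]]] := retracted_chamber iA0 fA chF clF.
have [//|[A2 [h' [u' [[h'A2 u'W FX' [z0' oX']] ih' u'neg u'fix]]]]] :=
  retracted_chamber i'A0 fA chF clF'.
have [[y [Fv [vF FE0]]] _] := chF.
have {FE0} FE E : F E = face S g y Fv E by rewrite FE0.
have FI E E' : F E -> F E' -> F (E `&` E') by rewrite !FE; apply: faceI.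
(* With [v] inverse to [u'], the map [u \o v] carries the second picture of the chamber to the
   first. *)
have [v [v'W uv vu]] := affine_weyl_inv hC u'W.
have [s [t [sW tQ sE]]] := affine_weyl_comp uW v'W.
have fixF : nbhs (0 : V) [set p | simple_face S i p -> u (v p) = p].
  have := FI _ _ FX FX' => /clF /face_germ; apply: filterS => p + pF.
  move=> /(_ (ex_intro2 _ _ _ pF (esym (add0r p))))[q qX fq].
  have <- : u' q = p.
    apply: u'fix => //; first by apply: closure_subset qX => x [].
    by rewrite fq /iota' /= sr_simple_face.
  rewrite uv; have -> : u' q = p.
    apply: u'fix => //; first by apply: closure_subset qX => x [].
    by rewrite fq /iota' /= sr_simple_face.
  by apply: ufix => //; apply: closure_subset qX => x [].
have sfix x : simple_face S i x -> s *m x = x /\ t = 0.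
  move=> xF; have [e e0 H] := nbhs_direction x fixF.
  have fix_r r : 0 < r < e -> r *: (s *m x) + t = r *: x.
    move=> /andP[r0 re]; have := H r; rewrite add0r gtr0_norm // => /(_ re).
    move=> /(_ (vfaceZ (simple_face_vface R S i) xF r0)).
    by have /= -> := congr1 (fun k => k (r *: x)) sE; rewrite -scalemxAr.
  (* Two scalings of the same fixed direction separate the translation part [t] from the linear part
     [s]. *)
  have r1 : 0 < e / 2 < e by apply/andP; split; lra.
  have r2 : 0 < e / 4 < e by apply/andP; split; lra.
  have := fix_r _ r1; have := fix_r _ r2 => h2 h1.
  have t0 : t = 0.
    have : 2 *: ((e / 4) *: (s *m x) + t) - ((e / 2) *: (s *m x) + t) = 0.
      by rewrite h1 h2; apply/colP => j; rewrite !mxE; field.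
    by move=> <-; apply/colP => j; rewrite !mxE; field.
  split=> //; move: h1; rewrite t0 addr0 => /scalerI; apply.
  by rewrite gt_eqF //; lra.
have [x0 x0F] := vface_nonempty (simple_face_vface R S i).
have t0 : t = 0 := (sfix _ x0F).2.
have {}sE x : u (v x) = s *m x.
  by have /= -> := congr1 (fun k => k x) sE; rewrite t0 addr0.
have sker x : ev (alpha i) x = 0 -> s *m x = x.
  move=> xi; have [r r0 xrF] := simple_face_perturb x0F xi.
  have := (sfix _ xrF).1; rewrite mulmxDr (sfix _ x0F).1 -scalemxAr.
  by move=> /addrI/scalerI; apply; rewrite gt_eqF.
have [y0 y0E] := alpha_dual S (fun=> 1 : R).
pose c := s *m y0 - y0.
have sc x : s *m x = x + ev (alpha i) x *: c.
  have : s *m (x - ev (alpha i) x *: y0) = x - ev (alpha i) x *: y0.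
    by apply: sker; rewrite evBr evZr y0E mulr1 subrr.
  rewrite mulmxBr -scalemxAr /c scalerBr addrCA => /(canRL (subrK _)) ->.
  by rewrite addrC.
exists s => //; exists c; split=> //.
(* Each picture lies on the negative side in its own coordinates, and [s] multiplies [alpha i] by
   [1 + ev (alpha i) c]; hence this factor is positive. *)
- have /(face_nonempty vF)[q [q1 q2]] : face S g y Fv
     ([set x | open_half (- alpha i) (Some 0) (u x)] `&`
      [set x | open_half (- alpha i) (Some 0) (u' x)]) by rewrite -FE; apply: FI.
  move: q1 q2; rewrite /= !addr0 !evNl -{1}(uv q) sE sc evDr evZr.
  set a := ev (alpha i) (u' q); set b := ev _ c => h1 h2.
  have {}h1 : 0 < (- a) * (1 + b) by lra.
  by rewrite pmulr_rgt0 in h1.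
- have [Nf hNf fN] := chart_norm hnorm fA.
  have [Nh hNh hNE] := chart_norm hnorm hA1.
  have [Nh' hNh' hNE'] := chart_norm hnorm h'A2.
  have [v0 v0C] := @fund_chamber_nonempty R I C n S.
  have oC := nbhs_fund_chamber v0C.
  have NNh : N =1 Nh.
    have o1 : nbhs v0 [set x | iota x = h x] by apply: filterS oC.
    exact: (charts_norm_eq iA0 hA1 o1 hN iN hNh hNE).
  have iN' x z : d (iota' x) (iota' z) = (N \o mulmx (sr i)) (x - z).
    by rewrite /iota' /= iN mulmxBr.
  have NNh' : N \o mulmx (sr i) =1 Nh'.
    have o1 : nbhs v0 [set x | iota' x = h' x] by apply: filterS oC.
    exact: (charts_norm_eq i'A0 h'A2 o1 (is_norm_weyl (weyl_sr _ _ _) hN) iN' hNh' hNE').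
  (* Both norms are compared through that of the chart [f] of the third chamber, which agrees with
     each retraction on an open set. *)
  have norm_f (A' : set M) (k : V -> M) (r : V -> V) (Nk : V -> R) (o : V) :
      chart A' k -> affine_weyl S r -> is_norm Nk ->
      (forall x z, d (k x) (k z) = Nk (x - z)) ->
      nbhs o [set x | f x = k (r x)] -> forall x z, Nf (x - z) = Nk (r x - r z).
    move=> kA' rW hNk kN oU x z; have [wr [tr [wrW trQ rE]]] := rW.
    have krN x1 z1 : d ((k \o r) x1) ((k \o r) z1) = (Nk \o mulmx wr) (x1 - z1).
      by rewrite /= kN rE opprD addrACA subrr addr0 -mulmxBr.
    apply: etrans (charts_norm_eq fA (chart_comp hM kA' rW) oU hNf fN
      (is_norm_weyl wrW hNk) krN (x - z)) _.
    by rewrite rE /= opprD addrACA subrr addr0 -mulmxBr.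
  move=> z; have := norm_f _ _ _ _ _ hA1 uW hNh hNE oX (v z) (v 0).
  rewrite (norm_f _ _ _ _ _ h'A2 u'W hNh' hNE' oX') !vu !sE subr0 mulmx0 subr0.
  by rewrite -NNh -NNh' /= => ->.
Qed.

End ReflectionIsometry.

(** * Comparison of a norm with the sup norm *)

Section NormEquivalence.
Context (R : realType) (n : nat).

Lemma rV_entry_le (x : 'rV[R]_n) i : `|x 0 i| <= `|x|.
Proof.
rewrite [leRHS]/Num.Def.normr /= mx_normrE.
by apply/bigmax_geP; right => /=; exists (0, i).
Qed.

Lemma tr_norm_le (x : 'rV[R]_n) : `|x^T| <= `|x|.
Proof. by apply: cV_norm_le => // i; rewrite mxE; apply: rV_entry_le. Qed.

Lemma lipschitz_continuous_rV (f : 'rV[R]_n -> R) (K : R) : 0 < K ->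
  (forall x y, `|f x - f y| <= K * `|x - y|) -> continuous f.
Proof.
move=> K0 fK x U /nbhs_ballP[e /= e0 xU].
apply/nbhs_ballP; exists (e / K); first exact: divr_gt0.
move=> y; rewrite -ball_normE /= => xy; apply: xU; rewrite -ball_normE /=.
by apply: le_lt_trans (fK _ _) _; rewrite -ltr_pdivlMl // mulrC.
Qed.

Lemma is_norm_ge_mx_norm (N : 'cV[R]_n -> R) : is_norm N ->
  exists2 m : R, 0 < m & forall x, m * `|x| <= N x.
Proof.
move=> hN; have [K K0 NK] := is_norm_le_mx_norm hN.
have [_ _ tri] := hN.
pose f (v : 'rV[R]_n) := N v^T.
have fK x y : `|f x - f y| <= K * `|x - y|.
  have xy (a b : 'rV[R]_n) : f a - f b <= K * `|a - b|.
    have := tri (a - b)^T b^T; rewrite -[in N (_ + _)]linearD /= subrK -/(f a) -/(f b).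
    have := NK (a - b)^T; have := ler_wpM2l (ltW K0) (tr_norm_le (a - b)).
    by rewrite /f; lra.
  rewrite ler_norml xy andbT; have := xy y x; rewrite [`|y - x|]distrC; lra.
pose A := [set v : 'rV[R]_n | `|v| = 1].
(* The unit sphere is empty only when the space is zero; otherwise the constant is the minimum of
   [N] on it. *)
have [A0|/nonemptyPn A0] := pselect (A !=set0); last first.
  exists 1 => // x; suff -> : x = 0 by rewrite normr0 mulr0 is_norm0.
  apply: contrapT => x0; have : A (`|x^T|^-1 *: x^T).
    have xT : `|x^T| != 0.
      by rewrite normr_eq0 -trmx0 (inj_eq trmx_inj); apply/eqP.
    by rewrite /A /= normrZ normrV ?unitfE // normr_id mulVf.
  by rewrite A0.
have cA : compact A.
  apply: bounded_closed_compact.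
    by exists 1; split=> [|r r1 v /= ->]; [apply: num_real|apply: ltW].
  rewrite (_ : A = (fun v : 'rV[R]_n => `|v|) @^-1` [set 1]) //.
  apply: closed_comp; last exact: closed_eq.
  by move=> v _; apply: norm_continuous.
have [v0 v0A v0min] := EVT_min_rV A0 cA (continuous_subspaceT (lipschitz_continuous_rV K0 fK)).
exists (f v0).
  apply: is_norm_gt0 => //; apply: contraPneq v0A => v00; rewrite inE /A /=.
  have -> : v0 = 0 by apply: trmx_inj; rewrite v00 trmx0.
  by rewrite normr0 => /esym/eqP; rewrite oner_eq0.
move=> x; have [->|x0] := eqVneq x 0; first by rewrite normr0 mulr0 is_norm0.
have xT : 0 < `|x^T|.
  by rewrite normr_gt0 -trmx0 (inj_eq trmx_inj).
have := v0min (`|x^T|^-1 *: x^T); rewrite inE /A /= normrZ ger0_norm ?invr_ge0 //.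
rewrite mulVf ?gt_eqF // => /(_ erefl).
rewrite /f linearZ /= trmxK is_normZ // ger0_norm ?invr_ge0 // ler_pdivlMl // => H.
have xx : `|x| <= `|x^T| by have := tr_norm_le x^T; rewrite trmxK.
have := ler_wpM2l (is_norm_ge0 hN v0^T) xx; rewrite mulrC in H *; lra.
Qed.

End NormEquivalence.

(** * Transvections and isometries in the Weyl group *)

Section ReflectionGroup.
Context (R : realType) (I : finType) (C : I -> I -> int) (n : nat).
Context (hC : kac_moody_matrix C) (S : root_datum C n).
Context (g : kac_moody_algebra R[i] C).
Local Notation V := 'cV[R]_n.
Local Notation alpha := (@alpha R I C n S).
Local Notation Delta := (@all_roots R I C n S g).

(* The roots [alpha j *m t] and [alpha j *m invmx t] have coefficient 1 at
   [alpha j], hence are positive, and have opposite coefficients at [alpha i]. *)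
Lemma transvection_orthogonal (t : 'M[R]_n) i (c : V) : weyl S t ->
  (forall x : V, t *m x = x + ev (alpha i) x *: c) -> ev (alpha i) c = 0 ->
  forall j, ev (alpha j) c = 0.
Proof.
move=> tW tE ci j; have [->//|ji] := eqVneq j i.
have half (u : 'M[R]_n) (e : V) : weyl S u ->
    (forall x : V, u *m x = x + ev (alpha i) x *: e) -> 0 <= ev (alpha j) e.
  move=> uW uE.
  have aE x : ev (alpha j *m u) x = ev (alpha j) x + ev (alpha i) x * ev (alpha j) e.
    by rewrite -evM uE evDr evZr.
  have Da : Delta (alpha j *m u).
    exact: (all_roots_weyl hC uW (all_roots_alpha hC S g j)).
  have [v vE] := alpha_dual S (fun k => (k == j)%:R : R).
  have [v' v'E] := alpha_dual S (fun k => (k == i)%:R : R).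
  have [a0|a0] := all_roots_sign Da.
    have := positive_root_ge0 (x := v') a0; rewrite aE !v'E eqxx (negPf ji) add0r mul1r.
    by apply=> k; rewrite v'E.
  have := positive_root_ge0 (x := v) a0; rewrite evNl aE !vE eqxx eq_sym (negPf ji).
  rewrite mul0r addr0 => H; suff : 0 <= -1 :> R by lra.
  by apply: H => k; rewrite vE.
have H1 := half t c tW tE.
have H2 := half (invmx t) (- c) (weyl_inv hC tW).
suff : 0 <= ev (alpha j) (- c) by rewrite evNr; lra.
apply: H2 => x; rewrite -[LHS](addrK (ev (alpha i) x *: c)) scalerN; congr (_ - _).
rewrite -[RHS](weyl_mulVx hC x tW) tE mulmxDr -scalemxAr; congr (_ + _ *: _).
by rewrite -[LHS](weyl_mulVx hC c tW) tE ci scale0r addr0.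
Qed.

(** The matrices are integral, and an isometry sends each basis vector to a vector of the same
    [N]-norm, which bounds its entries. *)
Lemma finite_isometries (N : V -> R) : is_norm N ->
  finite_set [set w : 'M[R]_n | weyl S w /\ forall x : V, N (w *m x) = N x].
Proof.
move=> hN; have [m m0 mN] := is_norm_ge_mx_norm hN.
pose B := Num.bound (\sum_j N (delta_mx j 0) / m).
pose F (c : {ffun 'I_n * 'I_n -> 'I_(B + B).+1}) : 'M[R]_n :=
  \matrix_(i, j) ((c (i, j))%:R - B%:R).
apply: (@sub_finite_set _ _ (F @` setT)); last first.
  exact/finite_image/finite_finset.
move=> w [/weyl_integral[z zE] wN].
have zB i j : `|z i j|%:~R <= B%:R :> R.
  apply: (@le_trans _ _ (\sum_j N (delta_mx j 0) / m)); last first.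
    apply/ltW/archi_boundP/sumr_ge0 => k _.
    by rewrite divr_ge0 ?is_norm_ge0 // ltW.
  apply: (@le_trans _ _ (N (delta_mx j 0) / m)); last first.
    rewrite (bigD1 j) //= lerDl sumr_ge0 // => k _.
    by rewrite divr_ge0 ?is_norm_ge0 // ltW.
  rewrite ler_pdivlMr // mulrC -wN; apply: le_trans (mN _).
  rewrite ler_pM2l //; apply: le_trans (cV_entry_le _ i).
  by rewrite -colE zE !mxE -intr_norm.
have zB' i j : `|z i j| <= B%:Z by rewrite -(ler_int R) zB.
exists [ffun p => inord `|z p.1 p.2 + B%:Z|] => //.
apply/matrixP => i j; rewrite zE !mxE ffunE /=.
have := zB' i j; rewrite ler_norml => /andP[z1 z2].
rewrite inordK; last by lia.
have -> : `|z i j + B|%:R = (z i j + B%:Z)%:~R :> R.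
  by rewrite -[in RHS](@gez0_abs (z i j + B)) //; lia.
by rewrite rmorphD /= addrK.
Qed.

End ReflectionGroup.

(** * Invertibility of the Cartan matrix *)

Section WeylIsometry.
Context (R : realType) (I : finType) (C : I -> I -> int) (n : nat).
Context (hC : kac_moody_matrix C) (S : root_datum C n).
Local Notation V := 'cV[R]_n.
Local Notation alpha := (@alpha R I C n S).
Local Notation alphav := (@alphav R I C n S).

Lemma sum_sqr_eq0 m (l : 'rV[R]_m) : (l *m l^T) 0 0 = 0 -> l = 0.
Proof.
rewrite mxE => /eqP; rewrite psumr_eq0; last first.
  by move=> j _; rewrite mxE -expr2 sqr_ge0.
move=> /allP l0; apply/rowP => j; rewrite mxE; apply/eqP.
have := l0 j (mem_index_enum j); rewrite mxE /= -expr2.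
by rewrite sqrf_eq0.
Qed.

(* Averaging over the finite group of isometries gives an invariant scalar
   product, for which a vector of the span of the roots killed by all coroots is
   orthogonal to every root; hence the Cartan matrix is invertible. *)
Lemma coroot_perturbation_eq0 (N : V -> R) (c : I -> V) (w : I -> 'M[R]_n) :
  is_norm N -> (forall i, weyl S (w i)) ->
  (forall i x, w i *m x = x - ev (alpha i) x *: (alphav i + c i)) ->
  (forall i j, ev (alpha j) (c i) = 0) -> (forall i x, N (w i *m x) = N x) ->
  (forall i, exists b : I -> R, c i = \sum_k b k *: alphav k) ->
  forall i, c i = 0.
Proof.
move=> hN wW wE ac wN cspan.
have /finite_seqP[s0 sE] := finite_isometries S hN.
pose s := undup s0.
have sP u : u \in s <-> weyl S u /\ forall x : V, N (u *m x) = N x.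
  rewrite mem_undup; split=> [us|us].
    by have : [set` s0] u by []; rewrite -sE.
  by have : [set` s0] u by rewrite -sE.
(* The form lives on the dual space, where the group acts on the right; left multiplication by [w i]
   permutes [s]. *)
pose B (a b : 'rV[R]_n) := \sum_(u <- s) ((a *m u) *m (b *m u)^T) 0 0.
have B_inv i a b : B (a *m w i) (b *m w i) = B a b.
  have perm : perm_eq [seq w i *m u | u <- s] s.
    have injw : injective (mulmx (w i) : 'M[R]_n -> 'M[R]_n).
      exact: can_inj (mulKmx (weyl_unit hC (wW i))).
    have uniqw : uniq [seq w i *m u | u <- s] by rewrite (map_inj_uniq injw) undup_uniq.
    have sub : {subset [seq w i *m u | u <- s] <= s}.
      move=> u /mapP[u' /sP[u'W u'N] ->]; apply/sP; split; first exact: weylMM.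
      by move=> x; rewrite -mulmxA wN u'N.
    apply: uniq_perm => //; first exact: undup_uniq.
    by have [] := uniq_min_size uniqw sub; rewrite ?size_map.
  rewrite /B -[RHS](perm_big _ perm) big_map; apply: eq_bigr => u _.
  by rewrite !mulmxA.
have B_Nr a b : B a (- b) = - B a b.
  rewrite /B -sumrN; apply: eq_bigr => u _.
  by rewrite mulNmx linearN mulmxN mxE.
have B_sum (l : I -> R) a b : (forall k, B a (b k) = 0) ->
    B a (\sum_k l k *: b k) = 0.
  move=> ab0; have -> : B a (\sum_k l k *: b k) = \sum_k l k * B a (b k).
    rewrite /B [RHS](eq_bigr (fun k => \sum_(u <- s) l k * ((a *m u) *m (b k *m u)^T) 0 0)).
      rewrite exchange_big; apply: eq_bigr => u _.
      rewrite mulmx_suml linear_sum mulmx_sumr summxE; apply: eq_bigr => k _.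
      by rewrite -scalemxAl linearZ -scalemxAr mxE.
    by move=> k _; rewrite mulr_sumr.
  by apply: big1 => k _; rewrite ab0 mulr0.
have B_eq0 a : B a a = 0 -> a = 0.
  move=> /eqP; rewrite psumr_eq0; last first.
    by move=> u _; rewrite mxE sumr_ge0 // => j _; rewrite [_^T _ _]mxE -expr2 sqr_ge0.
  have s1 : 1%:M \in s by apply/sP; split; [constructor|move=> x; rewrite mul1mx].
  by move=> /allP/(_ _ s1); rewrite mulmx1 => /eqP/sum_sqr_eq0.
have alpha_w i : alpha i *m w i = - alpha i.
  apply/rowP => k; have := wE i (delta_mx k 0) => /(congr1 (ev (alpha i))).
  rewrite evM evBr evZr evDr ev_alphav ac (Cii hC) addr0 /ev -!colE !mxE.
  by rewrite (_ : 2%:~R = 2) // => ->; ring.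
(* Such a combination [lam] of roots is fixed by each [w k], which negates [alpha k]. Invariance
   makes [lam] orthogonal to all roots, hence to itself. *)
have ker0 (l : I -> R) : (forall k, \sum_j l j * (C k j)%:~R = 0) -> forall j, l j = 0.
  move=> lC; pose lam := \sum_j l j *: alpha j.
  have lamv k : ev lam (alphav k) = 0.
    by rewrite ev_suml -[RHS](lC k); apply: eq_bigr => j _; rewrite ev_alphav.
  have lamw i : lam *m w i = lam.
    apply/rowP => k; have := wE i (delta_mx k 0) => /(congr1 (ev lam)).
    rewrite evM evBr evZr evDr lamv add0r.
    have -> : ev lam (c i) = 0.
      by rewrite ev_suml big1 // => j _; rewrite ac mulr0.
    by rewrite mulr0 subr0 /ev -!colE !mxE.
  have lam0 : lam = 0.
    apply: B_eq0; apply: B_sum => k.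
    have := B_inv k lam (alpha k); rewrite lamw alpha_w B_Nr; lra.
  move=> j; have [v vE] := alpha_dual S (fun k => (k == j)%:R : R).
  have : ev lam v = 0 by rewrite lam0 ev0l.
  rewrite ev_suml (bigD1 j) //= vE eqxx mulr1 big1 ?addr0 // => k kj.
  by rewrite vE (negPf kj) mulr0.
pose Cm : 'M[R]_#|I| := \matrix_(j, k) (C (enum_val k) (enum_val j))%:~R.
have Cfree : row_free Cm.
  apply: inj_row_free => l lC; apply/rowP => j; rewrite mxE.
  suff l0 (k : I) : \sum_j l 0 (enum_rank j) * (C k j)%:~R = 0.
    by have := ker0 _ l0 (enum_val j); rewrite enum_valK.
  have := congr1 (fun x : 'rV_#|I| => x 0 (enum_rank k)) lC.
  rewrite !mxE => lk; rewrite -[RHS]lk (reindex (@enum_val I I)) /=; last first.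
    exact: onW_bij (enum_val_bij _).
  by apply: eq_bigr => m _; rewrite mxE enum_valK enum_rankK.
(* The matrix is square, so its transpose is invertible too; the latter sends the coefficients of
   [c i] on the coroots to the values of the roots at [c i], which are 0. *)
have CTfree : row_free Cm^T by rewrite row_free_unit unitmx_tr -row_free_unit.
move=> i; have [b cE] := cspan i.
have b0 k : b k = 0.
  pose bv : 'rV[R]_#|I| := \row_k b (enum_val k).
  have bC : bv *m Cm^T = 0.
    apply/rowP => j; rewrite [RHS]mxE -(ac i (enum_val j)) cE ev_sumr mxE.
    rewrite [RHS](reindex (@enum_val I I)) /=; last first.
      exact: onW_bij (enum_val_bij _).
    by apply: eq_bigr => m _; rewrite !mxE ev_alphav.
  have : bv = 0 by apply: (row_free_inj CTfree); rewrite mul0mx.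
  by move=> /rowP/(_ (enum_rank k)); rewrite !mxE enum_rankK.
by rewrite cE big1 // => k _; rewrite b0 scale0r.
Qed.

End WeylIsometry.

Section WeylInvariance.
Context (R : realType) (I : finType) (C : I -> I -> int) (n : nat).
Context (hC : kac_moody_matrix C) (S : root_datum C n).
Context (g : kac_moody_algebra R[i] C).
Context (M : apartment_system R n) (hM : is_masure S g M).
Context (d : M -> M -> R) (hd : is_distance d).
Context (hnorm : forall A : set M, apartments A -> induced_by_norm d A).
Local Notation V := 'cV[R]_n.
Local Notation alpha := (@alpha R I C n S).
Local Notation alphav := (@alphav R I C n S).
Local Notation sr := (@simple_reflection R I C n S).

Lemma perturbed_reflection_isometry (A0 : set M) (iota : V -> M) (N : V -> R) i :
  thick_finite_panels S g M -> chart A0 iota -> is_norm N ->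
  (forall x y, d (iota x) (iota y) = N (x - y)) ->
  exists w (c : V), [/\ weyl S w,
    forall x : V, w *m x = x - ev (alpha i) x *: (alphav i + c),
    forall j, ev (alpha j) c = 0, forall x, N (w *m x) = N x &
    exists b : I -> R, c = \sum_k b k *: alphav k].
Proof.
move=> thick iA0 hN iN.
have [s sW [c [sE c1 sN]]] := wall_isometry hC hM hd hnorm i thick iA0 hN iN.
have wE x : s *m sr i *m x = x - ev (alpha i) x *: (alphav i + c).
  rewrite -mulmxA sE srE evBr evZr ev_alphav (Cii hC) (_ : 2%:~R = 2) //.
  by apply/colP => k; rewrite !mxE; ring.
have wN x : N (s *m sr i *m x) = N x.
  by rewrite -mulmxA sN mulmxA (@sr_inv R I C n hC S i) mul1mx.
(* The vector [alphav i + c] is a nonzero eigenvector of an isometry with eigenvalue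
   [- (1 + ev (alpha i) c)], a negative number, which must be -1. *)
have c0 : ev (alpha i) c = 0.
  have e0 : alphav i + c != 0.
    apply: contraTneq c1 => e0; have := ev0r (alpha i).
    rewrite -e0 evDr ev_alphav (Cii hC) (_ : 2%:~R = 2) // -leNgt; lra.
  have := wN (alphav i + c); rewrite wE evDr ev_alphav (Cii hC) (_ : 2%:~R = 2) //.
  rewrite -{1}[alphav i + c]scale1r -scalerBl is_normZ //.
  have Ne : N (alphav i + c) != 0 by rewrite gt_eqF // is_norm_gt0.
  rewrite -[RHS]mul1r => /(mulIf Ne); rewrite ler0_norm; lra.
exists (s *m sr i), c; split=> //.
- exact: weylMM sW (weyl_sr _ _ _).
- exact: (transvection_orthogonal hC g sW sE c0).
- have [y yE] := alpha_dual S (fun=> 1 : R).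
  have [b bE] := weyl_sub_coroot_span y sW; exists b.
  by rewrite -bE sE yE scale1r addrC addKr.
Qed.

Lemma weyl_isometry (A0 : set M) (iota : V -> M) (N : V -> R) :
  thick_finite_panels S g M -> chart A0 iota -> is_norm N ->
  (forall x y, d (iota x) (iota y) = N (x - y)) ->
  forall w, weyl S w -> forall x : V, N (w *m x) = N x.
Proof.
move=> thick iA0 hN iN.
have [w wP] := boolp.choice (fun i => perturbed_reflection_isometry i thick iA0 hN iN).
have [c {}wP] := boolp.choice wP.
have c0 : forall i, c i = 0.
  apply: (coroot_perturbation_eq0 hC (S := S) hN (w := w)) => i.
  - by have [H _ _ _ _] := wP i.
  - by have [_ H _ _ _] := wP i.
  - by have [_ _ H _ _] := wP i.
  - by have [_ _ _ H _] := wP i.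
  - by have [_ _ _ _ H] := wP i.
move=> u; elim=> [|i u' _ IH] x; first by rewrite mul1mx.
have [_ wE _ wN _] := wP i.
by rewrite -mulmxA srE -[alphav i]addr0 -(c0 i) -wE wN.
Qed.

End WeylInvariance.

(** * Finite Weyl groups *)

Section FlatCover.
Context (R : realType) (n : nat) (T : eqType).
Local Notation V := 'cV[R]_n.

(* A segment leaving an irredundant flat of the cover meets each of the others in
   at most one point. *)
Lemma flat_cover (X : set V) (F : T -> set V) (s : seq T) : convex X -> X !=set0 ->
  (forall w p q (r : R), F w p -> F w q -> p != q -> X (p + r *: (q - p)) ->
    F w (p + r *: (q - p))) ->
  (forall q, X q -> exists2 w, w \in s & F w q) ->
  exists2 w, w \in s & X `<=` F w.
Proof.
move=> cX X0 flat; elim: s => [cov|a s IH cov].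
  by have [q /cov[]] := X0.
have [cov'|] := pselect (forall q, X q -> exists2 w, w \in s & F w q).
  by have [w ws XF] := IH cov'; exists w => //; rewrite inE ws orbT.
move=> /existsNP[q /not_implyP[Xq nq]].
have Faq : F a q.
  have [w] := cov q Xq; rewrite inE => /predU1P[->//|ws Fwq].
  by case: nq; exists w.
have [XFa|] := pselect (X `<=` F a); first by exists a; rewrite ?mem_head.
move=> /existsNP[p /not_implyP[Xp nFp]].
have qp : q != p by apply/eqP => qp; apply: nFp; rewrite -qp.
(* Infinitely many points strictly inside the segment from [p] to [q]. None is in [F a], since [F a]
   would then contain [p]; two of them share some other [F w], which then contains [q], a
   contradiction. *)
pose t (k : nat) : R := k.+2%:R^-1.
have t0 k : 0 < t k by rewrite invr_gt0.
have t1 k : t k < 1 by rewrite invf_lt1 // ltr1n.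
have t_inj k l : t k = t l -> k = l.
  by move=> /invr_inj/eqP; rewrite eqr_nat => /eqP[].
pose x k := p + t k *: (q - p).
have x_in k : X (x k) by apply: cX => //; rewrite !ltW.
have W k : exists w, w \in s /\ F w (x k).
  have [w] := cov _ (x_in k); rewrite inE => /predU1P[->|ws Fw]; last by exists w.
  move=> Fax; case: nFp.
  have xq : x k != q.
    apply: contraTneq (t1 k) => /eqP; rewrite -subr_eq0.
    rewrite (_ : x k - q = (t k - 1) *: (q - p)); last first.
      by apply/colP => i; rewrite !mxE; ring.
    by rewrite scaler_eq0 !subr_eq0 (negPf qp) orbF => /eqP ->; rewrite ltxx.
  have pE : p = q + (1 - t k)^-1 *: (x k - q).
    have tk : 1 - t k != 0 by rewrite gt_eqF // subr_gt0.
    by apply/colP => i; rewrite !mxE; field.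
  by rewrite pE; apply: flat; rewrite ?(eq_sym q) // -pE.
have {W}[W Ws] := boolp.choice W.
have [k [l [kl Wkl]]] : exists k l, k != l /\ W k = W l.
  apply: contrapT => nW.
  have injW : injective W.
    by move=> k l Wkl; apply/eqP/negPn/negP => kl; apply: nW; exists k, l.
  have := @uniq_leq_size _ [seq W k | k <- iota 0 (size s).+1] s.
  rewrite map_inj_uniq // iota_uniq size_map size_iota ltnn => /(_ isT) sub.
  have /sub : {subset [seq W k | k <- iota 0 (size s).+1] <= s}.
    by move=> w /mapP[k _ ->]; have [] := Ws k.
  by [].
case: nq; exists (W k); first by have [] := Ws k.
have tkl : t l - t k != 0.
  by rewrite subr_eq0; apply: contra kl => /eqP/t_inj ->.
have qE : q = x k + ((1 - t k) / (t l - t k)) *: (x l - x k).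
  by apply/colP => i; rewrite !mxE; field.
rewrite qE; apply: flat; last by rewrite -qE.
- by have [] := Ws k.
- by rewrite Wkl; have [] := Ws l.
- rewrite -subr_eq0 (_ : x k - x l = (t k - t l) *: (q - p)); last first.
    by apply/colP => i; rewrite !mxE; ring.
  by rewrite scaler_eq0 -opprB oppr_eq0 (negPf tkl) subr_eq0.
Qed.

End FlatCover.

Section FiniteWeylGroup.
Context (R : realType) (I : finType) (C : I -> I -> int) (n : nat).
Context (hC : kac_moody_matrix C) (S : root_datum C n).
Context (g : kac_moody_algebra R[i] C).
Context (M : apartment_system R n) (hM : is_masure S g M).
Context (d : M -> M -> R) (hd : is_distance d).
Context (hnorm : forall A : set M, apartments A -> induced_by_norm d A).
Context (Wfin : finite_set [set w : 'M[R]_n | weyl S w]).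
Local Notation V := 'cV[R]_n.
Local Notation Delta := (@all_roots R I C n S g).
Local Notation alpha := (@alpha R I C n S).
Local Notation sr := (@simple_reflection R I C n S).

Lemma seq_argmax (T : eqType) (f : T -> R) (s : seq T) : s != [::] ->
  exists2 a, a \in s & forall b, b \in s -> f b <= f a.
Proof.
elim: s => // a s IH _; have [->|/IH[b bs bmax]] := eqVneq s [::].
  by exists a; [rewrite inE|move=> b; rewrite inE => /eqP ->].
have [ab|ba] := leP (f a) (f b).
  exists b; first by rewrite inE bs orbT.
  by move=> c; rewrite inE => /predU1P[->//|/bmax].
exists a; first by rewrite mem_head.
move=> c; rewrite inE => /predU1P[->//|/bmax/le_trans]; apply; exact: ltW.
Qed.

(** In a finite orbit, a point maximising a functional positive on the simple coroots is dominant: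
    reflecting it would otherwise increase the functional. *)
Lemma tits_cone_full (x : V) : tits_cone S x.
Proof.
have /finite_seqP[s sE] := Wfin.
have sP u : u \in s <-> weyl S u.
  split=> us; first by have : [set` s] u by []; rewrite -sE.
  by have : [set` s] u by rewrite -sE.
have s0 : s != [::].
  have s1 : 1%:M \in s by apply/sP; constructor.
  by case: (s) s1.
have [lam lamE] := alphav_dual S (fun=> 1 : R).
have [w /sP wW wmax] := seq_argmax (fun w => ev lam (w *m x)) s0.
exists (invmx w), (w *m x); split.
- exact: weyl_inv.
- apply/closure_fund_chamberP => i.
  have /wmax : sr i *m w \in s by apply/sP; constructor.
  rewrite -mulmxA srE evBr evZr lamE; lra.
- by rewrite (weyl_mulVx hC _ wW).
Qed.

Lemma preordered_full (x y : V) : preordered S x y.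
Proof. by left; apply: tits_cone_full. Qed.

(** The smallest vectorial face. It is spherical once the Tits cone is the whole space, so any face
    can be replaced by a germ of a splayed chimney in this direction. *)
Definition vface0 : set V := positive_vface S 1%:M finset.setT.

Lemma vface0P v : vface0 v <-> forall i, ev (alpha i) v = 0.
Proof.
split=> [[x xJ <-] i|v0]; first by rewrite mul1mx; have := xJ i; rewrite inE.
by exists v; [move=> i; rewrite inE|rewrite mul1mx].
Qed.

Lemma vface0_vface : is_vface S vface0.
Proof. by exists 1%:M, finset.setT; split; [constructor|left]. Qed.

Lemma vface0_0 : vface0 0.
Proof. by apply/vface0P => i; rewrite ev0r. Qed.

Lemma root_vface0 a v : Delta a -> vface0 v -> ev a v = 0.
Proof.
move=> [b _ ->] /vface0P v0; rewrite ev_suml big1 // => i _.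
by rewrite v0 mulr0.
Qed.

Lemma vface0_spherical : spherical S vface0.
Proof.
exists 0; split; first exact: vface0_0.
left; apply: (@filterS _ _ _ setT); last exact: filterT.
by move=> x _; apply: tits_cone_full.
Qed.

(* [vface0] is a linear subspace, so the enclosure and the translations in the
   germ of this chimney only enlarge the sets of the face. *)
Lemma chimney_germ_face (x : V) Fv E :
  chimney_germ S g (face S g x Fv) vface0 E -> face S g x Fv E.
Proof.
move=> [u u0 [k [[E0 [E1 FE1 E10] E0P] PE]]].
apply: face_superset FE1 _ => z E1z; apply/PE/E0P.
exists (z + u); first by apply: E10; exists z => //; exists u.
exists (- u); last by rewrite addrK.
apply/vface0P => i; rewrite evNr; apply/eqP; rewrite oppr_eq0; apply/negPn/negP => ui.
have := nbhs_ev (alpha i) u (e := `|ev (alpha i) u|); rewrite normr_gt0 => /(_ ui)/u0.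
move=> [y [/vface0P y0]]; rewrite /= y0 sub0r normrN ltxx.
by [].
Qed.

(** (MA3) treats a splayed chimney germ and a face; the chimney germ of direction [vface0] based on
    the first face takes the first role. *)
Lemma common_apartment F F' : transported_any (is_face S g) F ->
  transported_any (is_face S g) F' ->
  exists2 A : set M, apartments A & F A /\ F' A.
Proof.
move=> [A aA [f [F0 [fA [x [Fv [vF ->]]] ->]]]] tF'.
have tR : MA3_pair S g (f @ chimney_germ S g (face S g x Fv) vface0) F'.
  split; last by left.
  exists A => //; exists f, (chimney_germ S g (face S g x Fv) vface0); split=> //.
  exists (face S g x Fv), vface0; split=> //.
  - by exists x, Fv.
  - exact: vface0_vface.
  - exact: vface0_spherical.
have [A' aA' [RA' F'A']] := MA3 hM tR; exists A' => //; split=> //.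
exact: chimney_germ_face RA'.
Qed.

(** (MA2) at the point [x] puts its enclosure in both apartments. Roots vanish on [vface0], so the
    face of direction [vface0] at [x] contains that enclosure. *)
Lemma face_in_intersection (A A' : set M) x : apartments A -> apartments A' ->
  A x -> A' x ->
  exists F, [/\ transported (is_face S g) A F,
    forall E, F E -> E x & F (A `&` A')].
Proof.
move=> aA aA' Ax A'x; have [f fA] := chart_exists hM aA.
have [p _ fp] : range f x by rewrite (chart_range hC hM fA).
have MF : MA2_filter S g (globally [set p]) by apply: Or41; exists p.
have [|k [f' [Pp f'A' f'E]]] := MA2_chart hC hM aA fA aA' MF.
  by move=> _ ->; rewrite /= fp.
exists (f @ face S g p vface0); split.
- exists f, (face S g p vface0); split=> //; first by case: fA.
  by exists p, vface0; split=> //; apply: vface0_vface.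
- move=> E [k1 [k1' [Om [pOm PE OmP]]]]; rewrite -fp; apply/PE/OmP; split.
    exact: nbhs_singleton.
  by exists 0; [apply: vface0_0|rewrite addr0].
- exists k, (fun=> None), setT; split; first exact: filterT.
    move=> z Pz; split; first apply: (chart_in hC hM _ fA).
    rewrite /= -f'E; first apply: (chart_in hC hM _ f'A').
    by move=> a Da; have [] := Pz a Da.
  move=> _ [_ [v v0 <-]] a Da; split=> //.
  have := Pp p erefl a Da; case: (k a) => //= m.
  by rewrite evDr (root_vface0 Da v0) addr0.
Qed.

Lemma chart_on_intersection (A A' : set M) f : chart A f -> apartments A' ->
  exists2 f', chart A' f' & forall z, A' (f z) -> f z = f' z.
Proof.
move=> fA aA'; have [f1 f1A'] := chart_exists hM aA'.
pose X : set V := [set z | A' (f z)].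
have [X0|/nonemptyPn X0] := pselect (X !=set0); last first.
  by exists f1 => // z zX; have : X z by []; rewrite X0.
have cX : convex X.
  move=> x y t Xx Xy t01.
  have [x' _ fx] : range f1 (f x) by rewrite (chart_range hC hM f1A').
  have [y' _ fy] : range f1 (f y) by rewrite (chart_range hC hM f1A').
  have : (f @` segment x y) (f (x + t *: (y - x))).
    by exists (x + t *: (y - x)) => //; exists t.
  rewrite (charts_segment hM fA f1A' (esym fx) (esym fy) (preordered_full x y)).
  by move=> [z _ fz]; rewrite /X /= -fz; apply: (chart_in hC hM _ f1A').
have [p Xp] := X0.
have ray q : X q -> exists2 f', chart A' f' & f' p = f p /\ f' q = f q.
  move=> Xq.
  have [|k [f' [e' [e'0 f'A' kE f'E]]]] :=
    germ_chart hC hM (x := p) (y := q) fA aA' (preordered_full p q) ltr01 _.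
    by move=> t /andP[t0 t1]; apply: cX; rewrite ?t0 ?ltW.
  have fp : f' p = f p.
    by apply: f'E; have := kE 0; rewrite scale0r addr0; apply; rewrite lexx.
  exists f' => //; split=> //; apply/esym.
  pose t := Num.min (e' / 2) 1.
  have t0 : 0 < t by rewrite lt_min ltr01 divr_gt0.
  have te : t < e' by rewrite (@le_lt_trans _ _ (e' / 2)) ?ge_min ?lexx //; lra.
  have t1 : t <= 1 by rewrite ge_min lexx orbT.
  apply: (charts_agree_extend hC hM hnorm (x := p) (t := t) fA f'A').
  - by [].
  - by rewrite t0.
  - by apply/esym/f'E/kE; rewrite ltW.
  - exact: Xq.
  - exact: preordered_full.
have [f2 f2A' [f2p _]] := ray p Xp.
have /finite_seqP[s sE] := Wfin.
have sP u : weyl S u -> u \in s by move=> us; have : [set` s] u by rewrite -sE.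
(* All charts of [A'] that agree with [f] at [p] differ by an affine Weyl element fixing [p], hence
   are of the form [f2 \o rot w], with finitely many [w]. *)
pose rot (w : 'M[R]_n) (z : V) := w *m (z - p) + p.
pose Y (w : 'M[R]_n) : set V := [set q | chart A' (f2 \o rot w) /\ f q = f2 (rot w q)].
have [ | |w _ XY] := @flat_cover R n _ X Y s cX X0.
(* Between the two points of agreement (MAO) interpolates; beyond either of them the agreement is
   extended from the opposite one. *)
- move=> w1 q1 q2 r [cw fq1] [_ fq2] q12 Xz; split=> //.
  have [r0|r0] := ltP r 0.
    have zE : q2 + (1 - r)^-1 *: (q1 + r *: (q2 - q1) - q2) = q1.
      have r1 : 1 - r != 0 by rewrite gt_eqF //; lra.
      by apply/colP => i; rewrite !mxE; field.
    apply: (charts_agree_extend hC hM hnorm (x := q2) (t := (1 - r)^-1) fA cw) => //.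
    - have r1 : 0 < 1 - r by lra.
      by rewrite invr_gt0 r1 invf_le1 //; lra.
    - by rewrite zE.
    - exact: preordered_full.
  have [r1|r1] := leP r 1.
    by apply: (charts_agree_segment hM hnorm fA cw) => //; [apply: preordered_full|rewrite r0].
  have zE : q1 + r^-1 *: (q1 + r *: (q2 - q1) - q1) = q2.
    have r2 : r != 0 by rewrite gt_eqF //; lra.
    by apply/colP => i; rewrite !mxE; field.
  apply: (charts_agree_extend hC hM hnorm (x := q1) (t := r^-1) fA cw) => //.
  - have r2 : 0 < r by lra.
    by rewrite invr_gt0 r2 invf_le1 //; lra.
  - by rewrite zE.
  - exact: preordered_full.
- move=> q Xq; have [f' f'A' [f'p f'q]] := ray q Xq.
  have [u [w [t [wW tQ uE]]] f'E] := chart_trans hC hM f2A' f'A'.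
  have up : u p = p by apply: (chart_inj hC hM f2A'); rewrite f2p -f'p f'E.
  have f'rot : f' = f2 \o rot w.
    rewrite f'E; congr (f2 \o _); apply/funext => z.
    have wp : w *m p + t = p by move: up; rewrite uE.
    have tE : t = p - w *m p by rewrite -{1}wp [RHS]addrC addKr.
    by rewrite uE /rot tE mulmxBr -addrA [- _ + _]addrC.
  exists w; first exact: sP.
  by split; [rewrite -f'rot|rewrite -f'q f'rot].
exists (f2 \o rot w); first by have [] := XY p Xp.
by move=> z Xz; have [] := XY z Xz.
Qed.

Lemma transported_face_intersection F (A A' : set M) :
  transported_any (is_face S g) F -> F A -> F A' -> F (A `&` A').
Proof. by move=> [A1 _ [f [F0 [_ [x [Fv [_ ->]]] ->]]]] FA FA'; apply: faceI. Qed.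

Lemma intersection_isomorphism (A A' : set M) : apartments A -> apartments A' ->
  exists2 phi, weyl_isom S A A' phi & forall x, A x -> A' x -> phi x = x.
Proof.
move=> aA aA'; have [f fA] := chart_exists hM aA.
have [f' f'A' ff'] := chart_on_intersection fA aA'.
(* The map [f' \o f^-1] on [A], with the identity as default value elsewhere; [weyl_isom] concerns
   only the points of [A]. *)
pose phi x := if pselect (exists z, f z = x) is left e then f' (projT1 (cid e)) else x.
have phiE z : phi (f z) = f' z.
  rewrite /phi; case: pselect => [e|]; last by case; exists z.
  by congr f'; case: cid => z' /= /(chart_inj hC hM fA).
exists phi; last first.
  move=> x Ax A'x; have [z _ fz] : range f x by rewrite (chart_range hC hM fA).
  by rewrite -fz phiE -ff' // fz.
move=> f1 f1' f1A f1'A'.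
have [u uW ->] := chart_trans hC hM fA (conj aA f1A).
have [v vW f'E] := chart_trans hC hM (conj aA' f1'A') f'A'.
exists (v \o u); first exact: affine_weyl_comp.
by move=> x /=; rewrite phiE f'E.
Qed.

Lemma finite_weyl_building : is_building S g M.
Proof.
split=> //.
- exact: common_apartment.
- move=> A A' F F' aA aA' tF tF' FA F'A FA' F'A'.
  have [phi phiW phiE] := intersection_isomorphism aA aA'.
  exists phi => //; exists ((A `&` A') `|` (A `&` A')).
    exists (A `&` A'), (A `&` A'); split=> //; exact: transported_face_intersection.
  by move=> x [[? ?]|[? ?]]; apply: phiE.
- by move=> A A' x aA aA' Ax A'x; apply: face_in_intersection.
Qed.

End FiniteWeylGroup.

Theorem proposition12 (R : realType) (I : finType) (C : I -> I -> int)
  (hC : kac_moody_matrix C) (n : nat) (S : root_datum C n)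
  (g : kac_moody_algebra R[i] C)
  (M : apartment_system R n) (hM : is_masure S g M)
  (hpanels : thick_finite_panels S g M)
  (G : groupType) (act : G -> M -> M)
  (hact : strongly_transitive S g act)
  (A0 : set M) (hA0 : apartments A0)
  (iota : 'cV[R]_n -> M) (hiota : isomW A0 iota)
  (hstab : stabilizer_induces S act A0 iota)
  (d : M -> M -> R) (hd : is_distance d)
  (hnorm : forall A : set M, apartments A -> induced_by_norm d A) :
  is_building S g M /\
  forall u, affine_weyl S u ->
    forall x y, d (iota (u x)) (iota (u y)) = d (iota x) (iota y).
Proof.
have iA0 : chart A0 iota by [].
have [N hN iN] := chart_norm hnorm iA0.
have NW := weyl_isometry hC hM hd hnorm hpanels iA0 hN iN.
split.
  apply: (finite_weyl_building hC hM hnorm).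
  apply: sub_finite_set (finite_isometries S hN) => w wW.
  by split=> //; apply: NW.
move=> u [w [q [wW _ ->]]] x y.
by rewrite !iN opprD addrACA subrr addr0 -mulmxBr NW.
Qed.
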